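(* Let $u$ be a minimizer of $J_a$ among functions in $W^{1,2}(D^+,x_n^a)$ with $u=g$ on $(\partial D)^+$, and suppose $u\ge0$ on $D'$. Then $v(x)=u(x)-\frac{\lambda_+}{1-a}x_n^{1-a}$ is a minimizer of $$E_a(v)=\int_{D^+}|\nabla v|^2x_n^a\,dx$$ among all functions $v\in W^{1,2}(D^+,x_n^a)$ satisfying $v=h$ on $(\partial D)^+$ and $v\ge\phi$ on $D'$, where $h(x)=g(x)-\frac{\lambda_+}{1-a}x_n^{1-a}$ and $\phi=0$.
   Context: $D\subset\mathbb{R}^n$ is a bounded domain, $D^+=D\cap\{x_n>0\}$, $D'=D\cap\{x_n=0\}$, $(\partial D)^+=\partial D\cap\{x_n>0\}$. Here $a\in(-1,1)$, $\lambda_+,\lambda_->0$; $u^\pm=\max\{\pm u,0\}$. $W^{1,2}(D^+,x_n^a)$ is the weighted Sobolev space of functions that, together with their first distributional derivatives, are square integrable on $D^+$ with respect to $x_n^a\,dx$. The energy is $$J_a(u)=\int_{D^+}|\nabla u|^2x_n^a\,dx+2\int_{D'}(\lambda_+u^++\lambda_-u^-)\,dx'.$$ Values on $(\partial D)^+$ and $D'$ are in the sense of traces ($D$ is assumed regular enough for the traces to exist, e.g. there is a bi-Lipschitz map taking $(D,D')$ to $(B_1,B_1')$).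
   Formalization: Adds that ∂D∩{x_n=0} has zero (n−1)-dimensional measure and (∂D)^+ finite measure; without the first the claim fails, e.g. D=B_1∪{0<x_n<1/2,|x'|<2}. Domains flat only from below are covered after trimming D in {x_n<0}. *)

(* Defs.v *)
From HB Require Import structures.
From mathcomp Require Import all_boot all_order all_algebra.
From mathcomp Require Import all_classical all_reals all_analysis.

Set Implicit Arguments.
Unset Strict Implicit.
Unset Printing Implicit Defensive.

Import Order.TTheory GRing.Theory Num.Theory.
Import numFieldNormedType.Exports.

Local Open Scope classical_set_scope.
Local Open Scope ring_scope.

(* Points of R^n are row vectors.  The Borel sigma-algebra of R^n is presented
   as the product one, i.e. generated by the coordinate functions. *)
Section measurable_rV.
Context {R : realType} {n : nat}.

Definition rV_coor (i : 'I_n) (x : 'rV[R]_n) : measurableTypeR R := x ord0 i.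

Let rV_set0 : g_sigma_preimage rV_coor set0.
Proof. exact: sigma_algebra0. Qed.

Let rV_setC A : g_sigma_preimage rV_coor A -> g_sigma_preimage rV_coor (~` A).
Proof. exact: sigma_algebraC. Qed.

Let rV_bigcup (F : _^nat) : (forall i, g_sigma_preimage rV_coor (F i)) ->
  g_sigma_preimage rV_coor (\bigcup_i (F i)).
Proof. exact: sigma_algebra_bigcup. Qed.

HB.instance Definition _ := @isMeasurable.Build
  (measure_tuple_display default_measure_display)
  'rV[R]_n (g_sigma_preimage rV_coor) rV_set0 rV_setC rV_bigcup.

End measurable_rV.

Section lebesgue_rV.
Context {R : realType}.

Definition snoc n (y : 'rV[R]_n) (t : R) : 'rV[R]_n.+1 :=
  \row_i if unlift ord_max i is Some j then y ord0 j else t.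

Lemma measurable_rV_coor n (i : 'I_n) :
  measurable_fun [set: 'rV[R]_n] (rV_coor i).
Proof.
move=> _ Y mY; rewrite setTI; apply: sub_sigma_algebra => /=.
rewrite -bigcup_seq/=; exists i => /=; first by rewrite mem_index_enum.
by exists Y => //; rewrite setTI.
Qed.

Lemma measurable_snoc n : measurable_fun [set: 'rV[R]_n * measurableTypeR R]
  (fun p => snoc p.1 p.2).
Proof.
move=> _; apply: (@measurability _ _ _ _ _ _
  (\big[setU/set0]_(i < n.+1)
     preimage_set_system [set: 'rV[R]_n.+1] (rV_coor i) measurable)) => //.
move=> _ [B + <-]; rewrite -bigcup_seq => -[i _ [Y mY <-]].
rewrite !setTI -comp_preimage -[X in measurable X]setTI.
suff : measurable_fun [set: 'rV[R]_n * measurableTypeR R]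
    (rV_coor i \o (fun p => snoc p.1 p.2)) by apply.
case: (unliftP ord_max i) => [j|] ->.
- rewrite (_ : _ \o _ = rV_coor j \o fst).
    exact: measurableT_comp (measurable_rV_coor j) measurable_fst.
  by apply/funext => p; rewrite /= /rV_coor /snoc mxE liftK.
- rewrite (_ : _ \o _ = snd); first exact: measurable_snd.
  by apply/funext => p; rewrite /= /rV_coor /snoc mxE unlift_none.
Qed.

(* The product of a measure on R^n with the Lebesgue measure on R. *)
Definition prod_lebesgue n (mu : {measure set 'rV[R]_n -> \bar R}) :
    set 'rV[R]_n.+1 -> \bar R :=
  pushforward (mu \x @lebesgue_measure R)%E (fun p => snoc p.1 p.2).

Section prod_lebesgue_measure.
Variables (n : nat) (mu : {measure set 'rV[R]_n -> \bar R}).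
Let m : {measure set ('rV[R]_n * measurableTypeR R) -> \bar R} :=
  (mu \x @lebesgue_measure R)%E.

HB.instance Definition _ := Measure.copy (prod_lebesgue mu)
  (measure_function_pushforward__canonical__measure_function_Measure
     m (@measurable_snoc n)).
End prod_lebesgue_measure.

Fixpoint lebesgue_rV n : {measure set 'rV[R]_n -> \bar R} :=
  match n with
  | 0 => dirac (0 : 'rV[R]_0)
  | m.+1 => prod_lebesgue (lebesgue_rV m)
  end.

End lebesgue_rV.

Section hausdorff.
Context {R : realType} {n : nat}.
Local Open Scope ereal_scope.
Implicit Types (A : set 'rV[R]_n) (s : nat) (e : R).

Definition enorm (x : 'rV[R]_n) : R := Num.sqrt (\sum_i x ord0 i ^+ 2)%R.

(* equal to -oo on the empty set *)
Definition diam A : \bar R :=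
  ereal_sup [set (enorm (p.1 - p.2))%:E | p in A `*` A].

(* The convention that the empty set has gauge 0 matters only for s = 0. *)
Definition hausdorff_gauge s e A : \bar R :=
  if `[< A = set0 >] then 0 else
  if diam A <= e%:E then diam A ^+ s else +oo.

(* Every set is measurable in [g_sigma_algebraType setT], so that the infimum
   hidden in [mu_ext] is over all countable covers; those that involve a set of
   diameter greater than e do not contribute. *)
Definition hausdorff_delta s e : set 'rV[R]_n -> \bar R :=
  @mu_ext _ (g_sigma_algebraType [set: set 'rV[R]_n]) R (hausdorff_gauge s e).

(* The s-dimensional Hausdorff outer measure, up to the usual normalising
   constant: it is used below only through its null sets, through finiteness
   and through convergence in L^1. *)
Definition hausdorff s A : \bar R :=
  ereal_sup [set hausdorff_delta s e A | e in [set e : R | (0 < e)%R]].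

Lemma diam_ge0 A : A !=set0 -> 0 <= diam A.
Proof.
move=> [x Ax]; apply: ereal_sup_ubound; exists (x, x) => //=.
rewrite subrr /enorm big1 ?sqrtr0// => i _.
by rewrite mxE expr0n.
Qed.

Lemma hausdorff_gauge0 s e : hausdorff_gauge s e set0 = 0.
Proof. by rewrite /hausdorff_gauge asboolT. Qed.

Lemma hausdorff_gauge_ge0 s e A : 0 <= hausdorff_gauge s e A.
Proof.
rewrite /hausdorff_gauge; case: ifPn => // /asboolPn /eqP /set0P A0.
by case: ifPn => // _; rewrite expe_ge0// diam_ge0.
Qed.

Lemma hausdorff_delta_ge0 s e A : 0 <= hausdorff_delta s e A.
Proof. by apply: mu_ext_ge0 => *; exact: hausdorff_gauge_ge0. Qed.

Lemma hausdorff0 s : hausdorff s set0 = 0.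
Proof.
rewrite /hausdorff [X in ereal_sup X](_ : _ = [set 0]) ?ereal_sup1//.
have h0 e : hausdorff_delta s e set0 = 0.
  by apply: mu_ext0 => *; [exact: hausdorff_gauge0|exact: hausdorff_gauge_ge0].
by apply/seteqP; split => [_ [e _ <-]|_ ->] /=; [|exists 1%R].
Qed.

Lemma hausdorff_ge0 s A : 0 <= hausdorff s A.
Proof.
apply: le_trans (hausdorff_delta_ge0 s 1%R A) _.
by apply: ereal_sup_ubound; exists 1%R => /=.
Qed.

Lemma le_hausdorff s : {homo hausdorff s : A B / A `<=` B >-> A <= B}.
Proof.
move=> A B AB; apply: ge_ereal_sup => _ [e e0 <-].
apply: le_trans (_ : hausdorff_delta s e B <= _).
  exact: (@le_mu_ext _ (g_sigma_algebraType [set: set 'rV[R]_n])).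
by apply: ereal_sup_ubound; exists e.
Qed.

Lemma hausdorff_sigma_subadditive s : sigma_subadditive (hausdorff s).
Proof.
move=> F; apply: ge_ereal_sup => _ [e e0 <-].
apply: (@le_trans _ _ (\sum_(i <oo) hausdorff_delta s e (F i))).
  by apply: mu_ext_sigma_subadditive => *; exact: hausdorff_gauge_ge0.
apply: lee_nneseries => [i _ _|i _]; first exact: hausdorff_delta_ge0.
by apply: ereal_sup_ubound; exists e.
Qed.

HB.instance Definition _ s := isOuterMeasure.Build R 'rV[R]_n (hausdorff s)
  (hausdorff0 s) (hausdorff_ge0 s) (@le_hausdorff s)
  (@hausdorff_sigma_subadditive s).

End hausdorff.

(* From here on the ambient space is R^(n+1), its last coordinate plays the role
   of x_n, and {x_n = 0} is identified with R^n through [snoc ^~ 0]. *)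
Section domain.
Context {R : realType} {n : nat}.
Implicit Types (D : set 'rV[R]_n.+1).

Definition xn (x : 'rV[R]_n.+1) : R := x ord0 ord_max.

Definition upper D : set 'rV[R]_n.+1 := D `&` [set x | 0 < xn x].

Definition thin D : set 'rV[R]_n := [set y | D (snoc y 0)].

Definition frontier D : set 'rV[R]_n.+1 := closure D `\` interior D.

Definition upper_frontier D : set 'rV[R]_n.+1 :=
  frontier D `&` [set x | 0 < xn x].

Definition bounded_domain D : Prop :=
  [/\ D !=set0, open D, connected D & bounded_set D].

Definition surface_outer : {outer_measure set 'rV[R]_n.+1 -> \bar R} :=
  hausdorff n.

Definition surface_measure :
    {measure set (caratheodory_type surface_outer) -> \bar R} :=
  (surface_outer : set (caratheodory_type surface_outer) -> \bar R).

End domain.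

Section smooth.
Context {R : realType} {n : nat}.

Definition partial (i : 'I_n) (f : 'rV[R]_n -> R) : 'rV[R]_n -> R :=
  fun x => 'D_(delta_mx ord0 i) f x.

(* C^infty(R^n): all iterated partial derivatives are differentiable. *)
Definition smooth (f : 'rV[R]_n -> R) : Prop :=
  forall (s : seq 'I_n) x, differentiable (foldr partial f s) x.

Definition test_function (U : set 'rV[R]_n) (f : 'rV[R]_n -> R) : Prop :=
  smooth f /\
  exists K, [/\ compact K, K `<=` U & forall x, ~ K x -> f x = 0].

End smooth.

Section sobolev.
Context {R : realType} {n : nat}.
Variables (D : set 'rV[R]_n.+1) (a : R).
Local Open Scope ereal_scope.
Implicit Types (u f T : 'rV[R]_n.+1 -> R) (G : 'rV[R]_n.+1 -> 'rV[R]_n.+1).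

Definition wsqnorm f : \bar R :=
  \int[lebesgue_rV n.+1]_(x in upper D) (f x ^+ 2 * xn x `^ a)%:E.

Definition wL2 f : Prop := measurable_fun (upper D) f /\ wsqnorm f < +oo.

Definition weak_partial (i : 'I_n.+1) u f : Prop :=
  forall eta, test_function (upper D) eta ->
    \int[lebesgue_rV n.+1]_(x in upper D) (u x * partial i eta x)%:E =
    - \int[lebesgue_rV n.+1]_(x in upper D) (f x * eta x)%:E.

Definition is_weak_gradient u G : Prop :=
  forall i, wL2 (fun x => G x ord0 i) /\
            weak_partial i u (fun x => G x ord0 i).

(* W^{1,2}(D^+, x_n^a) *)
Definition W12 u : Prop := wL2 u /\ exists G, is_weak_gradient u G.

(* a representative of the weak gradient, which is unique almost everywhere *)
Definition weak_gradient u : 'rV[R]_n.+1 -> 'rV[R]_n.+1 :=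
  get (is_weak_gradient u).

(* Convergence in the norm of W^{1,2}(D^+, x_n^a) of functions that are smooth
   in the whole space. *)
Definition W12_cvg (phi : nat -> 'rV[R]_n.+1 -> R) u : Prop :=
  wsqnorm (fun x => phi k x - u x)%R @[k --> \oo] --> 0 /\
  forall i, wsqnorm (fun x => partial i (phi k) x - weak_gradient u x ord0 i)%R
    @[k --> \oo] --> 0.

(* [T] is a trace of [u] on the part of the boundary of D^+ made of (dD)^+ and
   D': the restrictions to it of smooth functions that converge to [u] in
   W^{1,2}(D^+, x_n^a) converge to [T] in L^1.  For a Lipschitz domain L^1 is
   always suitable since W^{1,2}(D^+, x_n^a) embeds in W^{1,1}(D^+). *)
Definition is_trace u T : Prop :=
  [/\ surface_measure.-integrable (upper_frontier D) (EFin \o T),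
      (lebesgue_rV n).-integrable (thin D) (fun y => (T (snoc y 0))%:E) &
      exists phi : nat -> 'rV[R]_n.+1 -> R,
        [/\ forall k, smooth (phi k), W12_cvg phi u,
            \int[surface_measure]_(x in upper_frontier D)
              `|phi k x - T x|%:E @[k --> \oo] --> 0 &
            \int[lebesgue_rV n]_(y in thin D)
              `|phi k (snoc y 0) - T (snoc y 0)|%:E @[k --> \oo] --> 0]].

Definition eq_on_upper_frontier u T : Prop :=
  {ae surface_measure, forall x, upper_frontier D x -> u x = T x}.

(* D is regular enough for traces: (dD)^+ has finite surface measure, (dD)^+
   and D' exhaust the boundary of D^+ up to a null set, and every function of
   the Sobolev space has one and only one trace.  The second clause excludes
   domains such as D = B_1 `|` {0 < x_n < 1/2, |x'| < 2}, for which the boundary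
   of D^+ has a flat part where neither D' nor (dD)^+ prescribes anything. *)
Definition trace_regular : Prop :=
  [/\ surface_measure (upper_frontier D) < +oo,
      surface_measure (frontier D `&` [set x | xn x = 0%R]) = 0 &
      forall u, W12 u -> exists T, is_trace u T /\
        forall T', is_trace u T' -> eq_on_upper_frontier T T' /\
          {ae lebesgue_rV n, forall y, thin D y -> T (snoc y 0) = T' (snoc y 0)}].

Definition trace u : 'rV[R]_n.+1 -> R := get (is_trace u).

Definition has_boundary_values g u : Prop :=
  eq_on_upper_frontier (trace u) g.

(* u >= psi on D' *)
Definition above_on_thin (psi : 'rV[R]_n -> R) u : Prop :=
  {ae lebesgue_rV n, forall y, thin D y -> (psi y <= trace u (snoc y 0))%R}.

Definition Ea u : \bar R :=
  \int[lebesgue_rV n.+1]_(x in upper D)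
    ((\sum_i weak_gradient u x ord0 i ^+ 2) * xn x `^ a)%:E.

Definition Ja (lp lm : R) u : \bar R :=
  Ea u + 2%:E * \int[lebesgue_rV n]_(y in thin D)
    (lp * Num.max (trace u (snoc y 0)) 0 +
     lm * Num.max (- trace u (snoc y 0)) 0)%:E.

End sobolev.

Definition minimizer (T : Type) (R : realType) (J : T -> \bar R) (K : set T)
  (u : T) : Prop := K u /\ forall w, K w -> (J u <= J w)%E.

(* Main.v *)
(** Write p for lambda_+/(1-a) x_n^(1-a), whose weighted gradient x_n^a grad p is
    the constant vector lambda_+ e_n and whose trace vanishes on D'.  If w competes
    with v, then w + p competes with u, and for functions with nonnegative values
    on D' expanding the square gives
      J_a(w + p) = E_a(w) + 2 lambda_+ (int_(D^+) d_n w + int_(D') w) + const.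
    The bracket depends only on the values of w on (dD)^+, by the divergence theorem
    in the direction e_n, so minimality of u for J_a passes to v for E_a.

    No smoothness of D is available for that divergence theorem.  It is replaced by
    the inequality
      |int_(D^+) d_n f + int_(D') f| <= C int_((dD)^+) |f| dH^n   (f smooth),
    obtained by translating D^+ vertically by h: the points of D^+ that enter or
    leave lie on vertical segments of length h meeting (dD)^+, and a cover of
    (dD)^+ by small sets shows that such segments over a set B fill a volume of at
    most C h H^n(B).  Applied to smooth approximations of a function with zero
    trace on (dD)^+ it yields the required identity. *)

Require Import Defs.
From HB Require Import structures.
From mathcomp Require Import all_boot all_order all_algebra.
From mathcomp Require Import all_classical all_reals all_analysis.
From mathcomp Require Import measurable_realfun.
From mathcomp Require Import ring lra zify.

Set Implicit Arguments.
Unset Strict Implicit.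
Unset Printing Implicit Defensive.

Import Order.TTheory GRing.Theory Num.Theory.
Import numFieldNormedType.Exports.

Local Open Scope classical_set_scope.
Local Open Scope ring_scope.

(** * Borel sets and Lebesgue measure on R^n *)

(** Boundedness of D and |a| < 1 give two facts about powers of the last coordinate: x_n^a has
    finite integral on [upper D], and so has x_n^(-a). The second turns weighted L^2 convergence of
    gradients into plain L^1 convergence of d_n, which is all that the unweighted flux sees; only
    the vertical component matters because grad p is vertical. The constant C in the divergence
    inequality is crude, and this is harmless: the inequality is applied only when its right-hand
    side tends to 0. The term on D' comes out of the same translation. The layer 0 < x_n <= h of D,
    divided by h, averages f along vertical segments that start on {x_n = 0}; the averages converge
    wherever (y, 0) is off the frontier of D, and [trace_regular] makes the exceptional set null.
    [weak_gradient] and [trace] are values of [get], so they are linear only almost everywhere. For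
    gradients this rests on the fundamental lemma of the calculus of variations, for traces on the
    uniqueness clause of [trace_regular]. Finally p is not smooth at x_n = 0, so its trace has to be
    exhibited through smooth approximations. *)

Section borel.
Context {R : realType} {n : nat}.
Implicit Types (V : set 'rV[R]_n) (q : 'rV[R]_n) (r : R).

Definition ocube q r : set 'rV[R]_n := [set x | forall i, `|x ord0 i - q ord0 i| < r].
Definition ccube q r : set 'rV[R]_n := [set x | forall i, `|x ord0 i - q ord0 i| <= r].

Lemma ocubeE q r : 0 < r -> ocube q r = ball q r.
Proof.
move=> r0; apply/seteqP; split => x /=.
  move=> xq; split => // i j; rewrite (ord1 i) /ball /= distrC; exact: xq.
by case=> _ xq i; have := xq ord0 i; rewrite /ball /= distrC.
Qed.

Lemma bigcap_coorE (F : 'I_n -> set R) :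
  [set x : 'rV[R]_n | forall i, F i (x ord0 i)] = \bigcap_(i in setT) (rV_coor i @^-1` F i).
Proof.
by apply/seteqP; split => x /= H i; [move=> _; exact: H|exact: (H i I)].
Qed.

Lemma measurable_coord (i : 'I_n) : measurable_fun setT (fun x : 'rV[R]_n => x ord0 i).
Proof. exact: measurable_rV_coor. Qed.

Lemma measurable_coor_box (F : 'I_n -> set R) : (forall i, measurable (F i)) ->
  measurable [set x : 'rV[R]_n | forall i, F i (x ord0 i)].
Proof.
move=> mF; rewrite bigcap_coorE; apply: fin_bigcap_measurable; [exact: finite_finset|move=> i _].
by rewrite -[X in measurable X]setTI; exact: (@measurable_coord i measurableT _ (mF i)).
Qed.

Lemma measurable_ocube q r : measurable (ocube q r).
Proof.
apply: (measurable_coor_box (F := fun i => [set t | `|t - q ord0 i| < r])) => i.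
rewrite (_ : [set t | _] = `]q ord0 i - r, q ord0 i + r[%classic) //.
by apply/seteqP; split => t; rewrite /= in_itv/= ltr_distl.
Qed.

(** Rational centres and radii 1/(m+1) make the cubes countable. Asking that the closed cube lie in
    [V] is what later makes bump functions on these cubes compactly supported in [V]. Codes that
    name no such cube give the empty set. *)
Lemma open_ocubes V : open V -> exists C : nat -> set 'rV[R]_n,
  V = \bigcup_k C k /\ forall k, C k = set0 \/
    exists q r, [/\ 0 < r, C k = ocube q r & ccube q r `<=` V].
Proof.
move=> oV.
pose P (p : 'rV[rat]_n * nat) := ccube (map_mx ratr p.1) (p.2.+1%:R^-1) `<=` V.
pose C k := if (unpickle k : option ('rV[rat]_n * nat)) is Some p then
  if `[< P p >] then ocube (map_mx ratr p.1) (p.2.+1%:R^-1) else set0 else set0.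
exists C; split; last first.
  move=> k; rewrite /C; case: unpickle => [p|]; last by left.
  by case: asboolP => [Pp|_]; [right|left] => //; exists (map_mx ratr p.1), p.2.+1%:R^-1.
apply/seteqP; split => [x Vx|x [k _]]; last first.
  rewrite /C; case: unpickle => [p|//]; case: asboolP => [Pp|//] xp.
  by apply: Pp => i; exact/ltW/xp.
have /nbhs_ballP[e /= e0 xe] : nbhs x V by exact: open_nbhs_nbhs.
(* A cube of radius 1/(m+1) whose centre is that close to [x] in each coordinate stays within
   2/(m+1) < e of [x]. *)
have [m me] : exists m : nat, m.+1%:R^-1 < e / 2.
  have [m _ Hm] := near_infty_natSinv_lt (PosNum (divr_gt0 e0 (ltr0n _ 2))).
  by exists m; apply: Hm => /=.
have /choice[q qx] : forall i, exists y : rat, (ratr y : R) \in `]x ord0 i - m.+1%:R^-1, x ord0 i + m.+1%:R^-1[.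
  move=> i; apply: rat_in_itvoo; rewrite ltrBlDr -addrA ltrDl addr_gt0//.
have qx' i : `|x ord0 i - ratr (q i)| < m.+1%:R^-1.
  by have := qx i; rewrite in_itv /= -ltr_distl distrC.
exists (pickle ((\row_i q i, m) : 'rV[rat]_n * nat)) => //.
rewrite /C pickleK; case: asboolP => [_ i|[]] /=; first by rewrite !mxE.
move=> z zq; apply: xe; rewrite -ocubeE// => i; have := zq i; rewrite !mxE /= => zi.
rewrite -(subrK (ratr (q i)) (z ord0 i)) -addrA (le_lt_trans (ler_normD _ _))//.
rewrite (splitr e) ltrD//; first exact: le_lt_trans me.
by rewrite distrC (lt_trans _ me).
Qed.

Lemma open_measurable_rV V : open V -> measurable V.
Proof.
move=> /open_ocubes[C [-> HC]]; apply: bigcupT_measurable => k.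
have [->//|[q [r [_ -> _]]]] := HC k; exact: measurable_ocube.
Qed.

Lemma closed_measurable_rV V : closed V -> measurable V.
Proof.
by move=> cV; rewrite -(setCK V); apply: measurableC; apply: open_measurable_rV; exact: closed_openC.
Qed.

Lemma continuous_measurable_rV (f : 'rV[R]_n -> R) : continuous f -> measurable_fun setT f.
Proof.
move=> /continuousP cf; apply: (measurability _ (measurable_realfun.RGenOpens.measurableE R)).
move=> _ [_ [a [b ->]] <-]; rewrite setTI; apply: open_measurable_rV.
by apply: cf; exact: interval_open.
Qed.

Lemma continuous_coor (i : 'I_n) : continuous (rV_coor i : 'rV[R]_n -> R).
Proof. by move=> x; exact: coord_continuous. Qed.

(** Opens are stable under intersection, so this form of the product sigma-algebra is the one on
    which Dynkin induction can run. *)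
Lemma measurable_open_rV : measurable = <<s @open 'rV[R]_n >> :> set (set 'rV[R]_n).
Proof.
apply/seteqP; split; last first.
  by apply: smallest_sub; [exact: sigma_algebra_measurable|exact: open_measurable_rV].
apply: smallest_sub; first exact: smallest_sigma_algebra.
move=> A; rewrite -bigcup_seq => -[i _ [Y mY <-]]; rewrite setTI.
suff : measurable_fun (setT : set (g_sigma_algebraType (@open 'rV[R]_n)))
    (fun x => x ord0 i : R).
  by move=> /(_ measurableT _ mY); rewrite setTI.
apply: (measurability _ (measurable_realfun.RGenOpens.measurableE R)).
move=> _ [_ [a [b ->]] <-]; rewrite setTI; apply: sub_sigma_algebra.
by move/continuousP: (@continuous_coor i); apply; exact: interval_open.
Qed.
End borel.

Section snoc.
Context {R : realType} {n : nat}.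
Implicit Types (y : 'rV[R]_n) (x : 'rV[R]_n.+1) (t : R).

Definition initv x : 'rV[R]_n := \row_j x ord0 (lift ord_max j).

Lemma snoc_lift y t j : snoc y t ord0 (lift ord_max j) = y ord0 j.
Proof. by rewrite mxE liftK. Qed.

Lemma snoc_max y t : snoc y t ord0 ord_max = t.
Proof. by rewrite mxE unlift_none. Qed.

Lemma xn_snoc y t : xn (snoc y t) = t.
Proof. exact: snoc_max. Qed.

Lemma initv_snoc y t : initv (snoc y t) = y.
Proof. by apply/rowP => j; rewrite mxE snoc_lift. Qed.

Lemma forall_lift (P : 'I_n.+1 -> Prop) :
  (forall i, P i) <-> (forall j, P (lift ord_max j)) /\ P ord_max.
Proof.
split=> [H|[H0 H1] i]; first by split.
by case: (unliftP ord_max i) => [j|] ->.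
Qed.

Lemma measurable_snocl y : measurable_fun setT (snoc y).
Proof.
have := measurableT_comp (@measurable_snoc R n) (@pair1_measurable _ _ _ (measurableTypeR R) y).
exact.
Qed.

End snoc.

Section lebesgue_rV.
Context {R : realType}.
Local Notation mu := (@lebesgue_rV R).
Local Open Scope ereal_scope.

Lemma lebesgue_rVS n (A : set 'rV[R]_n.+1) :
  mu n.+1 A = (mu n \x @lebesgue_measure R) ((fun p => snoc p.1 p.2) @^-1` A).
Proof. by []. Qed.

Lemma lebesgue_rV_cyl n (A : set 'rV[R]_n) (B : set R) : measurable A -> measurable B ->
  mu n.+1 [set x : 'rV[R]_n.+1 | A (initv x) /\ B (xn x)] = mu n A * lebesgue_measure B.
Proof.
move=> mA mB; rewrite lebesgue_rVS -product_measure1E//; congr (_ _).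
by apply/seteqP; split => -[y t] /=; rewrite initv_snoc xn_snoc.
Qed.

Lemma lebesgue_rV_box n (F : 'I_n -> set R) : (forall i, measurable (F i)) ->
  mu n [set x : 'rV[R]_n | forall i, F i (x ord0 i)] = \prod_(i < n) lebesgue_measure (F i).
Proof.
elim: n F => [F mF|n IH F mF].
  rewrite big_ord0 /= diracE mem_set//=; by case.
rewrite big_ord_recr.
have -> : [set x : 'rV[R]_n.+1 | forall i, F i (x ord0 i)] =
    [set x | [set y : 'rV[R]_n | forall j, F (lift ord_max j) (y ord0 j)] (initv x) /\
   F ord_max (xn x)].
  apply/seteqP; split => x /=.
    by move=> /forall_lift[H1 H2]; split => // j; rewrite mxE.
  by move=> [H1 H2]; apply/forall_lift; split => // j; have := H1 j; rewrite mxE.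
rewrite (lebesgue_rV_cyl (measurable_coor_box (F := fun j => F (lift ord_max j))
  (fun j => mF _)) (mF ord_max)) (IH (fun j => F (lift ord_max j)))//.
congr (_ * _); apply: eq_bigr => i _; congr (lebesgue_measure (F _)).
by apply: val_inj; rewrite /= /bump leqNgt ltn_ord.
Qed.

Lemma measurable_ccube n (q : 'rV[R]_n) r : measurable (ccube q r).
Proof.
apply: (measurable_coor_box (F := fun i => [set t | `|t - q ord0 i| <= r]%R)) => i.
rewrite (_ : [set t | _] = `[(q ord0 i - r)%R, (q ord0 i + r)%R]%classic) //.
by apply/seteqP; split => t; rewrite /= in_itv/= ler_distl.
Qed.

Lemma lebesgue_ccube n (q : 'rV[R]_n) r : (0 <= r)%R ->
  mu n (ccube q r) = ((2 * r) ^+ n)%:E.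
Proof.
move=> r0.
rewrite (lebesgue_rV_box (F := fun i => [set t | `|t - q ord0 i| <= r]%R)); last first.
  move=> i; rewrite (_ : [set t | _] = `[(q ord0 i - r)%R, (q ord0 i + r)%R]%classic) //.
  by apply/seteqP; split => t; rewrite /= in_itv/= ler_distl.
rewrite (eq_bigr (fun=> (2 * r)%:E)); last first.
  move=> i _; rewrite (_ : [set t | _] = `[(q ord0 i - r)%R, (q ord0 i + r)%R]%classic); last first.
    by apply/seteqP; split => t; rewrite /= in_itv/= ler_distl.
  rewrite lebesgue_measure_itv/= lte_fin.
  case: ifPn => [_|]; first by rewrite -EFinB; congr _%:E; ring.
  rewrite -leNgt => h; congr _%:E; lra.
by rewrite prodEFin prodr_const card_ord.
Qed.

Lemma lebesgue_rV_sigma_finite n : sigma_finite setT (mu n).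
Proof.
exists (fun k => ccube 0%R k%:R).
  apply/seteqP; split => // x _; exists (Num.truncn (\sum_i `|x ord0 i|)).+1%R => // i.
  rewrite !mxE subr0 (@le_trans _ _ (\sum_i `|x ord0 i|)%R)//.
    by rewrite (bigD1 i)//= lerDl sumr_ge0.
  by rewrite ltW// truncnS_gt.
by move=> k; split; [exact: measurable_ccube|rewrite lebesgue_ccube// ltry].
Qed.

(** [lebesgue_rV n] is already a bundled measure; this alias is a bare set function to which the
    sigma-finite structure required by Fubini can be attached. *)
Definition sfleb n : set 'rV[R]_n -> \bar R := mu n.
Arguments sfleb n A : clear implicits.
HB.instance Definition _ n := Measure.copy (sfleb n) (mu n).
HB.instance Definition _ n := @Measure_isSigmaFinite.Build _ _ _ (sfleb n) (@lebesgue_rV_sigma_finite n).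

Lemma ge0_integral_rVS n (f : 'rV[R]_n.+1 -> \bar R) : measurable_fun setT f ->
  (forall x, 0 <= f x) ->
  \int[mu n.+1]_x f x = \int[mu n]_y \int[lebesgue_measure]_t f (snoc y t).
Proof.
move=> mf f0.
transitivity (\int[(sfleb n \x @lebesgue_measure R)]_p f (snoc p.1 p.2)).
  have := @ge0_integral_pushforward _ _ _ _ _ _ (@measurable_snoc R n)
    (sfleb n \x @lebesgue_measure R) setT f measurableT mf (fun y _ => f0 y).
  exact.
apply: (@fubini_tonelli1 _ _ _ _ _ (sfleb n) lebesgue_measure (fun p => f (snoc p.1 p.2))) => //.
exact: measurableT_comp mf (@measurable_snoc R n).
Qed.

Lemma integrable_rVS n (f : 'rV[R]_n.+1 -> \bar R) : (mu n.+1).-integrable setT f ->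
  (sfleb n \x @lebesgue_measure R).-integrable setT (fun p => f (snoc p.1 p.2)).
Proof.
move=> /integrableP[mf fi]; apply/integrableP; split.
  exact: measurableT_comp mf (@measurable_snoc R n).
apply: le_lt_trans fi; rewrite le_eqVlt; apply/orP; left; apply/eqP; symmetry.
have := @ge0_integral_pushforward _ _ _ _ _ _ (@measurable_snoc R n)
    (sfleb n \x @lebesgue_measure R) setT (abse \o f) measurableT (measurableT_comp (@abse_measurable _ _) mf) (fun y _ => abse_ge0 _).
exact.
Qed.

Lemma integral_rVS n (f : 'rV[R]_n.+1 -> \bar R) : (mu n.+1).-integrable setT f ->
  \int[mu n.+1]_x f x = \int[mu n]_y \int[lebesgue_measure]_t f (snoc y t).
Proof.
move=> fi; have fi' := integrable_rVS fi; case/integrableP: (fi) => mf _.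
transitivity (\int[(sfleb n \x @lebesgue_measure R)]_p f (snoc p.1 p.2)).
  have := @integral_pushforward _ _ _ _ _ _ (@measurable_snoc R n)
    (sfleb n \x @lebesgue_measure R) setT f mf fi' measurableT.
  exact.
by rewrite -integral12_prod_meas1.
Qed.

Lemma integral_rVS_swap n (f : 'rV[R]_n.+1 -> \bar R) : (mu n.+1).-integrable setT f ->
  \int[mu n.+1]_x f x = \int[lebesgue_measure]_t \int[mu n]_y f (snoc y t).
Proof.
move=> fi; rewrite integral_rVS//; exact: Fubini (integrable_rVS fi).
Qed.

Lemma measurable_inner n (f : 'rV[R]_n.+1 -> \bar R) : measurable_fun setT f ->
  (forall x, 0 <= f x) ->
  measurable_fun setT (fun y => \int[lebesgue_measure]_t f (snoc y t)).
Proof.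
move=> mf f0.
apply: (@measurable_fun_fubini_tonelli_F _ _ _ _ _ lebesgue_measure (fun p => f (snoc p.1 p.2))) => //.
exact: measurableT_comp mf (@measurable_snoc R n).
Qed.

End lebesgue_rV.

(** * Hausdorff measure and vertical segments *)

Section hausdorff_measurable.
Context {R : realType} {n : nat}.
Local Open Scope ereal_scope.
Implicit Types (A B X : set 'rV[R]_n) (s : nat) (e : R).

Lemma enorm_coord (x : 'rV[R]_n) i : (`|x ord0 i| <= enorm x)%R.
Proof.
rewrite -sqrtr_sqr ler_wsqrtr// (bigD1 i)//= lerDl sumr_ge0// => j _.
exact: sqr_ge0.
Qed.

Lemma le_diam A B : A `<=` B -> diam A <= diam B.
Proof.
move=> AB; apply: ge_ereal_sup => _ [p [pA1 pA2] <-].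
by apply: ereal_sup_ubound; exists p => //; split; exact: AB.
Qed.

Lemma coord_diam A (x y : 'rV[R]_n) i : A x -> A y ->
  (`|x ord0 i - y ord0 i|)%:E <= diam A.
Proof.
move=> Ax Ay; apply: (@le_trans _ _ (enorm (x - y)%R)%:E).
  by have := enorm_coord (x - y)%R i; rewrite !mxE lee_fin.
by apply: ereal_sup_ubound; exists (x, y).
Qed.

Lemma le_hausdorff_gauge s e A B : A `<=` B -> hausdorff_gauge s e A <= hausdorff_gauge s e B.
Proof.
move=> AB; rewrite {1}/hausdorff_gauge; case: ifPn => [_|]; first exact: hausdorff_gauge_ge0.
move=> /asboolPn A0; have B0 : B <> set0 by move=> B0; apply: A0; rewrite -subset0 -B0.
have {}A0 : A !=set0 by apply/set0P/eqP.
rewrite /hausdorff_gauge asboolF//; case: (leP (diam B)) => Be; last by rewrite leey.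
rewrite (le_trans (le_diam AB) Be).
have := le_diam AB.
elim: s => [|s IH] dAB; first by [].
by rewrite !expeS lee_pmul// ?IH// ?expe_ge0// diam_ge0.
Qed.

(** A set of a cover that meets both half-spaces [P] and [Q] has diameter larger than [e], hence
    gauge +oo. Any other one meets at most one of them, so cutting the cover by [P] and by [Q]
    yields covers of [A] and [B] whose total gauge has not increased. *)
Lemma hausdorff_delta_sep s e A B i (p q : R) : (e < q - p)%R ->
  (forall x, A x -> x ord0 i <= p)%R -> (forall x, B x -> q <= x ord0 i)%R ->
  hausdorff_delta s e A + hausdorff_delta s e B <= hausdorff_delta s e (A `|` B).
Proof.
move=> epq Ap Bq; apply: le_ereal_inf_tmp => _ [F [mF FAB] <-].
pose P := [set x : 'rV[R]_n | x ord0 i <= p]%R.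
pose Q := [set x : 'rV[R]_n | q <= x ord0 i]%R.
apply: (@le_trans _ _ (\sum_(k <oo) (hausdorff_gauge s e (F k `&` P)) +
    \sum_(k <oo) (hausdorff_gauge s e (F k `&` Q)))).
  apply: leeD; apply: ereal_inf_lbound.
    exists (fun k => F k `&` P) => //; split => [k|x Ax].
      exact: sub_sigma_algebra.
    by have [k _ Fk] := FAB x (or_introl Ax); exists k => //; split => //; exact: Ap.
  exists (fun k => F k `&` Q) => //; split => [k|x Bx].
    exact: sub_sigma_algebra.
  by have [k _ Fk] := FAB x (or_intror Bx); exists k => //; split => //; exact: Bq.
rewrite -nneseriesD//; [|by move=> *; exact: hausdorff_gauge_ge0..].
apply: lee_nneseries => k _; first by rewrite adde_ge0// hausdorff_gauge_ge0.
have [->|/set0P[x [Fx Px]]] := eqVneq (F k `&` P) set0.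
  by rewrite hausdorff_gauge0 add0e; apply: le_hausdorff_gauge; exact: subIsetl.
have [->|/set0P[y [Fy Qy]]] := eqVneq (F k `&` Q) set0.
  by rewrite hausdorff_gauge0 adde0; apply: le_hausdorff_gauge; exact: subIsetl.
suff -> : hausdorff_gauge s e (F k) = +oo by rewrite leey.
rewrite /hausdorff_gauge asboolF; last by move=> F0; move: Fx; rewrite F0.
rewrite ifF//; apply/negbTE; rewrite -ltNge.
apply: lt_le_trans (coord_diam i Fy Fx); rewrite lte_fin.
apply: (lt_le_trans epq); apply: le_trans (ler_norm _); exact: lerB.
Qed.

Lemma le_hausdorff_delta s e e' A : (e <= e')%R -> hausdorff_delta s e' A <= hausdorff_delta s e A.
Proof.
move=> ee'; apply: le_ereal_inf_tmp => _ [F [mF FA] <-].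
apply: (@le_trans _ _ (\sum_(k <oo) hausdorff_gauge s e' (F k))).
  by apply: ereal_inf_lbound; exists F.
apply: lee_nneseries => [k _ _|k _]; first exact: hausdorff_gauge_ge0.
rewrite /hausdorff_gauge; case: ifPn => // _.
case: ifPn => [_|]; first by case: ifPn => // _; rewrite leey.
rewrite -ltNge => h; rewrite ifF ?leey//; apply/negbTE; rewrite -ltNge.
by apply: le_lt_trans h; rewrite lee_fin.
Qed.

Lemma hausdorff_delta_le s e A : (0 < e)%R -> hausdorff_delta s e A <= hausdorff s A.
Proof. by move=> e0; apply: ereal_sup_ubound; exists e. Qed.

(** [hausdorff_delta] grows as the scale shrinks, so the scales in the two suprema on the left can
    be replaced by a common one below the gap. Once the right-hand side is finite, terms may be
    subtracted and the two suprema taken one after the other. *)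
Lemma hausdorff_sep s A B i (p q : R) : (p < q)%R ->
  (forall x, A x -> x ord0 i <= p)%R -> (forall x, B x -> q <= x ord0 i)%R ->
  hausdorff s A + hausdorff s B <= hausdorff s (A `|` B).
Proof.
move=> pq Ap Bq.
have pq2 : (0 < (q - p) / 2)%R by rewrite divr_gt0// subr_gt0.
have key e : (0 < e)%R -> hausdorff_delta s e A + hausdorff_delta s e B <= hausdorff s (A `|` B).
  move=> e0; pose e' := Order.min e ((q - p) / 2)%R.
  have e'0 : (0 < e')%R by rewrite lt_min e0.
  have e'pq : (e' < q - p)%R.
    by apply: (@le_lt_trans _ _ ((q - p) / 2)%R); [by rewrite ge_min lexx orbT|lra].
  apply: le_trans (hausdorff_delta_le s (A `|` B) e'0).
  apply: le_trans (hausdorff_delta_sep s e'pq Ap Bq).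
  by apply: leeD; apply: le_hausdorff_delta; rewrite ge_min lexx.
have [/eqP AB|ABoo] := eqVneq (hausdorff s (A `|` B)) +oo; first by rewrite (eqP AB) leey.
have fAB : hausdorff s (A `|` B) \is a fin_num by rewrite ge0_fin_numE ?ltey// hausdorff_ge0.
rewrite -leeBrDr; last first.
  rewrite ge0_fin_numE ?hausdorff_ge0//; apply: (@le_lt_trans _ _ (hausdorff s (A `|` B))).
    by apply: le_hausdorff; exact: subsetUr.
  by rewrite ltey.
apply: ge_ereal_sup => _ [e e0 <-].
have fe : hausdorff_delta s e A \is a fin_num.
  rewrite ge0_fin_numE ?hausdorff_delta_ge0//.
  apply: le_lt_trans (hausdorff_delta_le _ _ e0) _.
  by apply: (@le_lt_trans _ _ (hausdorff s (A `|` B))); [apply: le_hausdorff; exact: subsetUl|rewrite ltey].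
rewrite leeBrDr; last first.
  rewrite ge0_fin_numE ?hausdorff_ge0//; apply: (@le_lt_trans _ _ (hausdorff s (A `|` B))).
    by apply: le_hausdorff; exact: subsetUr.
  by rewrite ltey.
rewrite addeC -leeBrDr//.
apply: ge_ereal_sup => _ [e' e'0 <-].
rewrite leeBrDr// addeC.
pose e2 := Order.min e e'.
have e20 : (0 < e2)%R by rewrite lt_min e0.
apply: le_trans (key _ e20); apply: leeD; apply: le_hausdorff_delta; by rewrite ge_min lexx ?orbT.
Qed.

(** Each [F N] lies strictly below all the earlier slabs, by a positive gap, so it can be added to
    their union by [hausdorff_sep]. *)
Lemma hausdorff_sum_sep s i (F : nat -> set 'rV[R]_n) (lo hi : nat -> R) :
  (forall j x, F j x -> (lo j <= x ord0 i <= hi j)%R) -> (forall j, hi j.+1 < lo j)%R ->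
  (forall j, lo j <= hi j)%R ->
  forall N, \sum_(0 <= j < N) hausdorff s (F j) <= hausdorff s (\bigcup_j F j).
Proof.
move=> Fb hl lh N.
have mono j k : (j <= k)%N -> (lo k <= lo j)%R.
  elim: k => [|k IH]; first by rewrite leqn0 => /eqP ->.
  rewrite leq_eqVlt ltnS => /orP[/eqP ->//|/IH]; apply: le_trans.
  by apply: le_trans (lh k.+1) _; exact: ltW.
apply: (@le_trans _ _ (hausdorff s (\bigcup_(j < N) F j))); last first.
  by apply: le_hausdorff => x [j _ Fx]; exists j.
elim: N => [|N IH]; first by rewrite big_nil; exact: hausdorff_ge0.
rewrite big_nat_recr//= bigcup_mkord big_ord_recr/= -bigcup_mkord.
apply: (@le_trans _ _ (hausdorff s (\bigcup_(j < N) F j) + hausdorff s (F N))).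
  by rewrite leeD2r.
case: N IH => [|N] _.
  by rewrite bigcup_mkord big_ord0 hausdorff0 add0e set0U.
rewrite addeC setUC; apply: (@hausdorff_sep s _ _ i (hi N.+1) (lo N)) => // x.
  by move=> /Fb/andP[].
move=> [j /= jN /Fb/andP[h _]]; apply: le_trans h; exact: mono.
Qed.

(** This is Caratheodory's criterion for metric outer measures, in one direction. [X] above height
    [r k] is separated from [X] outside the half-space, and what is lost between [c] and [r k] is
    covered by the rings [Rg j] with j >= k. Their total measure is the tail of a convergent
    series. *)
Lemma caratheodory_halfspace s i (c : R) :
  caratheodory_measurable (@hausdorff R n s) [set x : 'rV[R]_n | (c < x ord0 i)%R].
Proof.
apply: le_caratheodory_measurable => X.
set H := [set x | _].
rewrite -[leLHS]/(hausdorff s (X `&` H) + hausdorff s (X `&` ~` H)) -[leRHS]/(hausdorff s X).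
have [->|Xoo] := eqVneq (hausdorff s X) +oo; first by rewrite leey.
have fX : hausdorff s X \is a fin_num by rewrite ge0_fin_numE ?ltey// hausdorff_ge0.
pose r k : R := (c + k.+1%:R^-1)%R.
have rS k : (r k.+1 < r k)%R by rewrite ltrD2l ltf_pV2 ?posrE// ltr_nat.
have rmono j k : (j <= k)%N -> (r k <= r j)%R.
  by move=> jk; rewrite lerD2l lef_pV2 ?posrE// ler_nat.
pose Xk k := X `&` [set x : 'rV[R]_n | (r k <= x ord0 i)%R].
pose Rg j := X `&` [set x : 'rV[R]_n | (r j.+1 <= x ord0 i <= r j)%R].
have sub k : X `&` H `<=` Xk k `|` \bigcup_j Rg (k + j)%N.
  move=> x [Xx]; rewrite /H /= => cx.
  have [rx|rx] := leP (r k) (x ord0 i); [by left|right].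
  have [m xm] : exists m, (r (k + m).+1 <= x ord0 i)%R.
    have xc : (0 < x ord0 i - c)%R by rewrite subr_gt0.
    have [m _ Hm] := near_infty_natSinv_lt (PosNum xc).
    exists m; rewrite /r -lerBrDl; apply: le_trans (ltW (Hm m _)) => //=.
    by rewrite lef_pV2 ?posrE// ler_nat !ltnS ltnW// ltnS leq_addl.
  have [m' xm' minm] := ex_minnP (ex_intro (fun m => (r (k + m).+1 <= x ord0 i)%R) m xm).
  exists m' => //; split => //=; rewrite xm'/=.
  case: m' xm' minm => [|m'] xm' minm; first by rewrite addn0 ltW.
  rewrite leNgt; apply/negP => xlt; have := minm m'; rewrite addnS in xlt.
  by move=> /(_ (ltW xlt)); rewrite ltnn.
(* Consecutive rings touch, but two rings of the same parity are a whole ring apart, so each parity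
   contributes at most the measure of [X]. *)
have sumb : \sum_(j <oo) hausdorff s (Rg j) < +oo.
  apply: (@le_lt_trans _ _ (hausdorff s X + hausdorff s X)); last by rewrite lte_add_pinfty// ltey.
  have ev N : \sum_(0 <= j < N) hausdorff s (Rg j.*2) <= hausdorff s X.
    apply: (@le_trans _ _ (hausdorff s (\bigcup_j Rg j.*2))); last first.
      by apply: le_hausdorff => x [j _ []].
    apply: (@hausdorff_sum_sep s i _ (fun j => r j.*2.+1) (fun j => r j.*2)) => [j x []//|j|j]; last exact/ltW/rS.
    by rewrite doubleS; exact: rS.
  have od N : \sum_(0 <= j < N) hausdorff s (Rg j.*2.+1) <= hausdorff s X.
    apply: (@le_trans _ _ (hausdorff s (\bigcup_j Rg j.*2.+1))); last first.
      by apply: le_hausdorff => x [j _ []].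
    apply: (@hausdorff_sum_sep s i _ (fun j => r j.*2.+2) (fun j => r j.*2.+1)) => [j x []//|j|j]; last exact/ltW/rS.
    by rewrite doubleS; exact: rS.
  have eo N : \sum_(0 <= j < N.*2) hausdorff s (Rg j) =
      \sum_(0 <= j < N) hausdorff s (Rg j.*2) + \sum_(0 <= j < N) hausdorff s (Rg j.*2.+1).
    elim: N => [|N IH]; first by rewrite !big_nil adde0.
    by rewrite doubleS !big_nat_recr//= IH -addeA addeACA.
  apply: lime_le; first by apply: is_cvg_nneseries => *; exact: hausdorff_ge0.
  near=> N.
  apply: (@le_trans _ _ (\sum_(0 <= j < N.*2) hausdorff s (Rg j))).
    by apply: lee_sum_nneg_natr => [*|]; [exact: hausdorff_ge0|rewrite -addnn leq_addr].
  by rewrite eo leeD.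
have tail : \sum_(k <= j <oo) hausdorff s (Rg j) @[k --> \oo] --> 0.
  by apply: nneseries_tail_cvg => // *; exact: hausdorff_ge0.
have main k : hausdorff s (X `&` H) + hausdorff s (X `&` ~` H) <=
    hausdorff s X + \sum_(k <= j <oo) hausdorff s (Rg j).
  apply: (@le_trans _ _ (hausdorff s (Xk k) + \sum_(k <= j <oo) hausdorff s (Rg j) + hausdorff s (X `&` ~` H))).
    apply: leeD2r; apply: le_trans (le_hausdorff s (sub k)) _.
    apply: le_trans (outer_measureU2 (hausdorff s) _ _) _; apply: leeD2l.
    apply: le_trans (hausdorff_sigma_subadditive _ _) _.
    rewrite -[leRHS]nneseries_addn; last by move=> *; exact: hausdorff_ge0.
    by under eq_eseriesr do rewrite addnC.
  rewrite addeAC; apply: leeD2r.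
  rewrite addeC.
  apply: (@le_trans _ _ (hausdorff s ((X `&` ~` H) `|` Xk k))); last first.
    by apply: le_hausdorff => x [[]//|[]//].
  apply: (@hausdorff_sep s _ _ i c (r k)); first by rewrite ltrDl.
    by move=> x [_]; rewrite /H /= => /negP; rewrite -leNgt.
  by move=> x [].
rewrite -[leRHS]adde0.
have C : hausdorff s X + \sum_(k <= j <oo) hausdorff s (Rg j) @[k --> \oo] --> hausdorff s X + 0.
  by apply: (cvgeD _ (cvg_cst _) tail); exact: fin_num_adde_defr.
by apply: (cvge_ge _ C); near=> k; exact: main.
Unshelve. all: end_near. Qed.

(** [surface_measure] lives on the Caratheodory sets of the Hausdorff outer measure; this is what
    allows continuous functions to be integrated on the upper frontier. *)
Lemma borel_caratheodory s A : measurable A -> caratheodory_measurable (@hausdorff R n s) A.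
Proof.
apply: smallest_sub; first exact: (@sigma_algebra_measurable _ (caratheodory_type (@hausdorff R n s))).
move=> B; rewrite -bigcup_seq => -[i _ [Y mY <-]]; rewrite setTI.
suff : measurable_fun (setT : set (caratheodory_type (@hausdorff R n s)))
    (fun x : 'rV[R]_n => x ord0 i : R).
  by move=> /(_ measurableT _ mY); rewrite setTI.
apply: (measurability _ (RGenOInfty.measurableE R)).
move=> _ [_ [c ->] <-]; rewrite setTI.
rewrite (_ : _ @^-1` _ = [set x : 'rV[R]_n | (c < x ord0 i)%R]); first exact: caratheodory_halfspace.
by apply/seteqP; split => x; rewrite /= in_itv/= andbT.
Qed.

End hausdorff_measurable.

(** * Volume filled by vertical segments over a set of given Hausdorff measure *)

Section segment_cover.
Context {R : realType} {n : nat}.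
Local Open Scope ereal_scope.
Local Notation mu := (@lebesgue_rV R).
Implicit Types (B : set 'rV[R]_n.+1) (x : 'rV[R]_n.+1) (h t : R).

Definition vshift x t : 'rV[R]_n.+1 := snoc (initv x) (xn x + t).

Lemma vshiftE x t : vshift x t = (x + t *: delta_mx ord0 ord_max)%R.
Proof.
apply/rowP => i; rewrite /vshift; case: (unliftP ord_max i) => [j|] ->.
  by rewrite snoc_lift !mxE [_ == ord_max]eq_sym (negbTE (neq_lift _ _)) andbF mulr0 addr0.
by rewrite snoc_max !mxE !eqxx mulr1.
Qed.

(** A set of diameter d <= h projects into a cube of side 2d, and the segments of length h over it
    lie in a box of height 2d + h <= 3h. The volume is at most (2d)^n times 3h, which is [c h] times
    d^n. *)
Let c h : R := (3 * 2 ^+ n * h)%R.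

(** Using the length h of the segments as the scale of the gauge keeps the height of the box
    comparable to h. For a set of larger diameter the gauge is +oo and the whole space serves. *)
Let gauge_cover B h : (0 < h)%R -> exists E : set 'rV[R]_n.+1,
  [/\ measurable E, forall x t, B x -> (0 <= t <= h)%R -> E (vshift x t) &
      mu n.+1 E <= (c h)%:E * hausdorff_gauge n h B].
Proof.
move=> h0; have c0 : (0 < c h)%R by rewrite /c !mulr_gt0// exprn_gt0.
have [B0|] := pselect (B = set0).
  exists set0; split => //; first by move=> x t; rewrite B0.
  by rewrite measure0; apply: mule_ge0; [rewrite lee_fin ltW|exact: hausdorff_gauge_ge0].
move=> /[dup] B0 /eqP/set0P[x0 Bx0].
rewrite /hausdorff_gauge asboolF//; case: (leP (diam B)) => dB; last first.
  by exists setT; split => //; rewrite gt0_muley ?lte_fin// leey.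
have dge0 : 0 <= diam B by apply: diam_ge0; exists x0.
have fd : diam B \is a fin_num by rewrite ge0_fin_numE//; apply: le_lt_trans dB _; rewrite ltry.
pose d := fine (diam B).
have dE : diam B = d%:E by rewrite fineK.
have d0 : (0 <= d)%R by rewrite fine_ge0.
have dh : (d <= h)%R by rewrite -lee_fin -dE.
pose I : set R := `[(xn x0 - d)%R, (xn x0 + d + h)%R]%classic.
exists [set x : 'rV[R]_n.+1 | ccube (initv x0) d (initv x) /\ I (xn x)]; split.
- pose F i : set R := if unlift ord_max i is Some j then [set t | `|t - x0 ord0 i| <= d]%R else I.
  have -> : [set x : 'rV[R]_n.+1 | ccube (initv x0) d (initv x) /\ I (xn x)] =
      [set x : 'rV[R]_n.+1 | forall i, F i (x ord0 i)].
    apply/seteqP; split => x /=.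
      move=> [H1 H2] i; rewrite /F; case: unliftP => [j|] -> //.
      by have := H1 j; rewrite !mxE.
    move=> H; split => [j|]; last by have := H ord_max; rewrite /F unlift_none.
    by have := H (lift ord_max j); rewrite /F liftK !mxE.
  apply: measurable_coor_box => i; rewrite /F; case: unlift => [j|]; last exact: measurable_itv.
  rewrite (_ : [set t | _] = `[(x0 ord0 i - d)%R, (x0 ord0 i + d)%R]%classic) //.
  by apply/seteqP; split => t; rewrite /= in_itv/= ler_distl.
- move=> x t Bx /andP[t0 th]; rewrite /= initv_snoc xn_snoc; split.
    move=> j; rewrite !mxE -lee_fin -dE; exact: coord_diam.
  have : (`|xn x - xn x0| <= d)%R by rewrite -lee_fin -dE; exact: coord_diam.
  rewrite ler_distl /I /= in_itv/= => /andP[h1 h2].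
  by rewrite (le_trans h1) ?lerDl//= lerD.
- rewrite lebesgue_rV_cyl//; [|exact: measurable_ccube|exact: measurable_itv].
  rewrite lebesgue_ccube// lebesgue_measure_itv/= lte_fin.
  rewrite ifT; last by lra.
  rewrite dE -EFin_expe -EFinB -!EFinM lee_fin /c exprMn.
  rewrite [leRHS](_ : _ = 2 ^+ n * d ^+ n * (3 * h))%R; last by ring.
  by rewrite ler_wpM2l ?mulr_ge0 ?exprn_ge0//; lra.
Qed.

Let segment_cover_eps B h e : (0 < h)%R -> (0 < e)%R -> hausdorff n B \is a fin_num ->
  exists E : set 'rV[R]_n.+1,
  [/\ measurable E, forall x t, B x -> (0 <= t <= h)%R -> E (vshift x t) &
      mu n.+1 E <= (c h)%:E * (hausdorff n B + e%:E)].
Proof.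
move=> h0 e0 fB; have c0 : (0 < c h)%R by rewrite /c !mulr_gt0// exprn_gt0.
have fD : hausdorff_delta n h B \is a fin_num.
  rewrite ge0_fin_numE ?hausdorff_delta_ge0//; apply: le_lt_trans (hausdorff_delta_le _ _ h0) _.
  by rewrite ltey_eq fB.
have [_ [F [_ FB] <-]] := lb_ereal_inf_adherent e0 fD; rewrite -/(mu_ext _ _) => Fe.
have /choice[E HE] := fun j => @gauge_cover (F j) h h0.
exists (\bigcup_j E j); split.
- by apply: bigcupT_measurable => j; have [] := HE j.
- move=> x t /FB[j _ Fx] th; exists j => //; have [_ H _] := HE j; exact: H.
- apply: (@le_trans _ _ (\sum_(j <oo) mu n.+1 (E j))).
    apply: measure_sigma_subadditive => //; first by move=> j; have [] := HE j.
    by apply: bigcupT_measurable => j; have [] := HE j.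
  apply: (@le_trans _ _ (\sum_(j <oo) ((c h)%:E * hausdorff_gauge n h (F j)))).
    by apply: lee_nneseries => // j _; have [] := HE j.
  rewrite nneseriesZl; last by move=> *; exact: hausdorff_gauge_ge0.
  apply: lee_wpmul2l; first by rewrite lee_fin ltW.
  apply: ltW; apply: lt_le_trans Fe _; apply: leeD2r; exact: hausdorff_delta_le.
Qed.

Lemma segment_cover B h : (0 < h)%R -> exists E : set 'rV[R]_n.+1,
  [/\ measurable E, forall x t, B x -> (0 <= t <= h)%R -> E (vshift x t) &
      mu n.+1 E <= (3 * 2 ^+ n * h)%:E * hausdorff n B].
Proof.
move=> h0; have c0 : (0 < c h)%R by rewrite /c !mulr_gt0// exprn_gt0.
have [Boo|Boo] := eqVneq (hausdorff n B) +oo.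
  by exists setT; split => //; rewrite Boo gt0_muley ?lte_fin// leey.
have fB : hausdorff n B \is a fin_num by rewrite ge0_fin_numE ?ltey// hausdorff_ge0.
have /choice[E HE] := fun k : nat => @segment_cover_eps B h (k.+1%:R^-1)%R h0 ltac:(by rewrite invr_gt0) fB.
(* Every [E k] contains the segments and is good up to an error 1/(k+1); the intersection keeps the
   segments and has no error left. *)
exists (\bigcap_k E k); split.
- by apply: bigcapT_measurable => j; have [] := HE j.
- by move=> x t Bx th k _; have [_ H _] := HE k; exact: H.
- rewrite -/(c h); apply/lee_addgt0Pr => e e0.
  have [k _ Hk] := near_infty_natSinv_lt (PosNum (divr_gt0 e0 c0)).
  have {}Hk := Hk k (leqnn k).
  apply: (@le_trans _ _ (mu n.+1 (E k))).
    apply: le_measure; rewrite ?inE; [|by have [] := HE k|exact: bigcap_inf].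
    by apply: bigcapT_measurable => j; have [] := HE j.
  have [_ _] := HE k; move=> /le_trans; apply.
  rewrite muleDr//; last exact: fin_num_adde_defr.
  apply: leeD2l; rewrite -EFinM lee_fin -ler_pdivlMl//.
  by move: Hk => /= /ltW; rewrite mulrC.
Qed.

End segment_cover.

(** * A divergence estimate in the vertical direction *)

Section lines.
Context {R : realType} {n : nat}.
Implicit Types (x : 'rV[R]_n) (f : 'rV[R]_n -> R).

Local Notation e i := (delta_mx ord0 i : 'rV[R]_n).

Lemma line_quotient f x i t : (fun h : R => h^-1 *: (((fun t : R => f (x + t *: e i)) \o shift t) (h *: (1 : R)) -
      f (x + t *: e i))) =
  (fun h : R => h^-1 *: ((f \o shift (x + t *: e i)) (h *: e i) - f (x + t *: e i))).
Proof.
apply/funext => h /=; congr (_ *: (f _ - _)).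
by rewrite -[h *: 1]/(h * 1) mulr1 scalerDl addrCA.
Qed.

Lemma is_derive_line f x i t : derivable f (x + t *: e i) (e i) ->
  is_derive t (1 : R) (fun t : R => f (x + t *: e i)) (partial i f (x + t *: e i)).
Proof.
move=> df; apply: DeriveDef; first by rewrite /derivable line_quotient.
by rewrite /partial /derive line_quotient.
Qed.

Lemma line_lipschitz f x i (M : R) (a b : R) : a <= b ->
  (forall t, a <= t <= b -> derivable f (x + t *: e i) (e i)) ->
  (forall t, a <= t <= b -> `|partial i f (x + t *: e i)| <= M) ->
  `|f (x + b *: e i) - f (x + a *: e i)| <= M * (b - a).
Proof.
move=> ab df pM.
have [||c cab ->] := @MVT_segment R (fun t => f (x + t *: e i))
    (fun t => partial i f (x + t *: e i)) a b ab.
- move=> t /[!in_itv]/= /andP[t1 t2]; apply: is_derive_line; apply: df; by rewrite !ltW.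
- apply: derivable_within_continuous => t /[!in_itv]/= tab.
  by have [] := is_derive_line (df t tab).
- rewrite normrM (ger0_norm (_ : 0 <= b - a)) ?subr_ge0//.
  by rewrite ler_wpM2r ?subr_ge0//; apply: pM; move: cab; rewrite in_itv.
Qed.

End lines.

Section cubes.
Context {R : realType} {n : nat}.
Implicit Types (x : 'rV[R]_n) (f : 'rV[R]_n -> R) (A : set 'rV[R]_n).

Lemma ccube_norm r x : ccube 0 r x -> 0 <= r -> `|x| <= r.
Proof.
move=> xr r0; apply/ler_addgt0Pr => e e0.
have : ocube 0 (r + e) x.
  by move=> i; rewrite (le_lt_trans (xr i))// ltrDl.
rewrite ocubeE ?ltr_wpDl//= mx_norm_ball /ball_/= sub0r normrN => /ltW //.
Qed.

Lemma norm_ccube r x : `|x| <= r -> ccube 0 r x.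
Proof.
move=> xr i; rewrite mxE subr0; apply/ler_addgt0Pr => e e0.
have r0 : 0 <= r by apply: le_trans xr.
have : ball (0 : 'rV[R]_n) (r + e) x.
  by rewrite mx_norm_ball /ball_/= sub0r normrN (le_lt_trans xr)// ltrDl.
by rewrite -ocubeE ?ltr_wpDl// => /(_ i); rewrite mxE subr0 => /ltW.
Qed.

Lemma bounded_ccube A : bounded_set A -> exists2 r : R, 0 <= r & A `<=` ccube 0 r.
Proof.
move=> [M [_ HM]]; exists (Order.max (M + 1) 0); first by rewrite le_max lexx orbT.
move=> x Ax; apply: norm_ccube; rewrite le_max; apply/orP; left.
by apply: HM Ax; rewrite ltrDl.
Qed.

Lemma closed_ccube q r : closed (ccube q r : set 'rV[R]_n).
Proof.
have -> : ccube q r = \bigcap_(i in setT) (rV_coor i @^-1` [set t : R | `|t - q ord0 i| <= r]).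
  exact: (bigcap_coorE (fun i => [set t | `|t - q ord0 i| <= r])).
apply: closed_bigI => i _; apply: closed_comp; first by move=> x _; exact: continuous_coor.
rewrite (_ : [set t | _] = `[q ord0 i - r, q ord0 i + r]%classic); last first.
  by apply/seteqP; split => t; rewrite /= in_itv/= ler_distl.
exact: interval_closed.
Qed.

Lemma compact_ccube q r : compact (ccube q r : set 'rV[R]_n).
Proof.
apply: bounded_closed_compact; last exact: closed_ccube.
exists (`|q| + `|r|); split; first exact: num_real.
move=> M M0 x xq; apply: ltW; apply: le_lt_trans M0.
rewrite -(subrK q x) (le_trans (ler_normD _ _))// addrC lerD2l.
apply: ccube_norm => // i; rewrite !mxE subr0; apply: le_trans (ler_norm r); exact: xq.
Qed.

Lemma continuous_ccube_bound f r : continuous f ->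
  exists2 M : R, 0 <= M & forall x, ccube 0 r x -> `|f x| <= M.
Proof.
move=> cf; have : bounded_set [set f x | x in (ccube 0 r : set 'rV[R]_n)].
  apply: compact_bounded; apply: continuous_compact; last exact: compact_ccube.
  exact: continuous_subspaceT.
move=> [M [_ HM]]; exists (Order.max (M + 1) 0); first by rewrite le_max lexx orbT.
move=> x xr; rewrite le_max; apply/orP; left.
by apply: HM; [rewrite ltrDl|exists x].
Qed.

Local Notation mu := (@lebesgue_rV R).

Lemma integrable_bounded_supp f (M r : R) : measurable_fun setT f ->
  (forall x, `|f x| <= M) -> (forall x, ~ ccube 0 r x -> f x = 0) ->
  (mu n).-integrable setT (EFin \o f).
Proof.
move=> mf fM f0; pose C : set 'rV[R]_n := ccube 0 `|r|.
have mC : measurable C by exact: measurable_ccube.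
apply/integrableP; split; first exact/measurable_EFinP.
apply: (@le_lt_trans _ _ (\int[mu n]_x (M%:E * (\1_C x)%:E))%E).
  apply: ge0_le_integral => //.
  - by apply: measurableT_comp => //; exact/measurable_EFinP.
  - by apply/measurable_EFinP; apply: measurable_funM => //; exact: measurable_indic.
  - move=> x _ /=; rewrite lee_fin indicE.
    case: (boolP (x \in C)) => [_|]; first by rewrite mulr1.
    rewrite notin_setE => nC; rewrite mulr0 f0 ?normr0// => xr; apply: nC => i.
    by apply: le_trans (ler_norm r); exact: xr.
rewrite ge0_integralZl_EFin//; last 2 first.
- by apply/measurable_EFinP; exact: measurable_indic.
- by apply: le_trans (fM 0).
by rewrite integral_indic// setIT lebesgue_ccube// -EFinM ltry.
Qed.

End cubes.

(** * Vertical translations and null sets on the hyperplane x_n = 0 *)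

Section translation.
Context {R : realType}.
Local Notation mu := (@lebesgue_rV R).
Local Open Scope ereal_scope.

Lemma lebesgue_measure_shift (h : R) (A : set R) : measurable A ->
  lebesgue_measure ((fun t : R => t + h)%R @^-1` A) = lebesgue_measure A.
Proof.
move=> mA.
have mh : measurable_fun setT (fun t : measurableTypeR R => (t + h)%R : measurableTypeR R).
  have : measurable_fun setT (fun t : R => (t + h)%R) by exact: measurable_funD.
  exact.
pose m := measure_function_pushforward__canonical__measure_function_Measure
  (@lebesgue_measure R) mh.
suff : forall X, ocitv X -> lebesgue_measure X = m X.
  by move=> /lebesgue_measure_unique => H; exact/esym/H.
move=> _ [[a b] _ <-] /=; rewrite /pushforward.
rewrite (_ : _ @^-1` _ = `](a - h)%R, (b - h)%R]%classic); last first.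
  by apply/seteqP; split => t /=; rewrite !in_itv/= ltrBlDr lerBrDr.
rewrite !lebesgue_measure_itv/= !lte_fin ltrD2r; case: ifP => // _.
by rewrite -!EFinB; congr _%:E; ring.
Qed.

Lemma ge0_integral_shift (f : R -> \bar R) (h : R) : measurable_fun setT f ->
  (forall t, 0 <= f t) ->
  \int[lebesgue_measure]_t f (t + h)%R = \int[lebesgue_measure]_t f t.
Proof.
move=> mf f0.
have mh : measurable_fun setT (fun t : measurableTypeR R => (t + h)%R : measurableTypeR R).
  have : measurable_fun setT (fun t : R => (t + h)%R) by exact: measurable_funD.
  exact.
have := @ge0_integral_pushforward _ _ _ _ R _ mh (@lebesgue_measure R) setT f measurableT mf (fun y _ => f0 y).
rewrite preimage_setT => <-.
apply: eq_measure_integral => A mA _; exact: lebesgue_measure_shift.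
Qed.

Lemma measurable_vshift n (h : R) : measurable_fun setT (fun x : 'rV[R]_n.+1 => vshift x h).
Proof.
have : measurable_fun setT (fun x : 'rV[R]_n.+1 => (initv x, (xn x + h)%R : measurableTypeR R)).
  apply: measurable_fun_pair; last first.
    have : measurable_fun setT (fun x : 'rV[R]_n.+1 => (xn x + h)%R).
      by apply: measurable_funD => //; exact: measurable_coord.
    exact.
  move=> _; apply: (@measurability _ _ _ _ _ _
    (\big[setU/set0]_(i < n)
       preimage_set_system [set: 'rV[R]_n] (rV_coor i) measurable)) => //.
  move=> _ [B + <-]; rewrite -bigcup_seq => -[i _ [Y mY <-]].
  rewrite setTI setTI -comp_preimage.
  rewrite (_ : _ \o _ = (fun x : 'rV[R]_n.+1 => x ord0 (lift ord_max i))); last first.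
    by apply/funext => x; rewrite /= /rV_coor mxE.
  rewrite -[X in measurable X]setTI; exact: (@measurable_coord R n.+1 _ measurableT _ mY).
by move=> /(measurableT_comp (@measurable_snoc R n)).
Qed.

Lemma ge0_integral_vshift n (f : 'rV[R]_n.+1 -> \bar R) (h : R) : measurable_fun setT f ->
  (forall x, 0 <= f x) ->
  \int[mu n.+1]_x f (vshift x h) = \int[mu n.+1]_x f x.
Proof.
move=> mf f0.
have mfh := measurableT_comp mf (@measurable_vshift n h).
transitivity (\int[mu n]_y \int[lebesgue_measure]_t f (vshift (snoc y t) h)).
  by apply: (ge0_integral_rVS mfh) => x; exact: f0.
rewrite ge0_integral_rVS//.
apply: eq_integral => y _.
rewrite -[RHS](ge0_integral_shift h)//; last first.
  exact: measurableT_comp mf (@measurable_snocl R n y).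
by apply: eq_integral => t _; rewrite /= /vshift initv_snoc xn_snoc.
Qed.

Lemma integral_vshift n (f : 'rV[R]_n.+1 -> \bar R) (h : R) : measurable_fun setT f ->
  \int[mu n.+1]_x f (vshift x h) = \int[mu n.+1]_x f x.
Proof.
move=> mf.
have P : \int[mu n.+1]_x (fun x => f (vshift x h))^\+ x = \int[mu n.+1]_x f^\+ x.
  have <- := @ge0_integral_vshift n (f^\+) h (measurable_funepos mf) (funepos_ge0 _).
  by apply: eq_integral => x _; rewrite !funeposE.
have N : \int[mu n.+1]_x (fun x => f (vshift x h))^\- x = \int[mu n.+1]_x f^\- x.
  have <- := @ge0_integral_vshift n (f^\-) h (measurable_funeneg mf) (funeneg_ge0 _).
  by apply: eq_integral => x _; rewrite !funenegE.
by rewrite integralE P N -integralE.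
Qed.

(** The unit segments standing on [B] lie in a set [E] of volume 0. By Tonelli almost every vertical
    line meets [E] in a null set, whereas the line through a point (y, 0) of [B] meets it in at
    least [0, 1]. *)
Lemma hausdorff0_negligible n (B : set 'rV[R]_n.+1) : hausdorff n B = 0 ->
  (mu n).-negligible [set y : 'rV[R]_n | B (snoc y 0%R)].
Proof.
move=> B0; have [E [mE HE]] := @segment_cover R n B 1%R ltr01.
rewrite B0 mule0 => muE; have {}muE : mu n.+1 E = 0 by apply/eqP; rewrite eq_le muE measure_ge0.
pose f (x : 'rV[R]_n.+1) : \bar R := (\1_E x)%:E.
have mf : measurable_fun setT f by apply/measurable_EFinP; exact: measurable_indic.
have f0 x : 0 <= f x by rewrite lee_fin.
have : \int[mu n.+1]_x f x = 0 by rewrite integral_indic// setIT.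
rewrite ge0_integral_rVS//; set F := (fun y => _) => F0.
have mF : measurable_fun setT F by exact: measurable_inner.
have F0' y : 0 <= F y by exact: integral_ge0.
have : \int[mu n]_y `|F y| = 0.
  by rewrite -[RHS]F0; apply: eq_integral => y _; rewrite gee0_abs.
move/(ae_eq_integral_abs _ measurableT mF).1; apply: negligibleS => y By /=.
move/(_ I); rewrite /F.
apply/eqP; rewrite gt_eqF//.
apply: (@lt_le_trans _ _ (\int[lebesgue_measure]_t (\1_(`[0%R, 1%R]%classic : set R) t)%:E)).
  have := @integral_indic _ _ R (@lebesgue_measure R) setT measurableT `[0%R, 1%R]%classic (measurable_itv _).
  by move=> ->; rewrite setIT -[X in _ < X]/(@lebesgue_measure R `[0%R, 1%R]%classic) lebesgue_measure_itv/= lte_fin ltr01 oppr0 adde0.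
apply: ge0_le_integral => //.
- by apply/measurable_EFinP; exact: measurable_indic.
- exact: measurableT_comp mf (@measurable_snocl R n y).
- move=> t _; rewrite /f lee_fin !indicE.
  case: (boolP (t \in _)) => //; rewrite inE/= in_itv/= => t01.
  rewrite mem_set//; have := HE _ t By t01.
  by rewrite /vshift initv_snoc xn_snoc add0r.
Qed.

End translation.

Section vshift.
Context {R : realType} {n : nat}.
Implicit Types (x : 'rV[R]_n.+1) (D : set 'rV[R]_n.+1).

Lemma vshiftD x s t : vshift (vshift x s) t = vshift x (s + t).
Proof. by rewrite !vshiftE scalerDl addrA. Qed.

Lemma vshift0 x : vshift x 0 = x.
Proof. by rewrite vshiftE scale0r addr0. Qed.

Lemma vshiftNK x t : vshift (vshift x (- t)) t = x.
Proof. by rewrite vshiftD addNr vshift0. Qed.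

Lemma xn_vshift x t : xn (vshift x t) = xn x + t.
Proof. exact: xn_snoc. Qed.

Lemma snoc_vshift (y : 'rV[R]_n) t : snoc y t = vshift (snoc y 0) t.
Proof. by rewrite /vshift initv_snoc xn_snoc add0r. Qed.

Lemma ccube_vshift r x t : ccube 0 r x -> `|t| <= 1 -> ccube 0 (r + 1) (vshift x t).
Proof.
move=> xr t1 i; rewrite vshiftE !mxE subr0; have := xr i; rewrite mxE subr0 => xi.
apply: le_trans (ler_normD _ _) _; rewrite lerD// normrM.
by case: (_ && _); rewrite ?normr1 ?mulr1// normr0 mulr0.
Qed.

Lemma continuous_vshift x : continuous (fun t : R => vshift x t).
Proof.
move=> t; rewrite (_ : (fun t => _) = fun t => x + t *: delta_mx ord0 ord_max); last first.
  by apply/funext => s; exact: vshiftE.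
apply: cvgD; first exact: cvg_cst.
by apply: cvgZr_tmp; exact: cvg_id.
Qed.

Lemma measurable_snocr (t : R) : measurable_fun setT (fun y : 'rV[R]_n => snoc y t).
Proof.
have := measurableT_comp (@measurable_snoc R n) (@pair2_measurable _ _ _ (measurableTypeR R) t).
exact.
Qed.

Lemma open_upper D : open D -> open (upper D).
Proof.
move=> oD; apply: openI => //.
rewrite (_ : [set x | _] = rV_coor ord_max @^-1` `]0, +oo[%classic); last first.
  by apply/seteqP; split => x; rewrite /= in_itv/= andbT.
apply: open_comp; first by move=> x _; exact: continuous_coor.
exact: interval_open.
Qed.

Lemma measurable_xn : measurable_fun setT (@xn R n).
Proof. exact: measurable_coord. Qed.

Lemma measurable_upper_frontier D : measurable (upper_frontier D).
Proof.
apply: measurableI.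
  apply: measurableD; first by apply: closed_measurable_rV; exact: closed_closure.
  by apply: open_measurable_rV; exact: open_interior.
rewrite (_ : [set x | _] = xn @^-1` `]0, +oo[%classic); last first.
  by apply/seteqP; split => x; rewrite /= in_itv/= andbT.
by rewrite -[X in measurable X]setTI; apply: measurable_xn.
Qed.

Lemma measurable_thin D : open D -> measurable (thin D).
Proof.
move=> oD; rewrite -[X in measurable X]setTI; apply: (measurable_snocr 0) => //.
exact: open_measurable_rV.
Qed.

(* Since [0, h] is connected, a vertical segment that leaves [D] meets its
   frontier. *)
Lemma vsegment_frontier D x h : open D -> 0 <= h -> D x <> D (vshift x (- h)) ->
  exists2 s, 0 <= s <= h & frontier D (vshift x (- s)).
Proof.
move=> oD h0 Dx; apply: contrapT => nfr.
pose p (s : R) := vshift x (- s).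
have cp : continuous p.
  by move=> s; apply: (@continuous_comp _ _ _ -%R (vshift x)); [exact: opp_continuous|exact: continuous_vshift].
have clD s : 0 <= s <= h -> closure D (p s) -> D (p s).
  move=> sh cs; apply: contrapT => nD; apply: nfr; exists s => //.
  by split => // /interior_subset.
pose B := `[0, h]%classic `&` p @^-1` D.
have B0 : B !=set0 -> B = `[0, h]%classic.
  move=> Bn; apply: (@segment_connected R 0 h B Bn).
    by exists (p @^-1` D) => //; apply: open_comp => // s _; exact: cp.
  exists (p @^-1` closure D); first by apply: closed_comp; [move=> s _; exact: cp|exact: closed_closure].
  apply/seteqP; split => s [sh Ds]; split => //; first exact: subset_closure.
  by apply: clD => //; move: sh; rewrite /= in_itv.
have p0 : p 0 = x by rewrite /p oppr0 vshift0.
have i0 : `[0, h]%classic 0 by rewrite /= in_itv/= lexx.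
have ih : `[0, h]%classic h by rewrite /= in_itv/= h0 lexx.
apply: Dx; apply/propext; split => Dx.
  by have : B h by [rewrite B0//; exists 0; split => //=; rewrite p0]; case.
by have : B 0 by [rewrite B0//; exists h; split]; case; rewrite /= p0.
Qed.

End vshift.

(** * Averages over short intervals to the right of 0 *)

Section average.
Context {R : realType}.
Local Open Scope ereal_scope.

Lemma integrable_indic_bounded (g : R -> R) (h M : R) : measurable_fun setT g -> (forall t, `|g t| <= M)%R ->
  (0 < h)%R ->
  lebesgue_measure.-integrable setT (fun t : R => (h^-1 * \1_`]0%R, h] t * g t)%:E).
Proof.
move=> mg gM h0.
have mi : measurable_fun setT (\1_`]0%R, h] : R -> R) by exact: measurable_indic.
have mf : measurable_fun setT (fun t : R => h^-1 * \1_`]0%R, h] t * g t)%R.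
  by apply: measurable_funM => //; apply: measurable_funM.
apply/integrableP; split; first exact/measurable_EFinP.
apply: (@le_lt_trans _ _ (\int[lebesgue_measure]_t ((h^-1 * M)%:E * (\1_(`]0%R, h]%classic : set R) t)%:E))).
  apply: ge0_le_integral => //.
  - by apply: measurableT_comp => //; exact/measurable_EFinP.
  - by apply/measurable_EFinP; apply: measurable_funM.
  - move=> t _ /=; rewrite lee_fin !normrM (ger0_norm (_ : 0 <= h^-1)%R) ?invr_ge0 ?(ltW h0)//.
    rewrite indicE; case: (_ \in _); last by rewrite normr0 !mulr0 mul0r.
    by rewrite normr1 !mulr1 ler_wpM2l ?invr_ge0 ?(ltW h0).
have M0 : (0 <= M)%R by apply: le_trans (gM 0%R).
rewrite ge0_integralZl_EFin ?mulr_ge0 ?invr_ge0 ?(ltW h0)//; last exact/measurable_EFinP.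
have -> := @integral_indic _ _ R (@lebesgue_measure R) setT measurableT `]0%R, h]%classic (measurable_itv _).
rewrite setIT -[X in _ * X]/(@lebesgue_measure R `]0%R, h]%classic) lebesgue_measure_itv/= lte_fin h0.
by rewrite -EFinB -EFinM ltry.
Qed.

Lemma integral_indic_average (h c : R) : (0 < h)%R ->
  \int[lebesgue_measure]_(t in setT) (h^-1 * \1_`]0%R, h] t * c)%:E = c%:E.
Proof.
move=> h0; under eq_integral do rewrite mulrAC EFinM.
rewrite integralZl//; last first.
  have := @integrable_indic_bounded (fun=> h) h h (@measurable_cst _ _ _ _ _ h) _ h0.
  have E : (fun t : R => (h^-1 * \1_`]0%R, h] t * h)%:E) = (fun t => (\1_`]0%R, h] t)%:E).
    by apply/funext => t; rewrite mulrAC mulVf ?mul1r// gt_eqF.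
  by rewrite E; apply => t; rewrite ger0_norm// ltW.
have -> := @integral_indic _ _ R (@lebesgue_measure R) setT measurableT `]0%R, h]%classic (measurable_itv _).
rewrite setIT -[X in _ * X]/(@lebesgue_measure R `]0%R, h]%classic) lebesgue_measure_itv/= lte_fin h0.
by rewrite -EFinB -EFinM subr0 mulrAC mulVf ?mul1r// gt_eqF.
Qed.

Lemma average_bound (g : R -> R) (h M c e : R) : measurable_fun setT g -> (forall t, `|g t| <= M)%R ->
  (0 < h)%R -> (forall t, 0 < t <= h -> `|g t - c| <= e)%R ->
  `| \int[lebesgue_measure]_(t in setT) (h^-1 * \1_`]0%R, h] t * g t)%:E - c%:E| <= e%:E.
Proof.
move=> mg gM h0 gc.
rewrite -{1}(integral_indic_average c h0) -integralB_EFin//; last 2 first.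
- exact: integrable_indic_bounded mg gM h0.
- by apply: (@integrable_indic_bounded (fun=> c) h `|c|%R).
have mi : measurable_fun setT (\1_`]0%R, h] : R -> R) by exact: measurable_indic.
have mF : measurable_fun setT (fun t => (h^-1 * \1_`]0%R, h] t * g t)%:E - (h^-1 * \1_`]0%R, h] t * c)%:E).
  by apply/measurable_EFinP; apply: measurable_funB; do ?apply: measurable_funM.
have := @le_abse_integral _ _ R (@lebesgue_measure R) setT _ measurableT mF.
move=> /le_trans; apply.
rewrite -(integral_indic_average e h0).
apply: ge0_le_integral => //.
- exact: measurableT_comp.
- by apply/measurable_EFinP; apply: measurable_funM => //; apply: measurable_funM.
move=> t _; rewrite lee_fin -mulrBr normrM indicE.
case: (boolP (t \in _)); last by rewrite mulr0 normr0 !mul0r.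
rewrite inE/= in_itv/= => th; rewrite mulr1 ger0_norm ?invr_ge0 ?(ltW h0)//.
by rewrite ler_wpM2l ?invr_ge0 ?(ltW h0)// gc.
Qed.

Lemma cvge_abs_le (u : nat -> \bar R) (c : R) :
  (forall e : R, (0 < e)%R -> \forall k \near \oo, `|u k - c%:E| <= e%:E) ->
  u k @[k --> \oo] --> c%:E.
Proof.
move=> H; apply/fine_cvgP; split.
  near=> k; have : `|u k - c%:E| <= 1%:E by near: k; exact: H.
  by case: (u k).
apply/cvgrPdist_le => e e0; near=> k.
have : `|u k - c%:E| <= e%:E by near: k; exact: H.
by rewrite /=; case: (u k) => //= r; rewrite lee_fin distrC.
Unshelve. all: end_near. Qed.

Lemma average_cvg (g : R -> R) (M c : R) : measurable_fun setT g -> (forall t, `|g t| <= M)%R ->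
  (forall e, 0 < e -> exists2 d, 0 < d & forall t, 0 < t < d -> `|g t - c| <= e)%R ->
  \int[lebesgue_measure]_(t in setT) (k.+1%:R^-1^-1 * \1_`]0%R, k.+1%:R^-1] t * g t)%:E @[k --> \oo] --> c%:E.
Proof.
move=> mg gM gc; apply: cvge_abs_le => e e0; have [d d0 gd] := gc e e0.
near=> k.
apply: (average_bound (M := M)) => //.
move=> t /andP[t0 tk]; apply: gd; rewrite t0/=; apply: le_lt_trans tk _.
by near: k; exact: (near_infty_natSinv_lt (PosNum d0)).
Unshelve. all: end_near. Qed.

End average.

Lemma surface_measurable_fun (R : realType) n d (T : measurableType d) (g : 'rV[R]_n.+1 -> T) :
  measurable_fun setT g ->
  measurable_fun (setT : set (caratheodory_type (@surface_outer R n))) g.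
Proof. by move=> mg _ Y mY; apply: borel_caratheodory; exact: (mg measurableT). Qed.

(** * Comparison of the upper domain with its vertical translates *)

Section divergence.
Context {R : realType} {n : nat}.
Variables (D : set 'rV[R]_n.+1) (f : 'rV[R]_n.+1 -> R) (r M N : R).
Hypotheses (oD : open D) (Dr : D `<=` ccube 0 r).
Hypotheses (cf : continuous f)
  (df : forall x, derivable f x (delta_mx ord0 ord_max))
  (fN : forall x, ccube 0 (r + 1) x -> `|f x| <= N)
  (fM : forall x, ccube 0 (r + 1) x -> `|partial ord_max f x| <= M).
Local Notation mu := (@lebesgue_rV R).
Local Notation S := (upper_frontier D).
Local Notation H := (@surface_measure R n).
Local Notation C := (3 * 2 ^+ n : R).

(** Signed indicator of the exchange between [upper D] moved up by h and D above height h. Leaving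
    the layer 0 < x_n <= h out of the second set keeps the flat bottom out of the exchange; that
    layer is accounted for separately and produces the integral over D'. *)
Definition leaving (h : R) (x : 'rV[R]_n.+1) : R :=
  \1_(upper D) (vshift x (- h)) - \1_(D `&` [set z | h < xn z]) x.

(** The bounds on [f] and its derivative are taken on a cube enlarged by 1 so that segments of
    length h <= 1 starting in [ccube 0 r] stay inside it. *)
Let f_vshift (x : 'rV[R]_n.+1) h : ccube 0 r x -> 0 <= h <= 1 -> `|f (vshift x h) - f x| <= M * h.
Proof.
move=> xr /andP[h0 h1]; have := @line_lipschitz R n.+1 f x ord_max M 0 h h0.
rewrite scale0r addr0 -vshiftE subr0; apply => t /andP[t0 th]; first exact: df.
rewrite -vshiftE; apply: fM; apply: ccube_vshift => //.
by rewrite ger0_norm// (le_trans th).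
Qed.

Let clDr : closure D `<=` ccube 0 r.
Proof. by move=> x /(closure_subset Dr); exact: closed_ccube. Qed.

(** At height at most h both indicators vanish. Above it they tell whether x - h e_n and x are in D,
    so if they differ the segment between these points meets the frontier, at a height at least x_n
    - h > 0. *)
Lemma leaving_frontier (h : R) (x : 'rV[R]_n.+1) : 0 <= h -> leaving h x != 0 ->
  exists z s, [/\ S z, 0 <= s <= h & x = vshift z s].
Proof.
move=> h0; rewrite /leaving !indicE => w.
have xh : h < xn x.
  rewrite ltNge; apply/negP => xh; move/eqP: w; apply.
  rewrite memNset ?memNset ?subrr//=; first by move=> [_ /=]; rewrite ltNge xh.
  by move=> [_ /=]; rewrite xn_vshift subr_gt0 ltNge xh.
have Dx : D x <> D (vshift x (- h)).
  move=> Dx; move/eqP: w; apply.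
  have -> : (vshift x (- h) \in upper D) = (x \in D `&` [set z | h < xn z]).
    apply/idP/idP; rewrite !inE /upper /= xn_vshift subr_gt0 -Dx => -[] //.
  by rewrite subrr.
have [s sh [cs ns]] := vsegment_frontier oD h0 Dx.
exists (vshift x (- s)), s; split => //; last by rewrite vshiftNK.
split => //=; rewrite xn_vshift subr_gt0; case/andP: sh => _ sh; exact: le_lt_trans xh.
Qed.

Lemma measurable_leaving h : measurable_fun setT (leaving h).
Proof.
have mU : measurable (upper D) by apply: open_measurable_rV; exact: open_upper.
apply: measurable_funB.
  have := measurableT_comp (@measurable_indic _ _ R setT _ mU) (@measurable_vshift R n (- h)).
  exact.
apply: measurable_indic; apply: measurableI; first exact: open_measurable_rV.
rewrite (_ : [set z | _] = xn @^-1` `]h, +oo[%classic); last first.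
  by apply/seteqP; split => z; rewrite /= in_itv/= andbT.
by rewrite -[X in measurable X]setTI; apply: measurable_xn.
Qed.

Lemma leaving_le1 h x : `|leaving h x| <= 1.
Proof.
rewrite /leaving !indicE; case: (_ \in _); case: (_ \in _); rewrite ?subrr ?normr0 ?subr0 ?sub0r ?normrN ?normr1//.
Qed.

(* [S] is cut into the level sets [k h <= |f| < (k + 1) h], and the points of
   level [k] above which the segments leave [D] fill at most [C h] times the
   measure of that level set. *)
Lemma integral_leaving (h : R) : 0 < h -> h <= 1 -> 0 <= M ->
  (\int[mu n.+1]_x `|f x * leaving h x|%:E <=
   (C * h)%:E * \int[H]_(z in S) (`|f z| + (1 + M) * h)%:E)%E.
Proof.
move=> h0 h1 M0.
pose L (k : nat) : set 'rV[R]_n.+1 := S `&` [set z | k%:R * h <= `|f z| < k.+1%:R * h].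
have mf : measurable_fun setT f by exact: continuous_measurable_rV.
have mS := measurable_upper_frontier D.
have mL k : measurable (L k).
  apply: measurableI => //; rewrite (_ : [set z | _] = (fun z => `|f z|) @^-1` `[(k%:R * h), (k.+1%:R * h)[%classic) //.
  have : measurable_fun setT (fun z => `|f z|) by exact: measurableT_comp.
  by move=> mn; rewrite -[X in measurable X]setTI; exact: mn.
have Lf z : L (Num.truncn (`|f z| / h)) z <-> S z.
  split => [[]//|Sz]; split => //=.
  by rewrite -ler_pdivlMr// -ltr_pdivrMr// truncn_itv// divr_ge0// ltW.
have /choice[E HE] := fun k => @segment_cover R n (L k) h h0.
have mE k : measurable (E k) by have [] := HE k.
have muE k : (mu n.+1 (E k) <= (C * h)%:E * hausdorff n (L k))%E by have [] := HE k.
(* Bound for |f| on the segments over level k: the level reaches (k + 1) h, and f varies by at most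
   M h along a segment of length h. *)
pose c k : R := (k%:R * h + (1 + M) * h).
have c0 k : 0 <= c k by rewrite addr_ge0 ?mulr_ge0 ?addr_ge0// ltW.
apply: (@le_trans _ _ (\int[mu n.+1]_x \sum_(k <oo) (c k * \1_(E k) x)%:E)%E).
  apply: ge0_le_integral => //.
  - apply/measurable_EFinP; apply: (measurableT_comp _ _) => //.
    by apply: measurable_funM => //; exact: measurable_leaving.
  - apply: ge0_emeasurable_sum => [k x _ _|k _]; first by rewrite lee_fin mulr_ge0.
    by apply/measurable_EFinP; apply: measurable_funM => //; exact: measurable_indic.
  move=> x _.
  have [->|w0] := eqVneq (leaving h x) 0.
    by rewrite mulr0 normr0; apply: nneseries_ge0 => k _ _; rewrite lee_fin mulr_ge0.
  have [z [s [Sz /andP[s0 sh] xz]]] := leaving_frontier (ltW h0) w0.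
  pose k := Num.truncn (`|f z| / h).
  have Lz : L k z by apply/Lf.
  have Ex : E k x by have [_ H _] := HE k; rewrite xz; apply: H => //; rewrite s0.
  apply: (@le_trans _ _ (\sum_(0 <= i < k.+1) (c i * \1_(E i) x)%:E)%E); last first.
    by apply: nneseries_lim_ge => i _ _; rewrite lee_fin mulr_ge0.
  rewrite big_nat_recr//=.
  apply: (@le_trans _ _ (c k * \1_(E k) x)%:E); last first.
    by apply: leeDr; apply: sume_ge0 => i _; rewrite lee_fin mulr_ge0.
  rewrite lee_fin indicE mem_set// mulr1 normrM.
  apply: (@le_trans _ _ `|f x|).
    by rewrite ler_piMr// leaving_le1.
  have zr : ccube 0 r z by apply: clDr; case: Sz => -[].
  have fxz : `|f x - f z| <= M * s by rewrite xz; apply: f_vshift => //; rewrite s0 (le_trans sh).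
  have Msh : M * s <= M * h by rewrite ler_wpM2l.
  have [_ /= /andP[_ fz]] := Lz.
  rewrite -(subrK (f z) (f x)) (le_trans (ler_normD _ _))// /c.
  move: fz; rewrite -natr1 mulrDl mul1r => fz.
  by rewrite addrC mulrDl mul1r addrA lerD// ?(le_trans fxz)// ltW.
rewrite integral_nneseries//; last 2 first.
- by move=> k; apply/measurable_EFinP; apply: measurable_funM => //; exact: measurable_indic.
- by move=> k x _; rewrite lee_fin mulr_ge0.
have mLc k : measurable (L k : set (caratheodory_type (@surface_outer R n))).
  exact: (borel_caratheodory (n := n.+1) n (mL k)).
have SE : S = \bigcup_k L k.
  apply/seteqP; split => [z Sz|z [k _ []]//].
  by exists (Num.truncn (`|f z| / h)) => //; apply/Lf.
have mg : measurable_fun setT (fun z : caratheodory_type (@surface_outer R n) => (`|f z| + (1 + M) * h)%:E).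
  have : measurable_fun setT (fun z => (`|f z| + (1 + M) * h)%:E).
    apply/measurable_EFinP; apply: measurable_funD => //; exact: measurableT_comp.
  exact: surface_measurable_fun.
have g0 z : (0 <= (`|f z| + (1 + M) * h)%:E)%E.
  by rewrite lee_fin addr_ge0 ?mulr_ge0 ?addr_ge0// ltW.
rewrite [X in integral _ X _]SE.
rewrite (@ge0_integral_bigcup _ _ _ H L (fun z => (`|f z| + (1 + M) * h)%:E) mLc); last 3 first.
- exact: (measurable_funTS mg).
- by move=> z _; exact: g0.
- apply/trivIsetP => i j _ _ ij; rewrite -subset0 => z [[_ /= /andP[i1 i2]] [_ /= /andP[j1 j2]]].
  move/eqP: ij; apply; apply/eqP; rewrite eqn_leq.
  have := le_lt_trans i1 j2; have := le_lt_trans j1 i2.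
  by rewrite !ltr_pM2r// !ltr_nat !ltnS => -> ->.
rewrite -nneseriesZl; last by move=> *; apply: integral_ge0 => *; exact: g0.
apply: lee_nneseries => [k _ _|k _].
  by apply: integral_ge0 => x _; rewrite lee_fin mulr_ge0.
under eq_integral do rewrite EFinM.
rewrite ge0_integralZl_EFin//; last by apply/measurable_EFinP; exact: measurable_indic.
rewrite integral_indic// setIT.
apply: (@le_trans _ _ ((c k)%:E * ((C * h)%:E * H (L k)))%E).
  by apply: lee_wpmul2l; rewrite ?lee_fin//; exact: muE.
rewrite muleCA; apply: lee_wpmul2l.
  by rewrite lee_fin !mulr_ge0// ?exprn_ge0// ltW.
rewrite -(@integral_cst _ _ _ H (L k) (mLc k)).
apply: ge0_le_integral.
- exact: mLc.
- by move=> z _; rewrite lee_fin.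
- exact: measurable_cst.
- exact: (measurable_funTS mg).
- by move=> z [_ /= /andP[+ _]]; rewrite lee_fin lerD2r.
Qed.

Lemma integrable_indic_mul (B : set 'rV[R]_n.+1) (g : 'rV[R]_n.+1 -> R) (q b : R) :
  measurable B -> measurable_fun setT g -> B `<=` ccube 0 q -> 0 <= b ->
  (forall x, B x -> `|g x| <= b) ->
  (mu n.+1).-integrable setT (fun x => (\1_B x * g x)%:E).
Proof.
move=> mB mg Bq b0 gb; apply: (@integrable_bounded_supp R n.+1 (fun x => \1_B x * g x) b q).
- by apply: measurable_funM => //; exact: measurable_indic.
- move=> x; rewrite indicE; case: (boolP (x \in B)) => [|_].
    by rewrite inE => /gb; rewrite mul1r.
  by rewrite mul0r normr0.
- by move=> x nx; rewrite indicE memNset ?mul0r// => /Bq.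
Qed.

Hypotheses (M0 : 0 <= M) (N0 : 0 <= N).

(** [G h] is the difference quotient that tends to d_n f on [upper D]; [K h] averages [f] over the
    bottom layer of height h and tends to the values on D'. *)
Let G h x := \1_(upper D) x * ((f (vshift x h) - f x) / h).
Let K h x := \1_(D `&` [set z | 0 < xn z <= h]) x * (f x / h).

Let mf : measurable_fun setT f.
Proof. exact: continuous_measurable_rV. Qed.

Let mU : measurable (upper D).
Proof. by apply: open_measurable_rV; exact: open_upper. Qed.

Let mD : measurable D.
Proof. exact: open_measurable_rV. Qed.

Let Ur : upper D `<=` ccube 0 r.
Proof. by move=> x [/Dr]. Qed.

Let r1 : (ccube 0 r : set 'rV[R]_n.+1) `<=` ccube 0 (r + 1).
Proof. by move=> x xr i; rewrite (le_trans (xr i))// lerDl. Qed.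

Let measurable_slab (P : set R) : measurable P -> measurable (D `&` [set z | P (xn z)]).
Proof.
move=> mP; apply: measurableI => //.
by rewrite -[X in measurable X]setTI; exact: (measurable_xn measurableT mP).
Qed.

Let mslab1 h : measurable (D `&` [set z | 0 < xn z <= h]).
Proof.
apply: (@measurable_slab [set t | 0 < t <= h]).
rewrite (_ : [set t | _] = `]0, h]%classic) //.
Qed.

Let mslab2 h : measurable (D `&` [set z | h < xn z]).
Proof.
apply: (@measurable_slab [set t | h < t]).
rewrite (_ : [set t | _] = `]h, +oo[%classic) //.
by apply/seteqP; split => t; rewrite /= in_itv/= andbT.
Qed.

Let mfv h : measurable_fun setT (fun x => f (vshift x h)).
Proof. exact: measurableT_comp mf (@measurable_vshift R n h). Qed.

Let iG h : 0 < h -> h <= 1 -> (mu n.+1).-integrable setT (EFin \o G h).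
Proof.
move=> h0 h1; apply: (@integrable_indic_mul _ _ r M) => //.
  by apply: measurable_funM => //; exact: measurable_funB.
move=> x Ux; rewrite normrM normfV (gtr0_norm h0) ler_pdivrMr//.
by apply: f_vshift; [exact: Ur|rewrite ltW].
Qed.

Let iK h : 0 < h -> h <= 1 -> (mu n.+1).-integrable setT (EFin \o K h).
Proof.
move=> h0 h1; apply: (@integrable_indic_mul _ _ r (N / h)) => //.
- exact: measurable_funM.
- by move=> x [/Dr].
- by rewrite divr_ge0// ltW.
- move=> x [Dx _]; rewrite normrM normfV (gtr0_norm h0) ler_wpM2r ?invr_ge0 ?(ltW h0)//.
  by apply: fN; apply: r1; exact: Dr.
Qed.

(** Adding the bottom layer to [G h] cancels the part of f / h below height h. What remains is the
    integral of f(x + h e_n) / h over [upper D], which a translation turns into the integral of f /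
    h over the raised domain, minus that of f / h over D above height h. *)
Let integral_GK h : 0 < h -> h <= 1 ->
  (\int[mu n.+1]_x (G h x)%:E + \int[mu n.+1]_x (K h x)%:E =
   \int[mu n.+1]_x (f x * leaving h x / h)%:E)%E.
Proof.
move=> h0 h1.
pose A x := \1_(upper D) x * (f (vshift x h) / h).
pose A' x := \1_((fun x => vshift x (- h)) @^-1` upper D) x * (f x / h).
pose B x := \1_(D `&` [set z | h < xn z]) x * (f x / h).
have hN : 0 <= N / h by rewrite divr_ge0// ltW.
have mA' : measurable ((fun x : 'rV[R]_n.+1 => vshift x (- h)) @^-1` upper D).
  by rewrite -[X in measurable X]setTI; exact: (@measurable_vshift R n (- h) measurableT _ mU).
have UA' x : upper D (vshift x (- h)) -> ccube 0 (r + 1) x.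
  move=> /Ur xr; rewrite -(vshiftNK x h); apply: ccube_vshift => //.
  by rewrite gtr0_norm.
have iA : (mu n.+1).-integrable setT (EFin \o A).
  apply: (@integrable_indic_mul _ _ r (N / h)) => //; first exact: measurable_funM.
  move=> x Ux; rewrite normrM normfV (gtr0_norm h0) ler_wpM2r ?invr_ge0 ?(ltW h0)//.
  by apply: fN; apply: ccube_vshift; [exact: Ur|rewrite gtr0_norm].
have iA' : (mu n.+1).-integrable setT (EFin \o A').
  apply: (@integrable_indic_mul _ _ (r + 1) (N / h)) => //; first exact: measurable_funM.
  move=> x Ux; rewrite normrM normfV (gtr0_norm h0) ler_wpM2r ?invr_ge0 ?(ltW h0)//.
  by apply: fN; exact: UA'.
have iB : (mu n.+1).-integrable setT (EFin \o B).
  apply: (@integrable_indic_mul _ _ r (N / h)) => //.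
  - exact: measurable_funM.
  - by move=> x [/Dr].
  move=> x [Dx _]; rewrite normrM normfV (gtr0_norm h0) ler_wpM2r ?invr_ge0 ?(ltW h0)//.
  by apply: fN; apply: r1; exact: Dr.
rewrite -integralD_EFin//; [|exact: iG|exact: iK].
transitivity (\int[mu n.+1]_x (A x)%:E - \int[mu n.+1]_x (B x)%:E)%E.
  rewrite -integralB_EFin//; apply: eq_integral => x _; congr _%:E.
  rewrite /G /K /A /B.
  have -> : \1_(upper D) x = \1_(D `&` [set z | 0 < xn z <= h]) x + \1_(D `&` [set z | h < xn z]) x :> R.
    rewrite !indicE; have [Dx|nDx] := pselect (D x); last first.
      by rewrite !memNset ?addr0//; case.
    have [xh|xh] := leP (xn x) h.
      have -> : (x \in D `&` [set z | h < xn z]) = false.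
        by apply/negbTE; rewrite notin_setE => -[_ /=]; rewrite ltNge xh.
      rewrite addr0; congr (_ %:R); congr (nat_of_bool _).
      apply/idP/idP; rewrite !inE => -[_ /= x0]; split => //=; first by rewrite x0.
      by case/andP: x0.
    have -> : (x \in D `&` [set z | 0 < xn z <= h]) = false.
      by apply/negbTE; rewrite notin_setE => -[_ /= /andP[_]]; rewrite leNgt xh.
    by rewrite add0r !mem_set//; split => //=; exact: lt_trans xh.
  by ring.
transitivity (\int[mu n.+1]_x (A' x)%:E - \int[mu n.+1]_x (B x)%:E)%E.
  congr (_ - _)%E; rewrite -(@integral_vshift R n (EFin \o A) (- h)); last by case/integrableP: iA.
  apply: eq_integral => x _; rewrite /A /A' /= vshiftNK !indicE; congr (_%:R * _)%:E.
rewrite -integralB_EFin//; apply: eq_integral => x _; congr _%:E.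
rewrite /A' /B /leaving !indicE mulrBr mulrBl; congr (_ - _); last by ring.
rewrite (_ : (x \in _) = (vshift x (- h) \in upper D)); first by ring.
by apply/idP/idP; rewrite !inE.
Qed.

Hypothesis cdf : continuous (partial ord_max f).

Let hk (k : nat) : R := k.+1%:R^-1.

Let hk0 k : 0 < hk k.
Proof. by rewrite invr_gt0. Qed.

Let hk1 k : hk k <= 1.
Proof. by rewrite invf_le1// ler1n. Qed.

Let quotient_cvg (x : 'rV[R]_n.+1) :
  (f (vshift x (hk k)) - f x) / hk k @[k --> \oo] --> partial ord_max f x.
Proof.
have dd : (fun h : R => h^-1 *: ((f \o shift x) (h *: (delta_mx ord0 ord_max : 'rV[R]_n.+1)) - f x)) t @[t --> 0^'] --> partial ord_max f x.
  exact: df.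
have H0 := (cvgr_dnbhsP _ _ _).1 dd hk.
rewrite (_ : (fun k => _) = (fun k => (hk k)^-1 *: ((f \o shift x) (hk k *: (delta_mx ord0 ord_max : 'rV[R]_n.+1)) - f x))).
  by apply: H0; split; [move=> k; rewrite gt_eqF|exact: cvg_harmonic].
by apply/funext => k; rewrite /= mulrC vshiftE [x + _]addrC.
Qed.

Let cvg_G : (\int[mu n.+1]_x (G (hk k) x)%:E @[k --> \oo] -->
  \int[mu n.+1]_x (\1_(upper D) x * partial ord_max f x)%:E)%E.
Proof.
apply: (@dominated_cvg _ _ _ (mu n.+1) setT measurableT (fun k x => (G (hk k) x)%:E)
  _ (fun x => (\1_(upper D) x * M)%:E)).
- by move=> k; case/integrableP: (iG (hk0 k) (hk1 k)).
- move=> x _; apply/fine_cvgP; split; first exact: nearW.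
  apply: cvgM; [exact: cvg_cst|exact: quotient_cvg].
- by [].
- by apply: (@integrable_indic_mul _ (fun=> M) r M) => // x _; rewrite ger0_norm.
- move=> k x _; rewrite lee_fin /G normrM indicE; case: (boolP (x \in _)) => xU; last by rewrite normr0 !mul0r.
  rewrite normr1 !mul1r normrM normfV (gtr0_norm (hk0 k)) ler_pdivrMr//.
  by apply: f_vshift; [exact: Ur (set_mem xU)|rewrite (ltW (hk0 k)) hk1].
Unshelve. all: end_near. Qed.

Hypothesis flat0 : hausdorff n (frontier D `&` [set x | xn x = 0]) = 0%E.

Let g (y : 'rV[R]_n) (t : R) : R := \1_D (snoc y t) * f (snoc y t).

Let mg y : measurable_fun setT (g y).
Proof.
have ms := @measurable_snocl R n y.
apply: measurable_funM.
  exact: measurableT_comp (@measurable_indic _ _ R setT _ mD) ms.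
exact: measurableT_comp mf ms.
Qed.

Let gN y t : `|g y t| <= N * \1_(ccube 0 r) y.
Proof.
rewrite /g indicE; case: (boolP (_ \in D)) => [|_]; last by rewrite mul0r normr0 mulr_ge0.
rewrite inE mul1r => /Dr yr; rewrite indicE mem_set.
  by rewrite mulr1; apply: fN; exact: r1.
by move=> j; have := yr (lift ord_max j); rewrite snoc_lift !mxE.
Qed.

Let KE h y t : K h (snoc y t) = h^-1 * \1_`]0, h] t * g y t.
Proof.
have E : \1_(D `&` [set z | 0 < xn z <= h]) (snoc y t) = \1_`]0, h] t * \1_D (snoc y t) :> R.
  rewrite !indicE -natrM mulnb; congr (_ %:R); congr (nat_of_bool _).
  apply/idP/idP => [|/andP[]]; rewrite !inE /=.
    by move=> [Dy]; rewrite xn_snoc => ty; apply/andP; split; rewrite inE//= in_itv.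
  by rewrite in_itv/= => ty Dy; rewrite xn_snoc.
by rewrite /K /g E; ring.
Qed.

(** Off the frontier, (y, 0) is interior either to D or to its complement, so the indicator of D is
    constant near it and [g y] inherits the continuity of [f] at 0. *)
Let g_cvg y : ~ frontier D (snoc y 0) -> forall e, 0 < e -> exists2 d, 0 < d &
  forall t, 0 < t < d -> `|g y t - g y 0| <= e.
Proof.
move=> nfr e e0.
have cs : continuous (fun t : R => snoc y t).
  move=> t; rewrite (_ : (fun t => _) = vshift (snoc y 0)); first exact: continuous_vshift.
  by apply/funext => s; exact: snoc_vshift.
have nf : \forall t \near (0 : R), `|f (snoc y 0) - f (snoc y t)| <= e.
  have : (f \o snoc y) t @[t --> (0 : R)] --> f (snoc y 0).
    by apply: (@cvg_comp _ _ _ (snoc y) f _ (nbhs (snoc y 0))); [exact: cs|exact: cf].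
  by move=> /cvgrPdist_le; apply.
have nD : \forall t \near (0 : R), D (snoc y t) <-> D (snoc y 0).
  have [Dy|nDy] := pselect (D (snoc y 0)).
    have : nbhs (snoc y 0) D by exact: open_nbhs_nbhs.
    by move=> /(cs 0) Hn; apply: (@filterS _ (nbhs (0 : R)) _ _ _ _ Hn) => t Dt; split.
  have : nbhs (snoc y 0) (~` closure D).
    apply: open_nbhs_nbhs; split; first by apply: closed_openC; exact: closed_closure.
    by move=> cl; apply: nfr; split => // /interior_subset.
  move=> /(cs 0) Hn; apply: (@filterS _ (nbhs (0 : R)) _ _ _ _ Hn) => t Dt; split => // Dt'; exfalso; apply: Dt; exact: subset_closure.
have /nbhs_ballP[d /= d0 Hd] : nbhs (0 : R) [set t | `|f (snoc y 0) - f (snoc y t)| <= e /\ (D (snoc y t) <-> D (snoc y 0))].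
  by apply: filterI.
exists d => // t /andP[t0 td].
have [ft Dt] : `|f (snoc y 0) - f (snoc y t)| <= e /\ (D (snoc y t) <-> D (snoc y 0)).
  by apply: Hd; rewrite /ball/= sub0r normrN gtr0_norm.
rewrite /g !indicE (_ : (snoc y t \in D) = (snoc y 0 \in D)); last first.
  by apply/idP/idP; rewrite !inE; move/Dt.
case: (_ \in D); last by rewrite !mul0r subrr normr0 ltW.
by rewrite !mul1r distrC.
Qed.

Let cvg_K : (\int[mu n.+1]_x (K (hk k) x)%:E @[k --> \oo] -->
  \int[mu n]_y (g y 0)%:E)%E.
Proof.
pose F k y := (\int[lebesgue_measure]_t (K (hk k) (snoc y t))%:E)%E.
have FE k : (\int[mu n.+1]_x (K (hk k) x)%:E = \int[mu n]_y F k y)%E.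
  exact: (integral_rVS (iK (hk0 k) (hk1 k))).
rewrite (_ : (fun k => _) = (fun k => \int[mu n]_y F k y)%E); last by apply/funext.
have FE' k y : F k y = (\int[lebesgue_measure]_t ((hk k)^-1 * \1_`]0%R, hk k] t * g y t)%:E)%E.
  by apply: eq_integral => t _; rewrite KE.
have gN' y t : `|g y t| <= N.
  apply: le_trans (gN y t) _; rewrite ler_piMr// indicE; by case: (_ \in _).
have [] // := @dominated_convergence _ _ _ (mu n) setT measurableT F (fun y => (g y 0)%:E)
  (fun y => (N * \1_(ccube 0 r) y)%:E).
- move=> k; exact: (measurable_fubini_F (integrable_rVS (iK (hk0 k) (hk1 k)))).
- apply/measurable_EFinP; apply: measurable_funM.
    exact: measurableT_comp (@measurable_indic _ _ R setT _ mD) (@measurable_snocr R n 0).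
  exact: measurableT_comp mf (@measurable_snocr R n 0).
(* The averages may fail to converge only for y with (y, 0) on the frontier of D, which is the flat
   part that [flat0] makes null. *)
- have := hausdorff0_negligible flat0; apply: negligibleS => y /= H; apply: contrapT => nfr; apply: H => _.
  rewrite (_ : F^~ y = (fun k => \int[lebesgue_measure]_t ((hk k)^-1 * \1_`]0%R, hk k] t * g y t)%:E)%E); last by apply/funext.
  apply: (@average_cvg R (g y) N) => //; apply: g_cvg => fr; apply: nfr; split => //=; exact: xn_snoc.
- apply: (@integrable_bounded_supp R n (fun y => N * \1_(ccube 0 r) y) N r).
  + by apply: measurable_funM => //; apply: measurable_indic; exact: measurable_ccube.
  + move=> y; rewrite indicE; case: (_ \in _); rewrite ?mulr1 ?mulr0 ?normr0// ger0_norm//.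
  + by move=> y ny; rewrite indicE memNset ?mulr0.
- apply: aeW => y k _; rewrite FE' -[X in (`|X|)%E]sube0.
  apply: (average_bound (M := N)) => // t _; rewrite subr0; exact: gN.
Qed.

(** Divided by h, the estimate of the exchanged points still carries the error C (1 + M) h H(S).
    Finiteness of H(S) makes it vanish as h tends to 0. *)
Lemma divergence_bound : (H S < +oo)%E ->
  (`|\int[mu n.+1]_(x in upper D) (partial ord_max f x)%:E +
     \int[mu n]_(y in thin D) (f (snoc y 0))%:E| <=
   C%:E * \int[H]_(z in S) `|f z|%:E)%E.
Proof.
move=> Soo.
have mS : measurable (S : set (caratheodory_type (@surface_outer R n))).
  exact: (borel_caratheodory (n := n.+1) n (measurable_upper_frontier D)).
have C0 : 0 <= C by rewrite mulr_ge0 ?exprn_ge0.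
have fS : H S \is a fin_num by rewrite ge0_fin_numE// measure_ge0.
pose I1 := (\int[mu n.+1]_x (\1_(upper D) x * partial ord_max f x)%:E)%E.
pose I2 := (\int[mu n]_y (g y 0)%:E)%E.
have -> : (\int[mu n.+1]_(x in upper D) (partial ord_max f x)%:E = I1)%E.
  rewrite integral_mkcond; apply: eq_integral => x _; rewrite patchE indicE.
  by case: ifP; rewrite ?mul1r ?mul0r.
have -> : (\int[mu n]_(y in thin D) (f (snoc y 0))%:E = I2)%E.
  rewrite integral_mkcond; apply: eq_integral => y _; rewrite patchE /g indicE.
  rewrite (_ : (y \in thin D) = (snoc y 0 \in D)); last by apply/idP/idP; rewrite !inE.
  by case: ifP; rewrite ?mul1r ?mul0r.
have fI1 : I1 \is a fin_num.
  apply: integrable_fin_num => //; apply: (@integrable_indic_mul _ _ r M) => //.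
    exact: continuous_measurable_rV.
  by move=> x Ux; apply: fM; apply: r1; exact: Ur.
have cv : (`|\int[mu n.+1]_x (G (hk k) x)%:E + \int[mu n.+1]_x (K (hk k) x)%:E| @[k --> \oo] --> `|I1 + I2|)%E.
  exact: cvg_abse (cvgeD (fin_num_adde_defr _ fI1) cvg_G cvg_K).
(* The added 1 only keeps [c] positive, so that h < e / c can be asked for. *)
pose c := C * (1 + M) * fine (H S) + 1.
have c0 : 0 < c by rewrite ltr_wpDl// !mulr_ge0// ?addr_ge0// fine_ge0.
apply/lee_addgt0Pr => e e0.
apply: (cvge_le _ cv); near=> k.
rewrite integral_GK//.
have mfl : measurable_fun setT (fun x => f x * leaving (hk k) x / hk k).
  by apply: measurable_funM => //; apply: measurable_funM => //; exact: measurable_leaving.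
apply: le_trans (le_abse_integral _ measurableT _) _; first exact/measurable_EFinP.
under eq_integral do rewrite /= normrM normfV (gtr0_norm (hk0 k)) mulrC EFinM.
rewrite ge0_integralZl_EFin//; last 2 first.
- by apply/measurable_EFinP; apply: measurableT_comp => //; apply: measurable_funM => //; exact: measurable_leaving.
- by rewrite invr_ge0 ltW.
apply: (@le_trans _ _ ((hk k)^-1%:E * ((C * hk k)%:E * \int[H]_(z in S) (`|f z| + (1 + M) * hk k)%:E))%E).
  by apply: lee_wpmul2l; [rewrite lee_fin invr_ge0 ltW|exact: integral_leaving].
rewrite muleA -EFinM mulrCA mulVf ?mulr1; last by rewrite gt_eqF.
under eq_integral do rewrite EFinD.
have mfc : measurable_fun (S : set (caratheodory_type (@surface_outer R n))) (fun z : caratheodory_type (@surface_outer R n) => `|f z|%:E).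
  have : measurable_fun setT (fun z => `|f z|%:E) by apply/measurable_EFinP; exact: measurableT_comp.
  by move=> /surface_measurable_fun ms; exact: (measurable_funTS ms).
have b0 : 0 <= (1 + M) * hk k by rewrite mulr_ge0 ?addr_ge0// ltW.
rewrite ge0_integralD//.
rewrite ge0_muleDr; [|exact: integral_ge0|by apply: integral_ge0 => z _; rewrite lee_fin].
apply: leeD2l; rewrite integral_cst// -(fineK fS) -!EFinM lee_fin.
have : hk k < e / c.
  by near: k; exact: (near_infty_natSinv_lt (PosNum (divr_gt0 e0 c0))).
rewrite ltr_pdivlMr// => /ltW; apply: le_trans.
rewrite /c mulrDr mulr1 [leLHS](_ : _ = hk k * (C * (1 + M) * fine (H S))); last by ring.
by rewrite lerDl ltW.
Unshelve. all: end_near. Qed.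

End divergence.

(** * Smooth functions and bumps *)

Section flatexp.
Context {R : realType}.
Implicit Types (P : {poly R}) (t : R).

(** The polynomial factor makes the family stable under differentiation: P becomes X^2 (P - P').
    With P = 1 it is the usual flat function exp(-1/t), and its smoothness needs no computation of
    higher derivatives. *)
Definition flatexp P t : R := if 0 < t then P.[t^-1] * expR (- t^-1) else 0.

(** In the induction on P half of the rate d pays for the smaller polynomial and the other half for
    the new factor s, through s <= (2/d) exp(d s / 2). *)
Lemma poly_expR_bound P (d : R) : 0 < d -> exists2 C, 0 <= C &
  forall s, 0 <= s -> `|P.[s]| <= C * expR (d * s).
Proof.
elim/poly_ind: P d => [|P c IH] d d0.
  by exists 0 => // s _; rewrite horner0 normr0 mul0r.
have d2 : 0 < d / 2 by rewrite divr_gt0.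
have [C C0 HC] := IH _ d2.
exists (C * (d / 2)^-1 + `|c|); first by rewrite addr_ge0// mulr_ge0// invr_ge0 ltW.
move=> s s0; rewrite hornerMXaddC (le_trans (ler_normD _ _))// mulrDl.
have E1 x : 0 <= x -> 1 <= expR x :> R.
  by move=> x0; apply: le_trans (expR_ge1Dx x); rewrite lerDl.
have sE : s <= (d / 2)^-1 * expR (d / 2 * s).
  by rewrite ler_pdivlMl//; apply: le_trans (expR_ge1Dx _); rewrite lerDr.
have cE : `|c| <= `|c| * expR (d * s) by rewrite ler_peMr// E1// mulr_ge0// ltW.
apply: lerD => //; rewrite normrM (ger0_norm s0).
have -> : expR (d * s) = expR (d / 2 * s) * expR (d / 2 * s).
  by rewrite -expRD -mulrDl -splitr.
apply: le_trans (ler_pM _ _ (HC s s0) sE) _ => //.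
by rewrite le_eqVlt; apply/orP; left; apply/eqP; ring.
Qed.

Lemma flatexp_bound P : exists2 C, 0 <= C & forall t, `|flatexp P t| <= C * t ^+ 2.
Proof.
(* At s = 1/t the factor X^2 is t^(-2), which is where the t^2 on the right-hand side comes from. *)
have [C C0 HC] := @poly_expR_bound ('X^2 * P) 1 ltr01.
exists C => // t; rewrite /flatexp; case: ifPn => [t0|_]; last first.
  by rewrite normr0 mulr_ge0 ?sqr_ge0.
have ti : 0 < t^-1 by rewrite invr_gt0.
have := HC _ (ltW ti); rewrite hornerM hornerXn mul1r normrM (ger0_norm (exprn_ge0 2 (ltW ti))) => H.
rewrite normrM (gtr0_norm (expR_gt0 _)) expRN ler_pdivrMr ?expR_gt0//.
rewrite -(ler_pM2l (exprn_gt0 2 ti)); apply: le_trans H _.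
rewrite exprVn le_eqVlt; apply/orP; left; apply/eqP; field.
by rewrite gt_eqF.
Qed.

Lemma is_derive_flatexp P t :
  is_derive t (1 : R) (flatexp P) (flatexp ('X^2 * (P - P^`())) t).
Proof.
have [t0|t0|->] := ltgtP t 0.
- have -> : flatexp ('X^2 * (P - P^`())) t = 0 by rewrite /flatexp ltNge ltW.
  apply: (@near_eq_is_derive R R R (fun=> 0) (flatexp P) t 1 0).
  by near=> s; rewrite /flatexp ltNge ltW//; near: s; exact: lt_nbhsl.
- have tn0 : t != 0 by rewrite gt_eqF.
  have D1 : is_derive t (1 : R) (fun s : R => s^-1) (- t ^- 2).
    have := @is_deriveV R id t 1 1 tn0 (is_derive_id _ _).
    by rewrite [_ *: _]mulr1.
  have D2 := is_derive1_comp (is_derive_poly P t^-1) D1.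
  have D3 := @is_derive1_comp R expR (fun s : R => - s^-1) t _ _ (is_derive_expR (- t^-1)) (is_deriveN D1).
  have D : is_derive t (1 : R) (fun s => P.[s^-1] * expR (- s^-1)) (flatexp ('X^2 * (P - P^`())) t).
    have := is_deriveM D2 D3 => /is_derive_eq; apply.
    change (P.[t^-1] * (expR (- t^-1) * (- - t ^- 2)) + expR (- t^-1) * (P^`().[t^-1] * (- t ^- 2)) =
      flatexp ('X^2 * (P - P^`())) t).
    rewrite /flatexp t0 hornerM hornerXn hornerD hornerN exprVn.
    by ring.
  apply: (near_eq_is_derive _ D).
  by near=> s; rewrite /flatexp ifT//; near: s; exact: lt_nbhsr.
- have -> : flatexp ('X^2 * (P - P^`())) 0 = 0 by rewrite /flatexp ltxx.
  (* The quadratic bound makes the difference quotient at 0 at most C |h|, on both sides. *)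
  have [C C0 HC] := flatexp_bound P.
  have H : (fun h : R => h^-1 *: ((flatexp P \o shift 0) (h *: (1 : R)) - flatexp P 0)) t @[t --> 0^'] --> (0 : R).
    apply/cvgrPdist_le => e e0.
    have eC : 0 < e / (C + 1) by rewrite divr_gt0// ltr_wpDl.
    near=> h.
    have h0 : h != 0 by near: h; exact: nbhs_dnbhs_neq.
    have hn : `|h| < e / (C + 1).
      near: h; apply: dnbhs0_lt; exact: eC.
    have F0 : flatexp P 0 = 0 by rewrite /flatexp ltxx.
    change (`|0 - h^-1 * (flatexp P (h * 1 + 0) - flatexp P 0)| <= e).
    rewrite F0 subr0 sub0r normrN mulr1 addr0 normrM normfV ler_pdivrMl ?normr_gt0//.
    apply: le_trans (HC h) _.
    have -> : h ^+ 2 = `|h| * `|h| by rewrite -normrM ger0_norm// -expr2 sqr_ge0.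
    rewrite mulrCA ler_wpM2l//; move: hn; rewrite ltr_pdivlMr ?ltr_wpDl// => hn.
    by rewrite (le_trans _ (ltW hn))// mulrDr mulr1 mulrC lerDl.
  by apply: DeriveDef; [exact: cvgP H|exact: cvg_lim H].
Unshelve. all: end_near. Qed.

Lemma is_derive_affine (c d t : R) : is_derive t (1 : R) (fun t : R => c * t + d) c.
Proof.
have := is_deriveD (is_deriveZ c (is_derive_id t (1 : R))) (is_derive_cst d t (1 : R)).
by move=> /is_derive_eq; apply; rewrite addr0 [_ *: _]mulr1.
Qed.

Lemma is_derive_flatexp_affine P (a b t : R) :
  is_derive t (1 : R) (fun t => flatexp P (a * t + b)) (flatexp ('X^2 * (P - P^`())) (a * t + b) * a).
Proof.
exact: (@is_derive1_comp R (flatexp P) (fun t => a * t + b) t _ _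
  (is_derive_flatexp P (a * t + b)) (is_derive_affine a b t)).
Qed.

End flatexp.

Section smooth.
Context {R : realType} {n : nat}.
Implicit Types (f g : 'rV[R]_n -> R) (x : 'rV[R]_n).
Local Notation e i := (delta_mx ord0 i : 'rV[R]_n).

Lemma partial_line f x i d : is_derive (0 : R) (1 : R) (fun t : R => f (x + t *: e i)) d ->
  partial i f x = d.
Proof.
case=> _ <-; rewrite /partial /derive.
have := line_quotient f x i 0; rewrite !scale0r !addr0 => <- //.
Qed.

Lemma smooth_closure (P : ('rV[R]_n -> R) -> Prop) :
  (forall f, P f -> forall x, differentiable f x) ->
  (forall f i, P f -> P (partial i f)) -> forall f, P f -> smooth f.
Proof.
move=> Pd Pp f Pf s x; apply: Pd.
by elim: s => //= i s IH; exact: Pp.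
Qed.

Lemma smooth_partial f i : smooth f -> smooth (partial i f).
Proof. by move=> sf s x; have := sf (rcons s i) x; rewrite -cats1 foldr_cat. Qed.

Lemma smooth_differentiable f x : smooth f -> differentiable f x.
Proof. by move=> /(_ [::] x). Qed.

Lemma smooth_derivable f x i : smooth f -> derivable f x (e i).
Proof. by move=> sf; apply: diff_derivable; exact: smooth_differentiable. Qed.

Lemma smooth_continuous f : smooth f -> continuous f.
Proof. by move=> sf x; apply: differentiable_continuous; exact: smooth_differentiable. Qed.

(** Smoothness is stated through iterated partial derivatives and is not visibly stable under
    products. This syntactic class is closed under sums, products and [partial], and its members are
    differentiable, so [smooth_closure] makes all of them smooth. The positive [d] in [smc_pow]
    keeps the base of the power away from 0. *)
Inductive smc : ('rV[R]_n -> R) -> Prop :=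
| smc_base f : smooth f -> smc f
| smc_cst c : smc (fun=> c)
| smc_coord i : smc (fun x => x ord0 i)
| smc_flat P i a b : smc (fun x => flatexp P (a * x ord0 i + b))
| smc_pow d i r : 0 < d -> smc (fun x => (x ord0 i ^+ 2 + d) `^ r)
| smc_add f g : smc f -> smc g -> smc (fun x => f x + g x)
| smc_mul f g : smc f -> smc g -> smc (fun x => f x * g x).

Let line_coord x i j (t : R) : (x + t *: e i) ord0 j = (j == i)%:R * t + x ord0 j.
Proof. by rewrite !mxE eqxx/= mulrC addrC. Qed.

Let diff_comp_coord (g : R -> R) i x : derivable g (x ord0 i) 1 ->
  differentiable (fun x : 'rV[R]_n => g (x ord0 i)) x.
Proof.
move=> dg; apply: (@differentiable_comp _ _ _ _ (fun x : 'rV[R]_n => x ord0 i) g).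
  exact: differentiable_coord.
exact/derivable1_diffP.
Qed.

Lemma is_derive_pow d r (t : R) : 0 < d ->
  is_derive t (1 : R) (fun t : R => (t ^+ 2 + d) `^ r) (r * (t ^+ 2 + d) `^ (r - 1) * (2 * t)).
Proof.
move=> d0.
have t2 : 0 < t ^+ 2 + d by rewrite ltr_wpDl// sqr_ge0.
have D1 : is_derive t (1 : R) (fun t : R => t ^+ 2 + d) (2 * t).
  have := is_deriveD (is_deriveM (is_derive_id t (1 : R)) (is_derive_id t (1 : R))) (is_derive_cst d t (1 : R)).
  move=> /is_derive_eq H; apply: H.
  by rewrite addr0 ![_ *: _]mulr1 mulr2n mulrDl !mul1r.
exact: (@is_derive1_comp R (fun s => s `^ r) (fun t => t ^+ 2 + d) t _ _ (is_derive1_powR r t2) D1).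
Qed.

Lemma smc_differentiable f : smc f -> forall x, differentiable f x.
Proof.
elim=> {f} [f sf|c|i|P i a b|d i r d0|f g _ df _ dg|f g _ df _ dg] x.
- exact: smooth_differentiable.
- exact: differentiable_cst.
- exact: differentiable_coord.
- apply: (@diff_comp_coord (fun t => flatexp P (a * t + b))).
  by have [] := is_derive_flatexp_affine P a b (x ord0 i).
- apply: (@diff_comp_coord (fun t => (t ^+ 2 + d) `^ r)).
  by have [] := is_derive_pow r (x ord0 i) d0.
- exact: differentiableD.
- exact: differentiableM.
Qed.

Lemma smc_partial f i : smc f -> smc (partial i f).
Proof.
elim=> {f} [f sf|c|j|P j a b|d j r d0|f g sf pf sg pg|f g sf pf sg pg].
- by apply: smc_base; exact: smooth_partial.
- rewrite (_ : partial i _ = fun=> 0); first exact: smc_cst.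
  by apply/funext => x; apply: partial_line; exact: is_derive_cst.
- rewrite (_ : partial i _ = fun=> (j == i)%:R); first exact: smc_cst.
  apply/funext => x; apply: partial_line.
  under eq_fun do rewrite line_coord; exact: is_derive_affine.
- rewrite (_ : partial i _ = fun x => flatexp ('X^2 * (P - P^`())) (a * x ord0 j + b) * (a * (j == i)%:R)).
    by apply: smc_mul; [exact: smc_flat|exact: smc_cst].
  apply/funext => x; apply: partial_line.
  under eq_fun do rewrite line_coord mulrDr mulrA -addrA.
  have := is_derive_flatexp_affine P (a * (j == i)%:R) (a * x ord0 j + b) 0.
  by rewrite mulr0 add0r.
- rewrite (_ : partial i _ = fun x => r * (x ord0 j ^+ 2 + d) `^ (r - 1) * (2 * x ord0 j) * (j == i)%:R).
    apply: smc_mul; last exact: smc_cst.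
    apply: smc_mul; last by apply: smc_mul; [exact: smc_cst|exact: smc_coord].
    by apply: smc_mul; [exact: smc_cst|exact: smc_pow].
  apply/funext => x; apply: partial_line.
  under eq_fun do rewrite line_coord.
  have := @is_derive1_comp R (fun t => (t ^+ 2 + d) `^ r) (fun t => (j == i)%:R * t + x ord0 j) 0 _ _
    (is_derive_pow r ((j == i)%:R * 0 + x ord0 j) d0) (is_derive_affine (j == i)%:R (x ord0 j) 0).
  by rewrite mulr0 add0r.
- rewrite (_ : partial i _ = fun x => partial i f x + partial i g x); first exact: smc_add.
  apply/funext => x; apply: deriveD; apply: diff_derivable; exact: smc_differentiable.
- rewrite (_ : partial i _ = fun x => f x * partial i g x + g x * partial i f x).
    by apply: smc_add; exact: smc_mul.
  apply/funext => x; apply: deriveM; apply: diff_derivable; exact: smc_differentiable.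
Qed.

Lemma smc_smooth f : smc f -> smooth f.
Proof. by apply: smooth_closure => {}f; [exact: smc_differentiable|move=> i; exact: smc_partial]. Qed.

End smooth.

(** * Integrability of powers near 0 *)

Section power.
Context {R : realType}.

(** The antiderivative is nonnegative at the lower end because b + 1 > 0, and dropping it leaves a
    bound uniform in e. *)
Lemma integral_powR_le (b e L : R) : -1 < b -> 0 < e -> e < L ->
  (\int[lebesgue_measure]_(t in `[e, L]) (t `^ b)%:E <= (L `^ (b + 1) / (b + 1))%:E)%E.
Proof.
move=> b1 e0 eL.
have b10 : 0 < b + 1 by lra.
pose F (t : R) : R := t `^ (b + 1) / (b + 1).
have dF (t : R) : 0 < t -> is_derive t (1 : R) F (t `^ b).
  move=> t0; have := is_deriveZ (b + 1)^-1 (is_derive1_powR (b + 1) t0).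
  rewrite (_ : _ \*: _ = F); last by apply/funext => s; rewrite /F mulrC.
  move=> /is_derive_eq; apply.
  change ((b + 1)^-1 * ((b + 1) * t `^ (b + 1 - 1)) = t `^ b).
  by rewrite mulKf ?gt_eqF// addrK.
have cont (g : R -> R) (dg : R -> R) : (forall t : R, 0 < t -> is_derive t (1 : R) g (dg t)) ->
    forall t : R, 0 < t -> {for t, continuous g}.
  move=> H t t0; apply: differentiable_continuous; apply/derivable1_diffP.
  by have [] := H t t0.
rewrite (@continuous_FTC2 _ (fun t => t `^ b) F)//.
- by rewrite -EFinB lee_fin lerBlDr lerDl divr_ge0 ?powR_ge0// ltW.
- apply: continuous_in_subspaceT => t; rewrite inE/= in_itv/= => /andP[te _].
  have H := cont (fun t => t `^ b) (fun t => b * t `^ (b - 1)) (fun s s0 => is_derive1_powR b s0).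
  by apply: H; exact: lt_le_trans te.
- split.
  + move=> t /[!in_itv]/= /andP[te _]; have [] // := dF t (lt_trans e0 te).
  + by apply: cvg_at_right_filter; apply: (cont _ _ dF).
  + by apply: cvg_at_left_filter; apply: (cont _ _ dF); exact: lt_trans eL.
- move=> t /[!in_itv]/= /andP[te _]; rewrite derive1E.
  by have [] := dF t (lt_trans e0 te).
Qed.

Local Open Scope ereal_scope.

Lemma integral_powR_lty (b L : R) : (-1 < b)%R -> (0 < L)%R ->
  \int[lebesgue_measure]_(t in `]0%R, L]) (t `^ b)%:E < +oo.
Proof.
(* The denominators start at 2 so that the lower end is strictly below L, as [integral_powR_le]
   requires. *)
move=> b1 L0; pose S (k : nat) : set R := `[(L / k.+2%:R)%R, L]%classic.
have SE : `]0%R, L]%classic = \bigcup_k S k.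
  apply/seteqP; split => t /=; last first.
    move=> [k _]; rewrite /S /= !in_itv/= => /andP[kt ->]; rewrite andbT.
    by apply: lt_le_trans kt; rewrite divr_gt0.
  rewrite in_itv/= => /andP[t0 tL].
  have [k _ Hk] := near_infty_natSinv_lt (PosNum (divr_gt0 t0 L0)).
  exists k => //; rewrite /S /= in_itv/= tL andbT.
  have := Hk k.+1 (leqnSn k); rewrite /= => /ltW; rewrite ler_pdivlMr// => H.
  by rewrite mulrC.
have mp : measurable_fun setT (fun t : R => (t `^ b)%:E).
  by apply/measurable_EFinP; exact: measurable_powR.
have cv : \int[lebesgue_measure]_(t in S k) (t `^ b)%:E @[k --> \oo] -->
    \int[lebesgue_measure]_(t in \bigcup_k S k) (t `^ b)%:E.
  apply: ge0_nondecreasing_set_cvg_integral.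
  - move=> i j ij; apply/subsetPset => t; rewrite /S /= !in_itv/= => /andP[it ->]; rewrite andbT.
    apply: le_trans it; rewrite ler_wpM2l ?(ltW L0)// lef_pV2 ?posrE// ler_nat !ltnS//.
  - by move=> k; exact: measurable_itv.
  - by move=> k; exact: measurable_funTS.
  - by move=> k t _; rewrite lee_fin powR_ge0.
rewrite SE; apply: (@le_lt_trans _ _ (L `^ (b + 1) / (b + 1))%:E); last by rewrite ltry.
apply: (cvge_le _ cv); near=> k; apply: integral_powR_le => //.
  by rewrite divr_gt0.
by rewrite ltr_pdivrMr// ltr_pMr// ltr1n.
Unshelve. all: end_near. Qed.

End power.

Lemma measurable_initv (R : realType) n : measurable_fun setT (@initv R n).
Proof.
move=> _; apply: (@measurability _ _ _ _ _ _
  (\big[setU/set0]_(i < n) preimage_set_system [set: 'rV[R]_n] (rV_coor i) measurable)) => //.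
move=> _ [B + <-]; rewrite -bigcup_seq => -[i _ [Y mY <-]].
rewrite setTI setTI -comp_preimage.
rewrite (_ : _ \o _ = (fun x : 'rV[R]_n.+1 => x ord0 (lift ord_max i))); last first.
  by apply/funext => x; rewrite /= /rV_coor mxE.
rewrite -[X in measurable X]setTI; exact: (@measurable_coord R n.+1 _ measurableT _ mY).
Qed.

(** * Weighted L^2 and weak gradients *)

Section weighted.
Context {R : realType} {n : nat}.
Variables (D : set 'rV[R]_n.+1) (a : R).
Hypotheses (oD : open D) (bD : bounded_set D) (a1 : -1 < a < 1).
Local Notation U := (upper D).
Local Notation mu := (@lebesgue_rV R n.+1).
Implicit Types (f g : 'rV[R]_n.+1 -> R).

Lemma measurable_upper : measurable U.
Proof. by apply: open_measurable_rV; exact: open_upper. Qed.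

Let mU := measurable_upper.

Lemma measurable_xn_powR b : measurable_fun setT (fun x : 'rV[R]_n.+1 => xn x `^ b).
Proof. exact: measurableT_comp (measurable_powR b) (@measurable_xn R n). Qed.

Lemma integrable_xn_powR b : -1 < b -> mu.-integrable U (fun x => (xn x `^ b)%:E).
Proof.
move=> b1; have [r r0 Dr] := bounded_ccube bD.
have mp : measurable_fun setT (fun x : 'rV[R]_n.+1 => (xn x `^ b)%:E).
  by apply/measurable_EFinP; exact: measurable_xn_powR.
apply/integrableP; split; first exact: measurable_funTS.
(* A product majorant on a cylinder, to which Tonelli applies; enlarging r to r + 1 makes its height
   positive even when r = 0. *)
pose g (x : 'rV[R]_n.+1) : \bar R :=
  ((\1_(ccube 0 (r + 1)) (initv x))%:E * ((xn x `^ b) * \1_`]0%R, (r + 1)%R] (xn x))%:E)%E.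
have mg : measurable_fun setT g.
  apply/measurable_EFinP; apply: measurable_funM.
    apply: (measurableT_comp (@measurable_indic _ _ R setT _ (@measurable_ccube R n 0 (r + 1)))).
    apply: measurable_initv.
  apply: measurable_funM; first exact: measurable_xn_powR.
  exact: (measurableT_comp (@measurable_indic _ _ R setT `]0%R, (r + 1)%R]%classic (measurable_itv _)) (@measurable_xn R n)).
have g0 x : (0 <= g x)%E by rewrite /g -EFinM lee_fin !mulr_ge0// powR_ge0.
apply: (@le_lt_trans _ _ (\int[mu]_x g x)%E).
  rewrite integral_mkcond; apply: ge0_le_integral => //.
  - by move=> x _; rewrite patchE; case: ifP.
  - have : measurable_fun U (abse \o (fun x : 'rV[R]_n.+1 => (xn x `^ b)%:E)).
      by apply: measurableT_comp => //; exact: measurable_funTS.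
    by move=> /(measurable_restrictT _ mU).
  - move=> x _; rewrite patchE; case: ifPn => [|_]; last exact: g0.
    rewrite inE => -[/Dr xr x0]; rewrite /g !indicE !mem_set ?mulr1 ?mul1e//=.
    + by rewrite ger0_norm// powR_ge0.
    + rewrite in_itv/= x0/=; have := xr ord_max; rewrite mxE subr0 => /(le_trans (ler_norm _)) H.
      by rewrite (le_trans H)// lerDl.
    + by move=> j; have := xr (lift ord_max j); rewrite !mxE !subr0 => H; rewrite (le_trans H)// lerDl.
rewrite ge0_integral_rVS//.
have q0 : (0 <= \int[lebesgue_measure]_(t in `]0%R, (r + 1)%R]) (t `^ b)%:E)%E.
  by apply: integral_ge0 => t _; rewrite lee_fin powR_ge0.
have r10 : 0 < r + 1 by rewrite ltr_wpDl.
under eq_integral => y _.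
  under eq_integral do rewrite /g initv_snoc xn_snoc.
  rewrite ge0_integralZl_EFin//; last 2 first.
  - by move=> t _; rewrite lee_fin mulr_ge0// powR_ge0.
  - apply/measurable_EFinP; apply: measurable_funM; first exact: measurable_powR.
    by apply: measurable_indic; exact: measurable_itv.
  rewrite (_ : (\int[_]_t _)%E = (\int[lebesgue_measure]_(t in `]0%R, (r + 1)%R]) (t `^ b)%:E)%E); last first.
    rewrite [RHS]integral_mkcond; apply: eq_integral => t _; rewrite patchE indicE.
    by case: ifP; rewrite ?mulr1 ?mulr0.
  over.
have mi : measurable_fun setT (fun y : 'rV[R]_n => (\1_(ccube 0 (r + 1)) y : R)%:E).
  by apply/measurable_EFinP; apply: measurable_indic; exact: measurable_ccube.
rewrite ge0_integralZr//.
rewrite integral_indic ?setIT; [|exact: measurableT|exact: measurable_ccube].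
rewrite lebesgue_ccube ?ltW//; apply: lte_mul_pinfty; rewrite ?lee_fin ?exprn_ge0 ?mulr_ge0 ?ltW//.
exact: integral_powR_lty.
Qed.

(** Integrated with w = x_n^a, this pointwise inequality takes the place of the Cauchy-Schwarz
    inequality: the free parameter d makes the last term small before the weighted norm is. *)
Lemma amgm_weight (y w d : R) : 0 < w -> 0 < d -> `|y| <= d^-1 * (y ^+ 2 * w) + d * w^-1.
Proof.
move=> w0 d0.
have y2 : y ^+ 2 = `|y| ^+ 2 by rewrite real_normK ?num_real.
rewrite y2; set z := `|y|; have z0 : 0 <= z by rewrite normr_ge0.
have k0 : 0 < d^-1 * w by rewrite mulr_gt0 ?invr_gt0.
have -> : d * w^-1 = (d^-1 * w)^-1 by rewrite invfM invrK.
rewrite mulrCA [X in _ <= X + _](_ : _ = z ^+ 2 * (d^-1 * w)); last by [].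
set k := d^-1 * w in k0 *.
have : 0 <= (z * k - 1) ^+ 2 * k^-1 by rewrite mulr_ge0 ?sqr_ge0// invr_ge0 ltW.
have -> : (z * k - 1) ^+ 2 * k^-1 = z ^+ 2 * k - 2 * z + k^-1 by field; rewrite gt_eqF.
by lra.
Qed.

Lemma wsqnorm_ge0 f : (0 <= wsqnorm D a f)%E.
Proof. by apply: integral_ge0 => x _; rewrite lee_fin mulr_ge0 ?sqr_ge0 ?powR_ge0. Qed.

Lemma measurable_wsq f : measurable_fun U f -> measurable_fun U (fun x => (f x ^+ 2 * xn x `^ a)%:E).
Proof.
move=> mf; apply/measurable_EFinP; apply: measurable_funM; first exact: measurable_funX.
by apply: measurable_funTS; exact: measurable_xn_powR.
Qed.

Let K : \bar R := (\int[mu]_(x in U) (xn x `^ (- a))%:E)%E.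

Lemma integral_abs_le f d : measurable_fun U f -> 0 < d ->
  (\int[mu]_(x in U) `|f x|%:E <= d^-1%:E * wsqnorm D a f +
     d%:E * \int[mu]_(x in U) (xn x `^ (- a))%:E)%E.
Proof.
move=> mf d0.
have mp : measurable_fun U (fun x => (xn x `^ (- a))%:E).
  by apply/measurable_EFinP; apply: measurable_funTS; exact: measurable_xn_powR.
rewrite -ge0_integralZl_EFin//; [|by move=> x _; rewrite lee_fin mulr_ge0 ?sqr_ge0 ?powR_ge0|exact: measurable_wsq|by rewrite invr_ge0 ltW].
rewrite -ge0_integralZl_EFin//; [|by move=> x _; rewrite lee_fin powR_ge0|by rewrite ltW].
rewrite -ge0_integralD//; last 4 first.
- by move=> x _; rewrite -EFinM lee_fin mulr_ge0 ?invr_ge0 ?(ltW d0)// mulr_ge0 ?sqr_ge0 ?powR_ge0.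
- by apply: emeasurable_funM => //; exact: measurable_wsq.
- by move=> x _; rewrite -EFinM lee_fin mulr_ge0 ?(ltW d0) ?powR_ge0.
- by apply: emeasurable_funM.
apply: ge0_le_integral => //.
- by apply/measurable_EFinP; apply: measurableT_comp.
- apply: emeasurable_funD; apply: emeasurable_funM => //; exact: measurable_wsq.
- move=> x [_ /= x0]; rewrite -!EFinM -EFinD lee_fin powRN; apply: amgm_weight => //; exact: powR_gt0.
Qed.

Let Kfin : exists2 k : R, (0 <= k)%R & (\int[mu]_(x in U) (xn x `^ (- a))%:E)%E = k%:E.
Proof.
have na1 : -1 < - a by case/andP: a1 => _; rewrite ltrN2.
have := integrable_xn_powR na1 => /(integrable_fin_num mU) fK.
exists (fine (\int[mu]_(x in U) (xn x `^ (- a))%:E)%E); last by rewrite fineK.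
by apply: fine_ge0; apply: integral_ge0 => x _; rewrite lee_fin powR_ge0.
Qed.

Lemma wL2_integrable f : wL2 D a f -> mu.-integrable U (EFin \o f).
Proof.
move=> [mf ff]; apply/integrableP; split; first exact/measurable_EFinP.
have [k k0 Kk] := Kfin.
apply: le_lt_trans (integral_abs_le mf ltr01) _.
by rewrite Kk invr1 !mul1e lte_add_pinfty// ltry.
Qed.

Lemma wsqnorm_cvg_L1 (F : nat -> 'rV[R]_n.+1 -> R) : (forall k, measurable_fun U (F k)) ->
  wsqnorm D a (F k) @[k --> \oo] --> 0%E ->
  (\int[mu]_(x in U) `|F k x|%:E @[k --> \oo] --> 0)%E.
Proof.
move=> mF wF; have [K0 K00 KE] := Kfin.
apply: cvge_abs_le => e e0.
(* Then d K0 <= e / 2, and a weighted norm below d e / 2 contributes the other half of e. *)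
pose d := e / 2 / (K0 + 1).
have d0 : 0 < d by rewrite !divr_gt0// ltr_wpDl.
have de0 : 0 < d * (e / 2) by rewrite mulr_gt0// divr_gt0.
have : \forall k \near \oo, (wsqnorm D a (F k) <= (d * (e / 2))%:E)%E.
  have /fine_cvgP[fw /cvgrPdist_le/(_ _ de0) H] := wF.
  near=> k; have : `|0 - (fine \o (fun k => wsqnorm D a (F k))) k| <= d * (e / 2) by near: k.
  rewrite sub0r normrN /= => h; rewrite -(fineK (_ : wsqnorm D a (F k) \is a fin_num)) ?lee_fin; last by near: k.
  exact: le_trans (ler_norm _) h.
apply: filterS => k wk; rewrite sube0 gee0_abs; last by apply: integral_ge0 => x _; rewrite lee_fin.
apply: le_trans (integral_abs_le (mF k) d0) _; rewrite KE.
apply: (@le_trans _ _ (d^-1%:E * (d * (e / 2))%:E + d%:E * K0%:E)%E).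
  by apply: leeD => //; apply: lee_wpmul2l => //; rewrite lee_fin invr_ge0 ltW.
rewrite -!EFinM -EFinD lee_fin [d^-1 * _]mulKf ?gt_eqF//.
have : d * K0 <= e / 2.
  rewrite /d mulrAC ler_pdivrMr ?ltr_wpDl// ler_wpM2l ?divr_ge0 ?(ltW e0)//.
  by rewrite lerDl.
by lra.
Unshelve. all: end_near. Qed.

End weighted.

(** * Bump functions and approximation of indicators *)

Section bumps.
Context {R : realType} {n : nat}.
Implicit Types (V U : set 'rV[R]_n) (f : 'rV[R]_n -> R).

Lemma flatexp1_bounds (t : R) : 0 <= flatexp 1 t <= 1.
Proof.
rewrite /flatexp; case: ifPn => [t0|_]; last by rewrite lexx ler01.
by rewrite hornerC mul1r expR_ge0/= -expR0 ler_expR oppr_le0 invr_ge0 ltW.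
Qed.

Lemma flatexp1_gt0 (t : R) : (0 < flatexp 1 t) = (0 < t).
Proof.
rewrite /flatexp; case: ifPn => [t0|_]; last by rewrite ltxx.
by rewrite hornerC mul1r expR_gt0.
Qed.

Lemma smc_prod (I : Type) (s : seq I) (F : I -> 'rV[R]_n -> R) : (forall i, smc (F i)) ->
  smc (fun x => \prod_(i <- s) F i x).
Proof.
move=> sF; elim: s => [|i s IH].
  by under eq_fun do rewrite big_nil; exact: smc_cst.
by under eq_fun do rewrite big_cons; exact: smc_mul.
Qed.

Lemma smc_exp f k : smc f -> smc (fun x => f x ^+ k).
Proof.
move=> sf; elim: k => [|k IH]; first by under eq_fun do rewrite expr0; exact: smc_cst.
by under eq_fun do rewrite exprS; exact: smc_mul.
Qed.

Lemma smc_onem f : smc f -> smc (fun x => 1 - f x).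
Proof.
move=> sf; rewrite (_ : (fun x => _) = fun x => 1 + (-1) * f x); last first.
  by apply/funext => x; rewrite mulN1r.
by apply: smc_add; [exact: smc_cst|apply: smc_mul => //; exact: smc_cst].
Qed.

(** Coordinate i contributes the flat function at x_i - (q_i - r) and at (q_i + r) - x_i, so the
    product is positive exactly on the open cube. The arguments are written in the affine form of
    [smc_flat]. *)
Definition bump (q : 'rV[R]_n) (r : R) (x : 'rV[R]_n) : R :=
  \prod_(i < n) (flatexp 1 (1 * x ord0 i + (r - q ord0 i)) *
                 flatexp 1 ((-1) * x ord0 i + (r + q ord0 i))).

Lemma smc_bump q r : smc (bump q r).
Proof. by apply: smc_prod => i; apply: smc_mul; exact: smc_flat. Qed.

Lemma bump_bounds q r x : 0 <= bump q r x <= 1.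
Proof.
have H i : 0 <= flatexp 1 (1 * x ord0 i + (r - q ord0 i)) * flatexp 1 ((-1) * x ord0 i + (r + q ord0 i)) <= 1.
  have /andP[a0 a1] := flatexp1_bounds (1 * x ord0 i + (r - q ord0 i)).
  have /andP[b0 b1] := flatexp1_bounds ((-1) * x ord0 i + (r + q ord0 i)).
  by rewrite mulr_ge0//= mulr_ile1.
rewrite prodr_ge0//=; last by move=> i _; case/andP: (H i).
by apply: prodr_ile1 => i _; exact: H.
Qed.

Lemma bump_gt0 q r x : ocube q r x -> 0 < bump q r x.
Proof.
move=> xq; apply: prodr_gt0 => i _; have := xq i; rewrite ltr_distl => /andP[h1 h2].
by rewrite mulr_gt0// flatexp1_gt0; lra.
Qed.

Lemma bump_out q r x : ~ ocube q r x -> bump q r x = 0.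
Proof.
move=> nx; have [i ni] : exists i, ~ `|x ord0 i - q ord0 i| < r by exact/existsNP.
rewrite /bump (bigD1 i)//; apply/eqP; rewrite !mulf_eq0 -!orbA.
have [//|n1] := boolP (flatexp 1 (1 * x ord0 i + (r - q ord0 i)) == 0).
have [//|n2] := boolP (flatexp 1 ((-1) * x ord0 i + (r + q ord0 i)) == 0).
exfalso; apply: ni.
have p1 : 0 < flatexp 1 (1 * x ord0 i + (r - q ord0 i)).
  by rewrite lt_neqAle eq_sym n1; case/andP: (flatexp1_bounds (1 * x ord0 i + (r - q ord0 i))).
have p2 : 0 < flatexp 1 ((-1) * x ord0 i + (r + q ord0 i)).
  by rewrite lt_neqAle eq_sym n2; case/andP: (flatexp1_bounds ((-1) * x ord0 i + (r + q ord0 i))).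
move: p1 p2; rewrite !flatexp1_gt0 ltr_distl => p1 p2; apply/andP; split; lra.
Qed.

(* With bumps [b j] positive exactly on the cubes whose union is [V], the
   functions [1 - prod_(j < m) (1 - b j) ^+ m] increase to the indicator of [V]. *)
Lemma test_functions_indic V : open V -> exists theta : nat -> 'rV[R]_n -> R,
  [/\ forall m, test_function V (theta m),
      forall m x, `|theta m x| <= 1 &
      forall x, theta m x @[m --> \oo] --> (\1_V x : R)].
Proof.
move=> oV; have [C [VE HC]] := open_ocubes oV.
have /choice[b Hb] : forall j, exists b : 'rV[R]_n -> R, [/\ smc b, forall x, 0 <= b x <= 1,
    forall x, C j x -> 0 < b x &
    exists K, [/\ compact K, K `<=` V & forall x, ~ K x -> b x = 0]].
  move=> j; have [Cj|[q [r [r0 Cj qV]]]] := HC j.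
    exists (fun=> 0); split => //; first exact: smc_cst.
      by move=> x; rewrite lexx ler01.
      by move=> x; rewrite Cj.
    by exists set0; split => //; exact: compact0.
  exists (bump q r); split; [exact: smc_bump|exact: bump_bounds|by move=> x; rewrite Cj; exact: bump_gt0|].
  exists (ccube q r); split => //; first exact: compact_ccube.
  by move=> x nx; apply: bump_out => xq; apply: nx => i; exact/ltW/xq.
pose P m x := \prod_(j < m) (1 - b j x) ^+ m.
have bb j x : 0 <= 1 - b j x <= 1.
  by have [_ H _ _] := Hb j; have := H x; rewrite subr_ge0 gerBl andbC.
have Pb m x : 0 <= P m x <= 1.
  have H j : 0 <= (1 - b j x) ^+ m <= 1.
    by have /andP[h0 h1] := bb j x; rewrite exprn_ge0//= exprn_ile1.
  rewrite /P prodr_ge0//=; last by move=> j _; case/andP: (H j).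
  by apply: prodr_ile1 => j _; exact: H.
exists (fun m x => 1 - P m x); split.
- move=> m; split.
    apply: smc_smooth; apply: smc_onem; apply: (@smc_prod _ _ (fun (j : 'I_m) x => (1 - b j x) ^+ m)) => j.
    by apply: smc_exp; apply: smc_onem; have [] := Hb j.
  have : exists K, [/\ compact K, K `<=` V & forall x, ~ K x -> forall j, (j < m)%N -> b j x = 0].
    elim: m => [|m [K [cK KV K0]]]; first by exists set0; split => //; exact: compact0.
    have [_ _ _ [L [cL LV L0]]] := Hb m.
    exists (K `|` L); split; [exact: compactU|by move=> x [/KV|/LV]|].
    move=> x nKL j; rewrite ltnS leq_eqVlt => /orP[/eqP ->|jm].
      by apply: L0 => Lx; apply: nKL; right.
    by apply: K0 => // Kx; apply: nKL; left.
  move=> [K [cK KV K0]]; exists K; split => // x nK.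
  by rewrite /P big1 ?subrr// => j _; rewrite (K0 x nK j)// subr0 expr1n.
- by move=> m x; have /andP[h0 h1] := Pb m x; rewrite ger0_norm ?subr_ge0// gerBl.
- move=> x; rewrite indicE; have [Vx|nVx] := boolP (x \in V); last first.
    rewrite (_ : (fun m => _) = fun=> 0); first exact: cvg_cst.
    apply/funext => m; rewrite /P big1 ?subrr// => j _.
    have [_ _ _ [K [_ KV K0]]] := Hb j.
    rewrite K0 ?subr0 ?expr1n// => /KV Vx; by rewrite notin_setE in nVx.
  move: Vx; rewrite inE {1}VE => -[j0 _ Cx].
  have bpos : 0 < b j0 x by have [_ _ H _] := Hb j0; exact: H.
  have g1 : `|1 - b j0 x| < 1.
    by have /andP[h0 h1] := bb j0 x; rewrite ger0_norm// ltrBlDr ltrDl.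
  have Pcv : P m x @[m --> \oo] --> 0.
    have gc := cvg_expr g1.
    apply: (squeeze_cvgr _ (cvg_cst 0) gc); near=> m.
    have /andP[-> _] /= := Pb m x.
    have jm : (j0 < m)%N by near: m; exact: nbhs_infty_gt.
    rewrite /P (bigD1 (Ordinal jm))//= ler_piMr//.
      by have /andP[h0 _] := bb j0 x; rewrite exprn_ge0.
    apply: prodr_ile1 => j _; have /andP[h0 h1] := bb j x.
    by rewrite exprn_ge0//= exprn_ile1.
  rewrite -[X in _ --> X]subr0; apply: cvgB => //; exact: cvg_cst.
Unshelve. all: end_near. Qed.

Lemma measurable_test_function U eta : test_function U eta -> measurable_fun setT eta.
Proof. by move=> [s _]; apply: continuous_measurable_rV; exact: smooth_continuous. Qed.

End bumps.

(** * The fundamental lemma of the calculus of variations *)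

Section variations.
Context {R : realType} {n : nat}.
Local Notation mu := (@lebesgue_rV R n).
Local Open Scope ereal_scope.

(** Bounded test functions converging to the indicator of an open subset of U make the integral of f
    over it vanish, by dominated convergence. The vanishing spreads to all Borel sets, and then f =
    0 almost everywhere. *)
Lemma integral_test_function_eq0 (U : set 'rV[R]_n) (f : 'rV[R]_n -> R) : open U ->
  mu.-integrable U (EFin \o f) ->
  (forall eta, test_function U eta -> \int[mu]_(x in U) (f x * eta x)%:E = 0) ->
  ae_eq mu U (EFin \o f) (cst 0).
Proof.
move=> oU fi H; have mU : measurable U by exact: open_measurable_rV.
have mf : measurable_fun U f by case/integrableP: fi => /measurable_EFinP.
have fiA A : measurable A -> mu.-integrable (U `&` A) (EFin \o f).
  move=> mA; apply: (integrableS mU _ _ fi); [exact: measurableI|exact: subIsetl].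
have open0 V : open V -> \int[mu]_(x in U `&` V) (f x)%:E = 0.
  move=> oV; have [th [tth th1 thV]] := test_functions_indic (openI oU oV).
  have E m : \int[mu]_(x in U) (f x * th m x)%:E = 0.
    apply: H; have [s [K [cK KUV K0]]] := tth m; split => //; exists K; split => //.
    by move=> x /KUV[].
  have cv : \int[mu]_(x in U) (f x * th m x)%:E @[m --> \oo] -->
      \int[mu]_(x in U) (f x * \1_(U `&` V) x)%:E.
    apply: (@dominated_cvg _ _ _ _ _ mU _ _ (fun x => `|f x|%:E)) => //.
    - move=> m; apply/measurable_EFinP; apply: measurable_funM => //.
      by apply: measurable_funTS; exact: measurable_test_function (tth m).
    - move=> x _; apply/fine_cvgP; split; first exact: nearW.
      by apply: cvgM; [exact: cvg_cst|exact: thV].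
    - exact: (integrable_abse fi).
    - by move=> m x _; rewrite lee_fin normrM ler_piMr.
  transitivity (\int[mu]_(x in U) (f x * \1_(U `&` V) x)%:E).
    rewrite [LHS]integral_mkcond [RHS]integral_mkcond; apply: eq_integral => x _.
    rewrite !patchE indicE in_setI; case: (x \in U) => //=.
    by case: (x \in V); rewrite ?mulr1 ?mulr0.
  by rewrite -(cvg_lim _ cv)//; apply/cvg_lim => //; under eq_fun do rewrite E; exact: cvg_cst.
have all0 A : measurable A -> \int[mu]_(x in U `&` A) (f x)%:E = 0.
  move=> mA; have mAo : <<s @open 'rV[R]_n >> A by rewrite -measurable_open_rV.
  (* Stability under complements uses that the integral over all of U is 0, which is the open case
     with the whole space. *)
  move: A mAo {mA}; apply: (dynkin_induction (P := fun A => \int[mu]_(x in U `&` A) (f x)%:E = 0)).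
  - exact: measurable_open_rV.
  - by move=> A B; exact: openI.
  - by apply: open0; exact: openT.
  - by move=> A; exact: open0.
  - move=> A mA A0; have := open0 setT openT; rewrite setIT.
    have -> : \int[mu]_(x in U) (f x)%:E = \int[mu]_(x in (U `&` A) `|` (U `&` ~` A)) (f x)%:E.
      by rewrite -setIUr setUv setIT.
    rewrite integral_setU.
    + by rewrite A0 add0e.
    + exact: measurableI.
    + by apply: measurableI => //; exact: measurableC.
    + by rewrite -setIUr setUv setIT; exact/measurable_EFinP.
    + by apply/disj_setPS => x [[_ Ax] [_]].
  - move=> F mF tF F0; rewrite setI_bigcupr integral_bigcup.
    + by apply: eseries0 => i _ _; exact: F0.
    + by apply: trivIset_setIl.
    + by move=> k; exact: measurableI.
    + by rewrite -setI_bigcupr; apply: fiA; exact: bigcupT_measurable.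
apply: integral_ae_eq => // E EU mE.
rewrite integral_cst// mul0e -[RHS](all0 E mE); congr (integral _ _ _).
by apply/seteqP; split => [x Ex|x []//]; split => //; exact: EU.
Qed.

End variations.

(** * Derivatives of compactly supported functions have integral zero *)

Section integral_partial.
Context {R : realType}.
Local Notation mu := (@lebesgue_rV R).

Lemma partial_out n (f : 'rV[R]_n -> R) i (A : set 'rV[R]_n) x : closed A ->
  (forall x, ~ A x -> f x = 0) -> ~ A x -> partial i f x = 0.
Proof.
move=> cA f0 nA; rewrite /partial -(@derive_cst R _ _ (0 : R) x (delta_mx ord0 i : 'rV[R]_n)).
apply: near_eq_derive.
have : nbhs x (~` A) by apply: open_nbhs_nbhs; split => //; exact: closed_openC.
by apply: filterS => y ny; exact: f0.
Qed.

Lemma line_derive n (f : 'rV[R]_n -> R) x i d :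
  is_derive (0 : R) (1 : R) (fun t : R => f (x + t *: delta_mx ord0 i)) d ->
  derivable f x (delta_mx ord0 i) /\ partial i f x = d.
Proof.
move=> D; split; last exact: partial_line.
by case: D; rewrite /derivable (line_quotient f x i 0) scale0r addr0.
Qed.

Lemma snoc_line_lift n (y : 'rV[R]_n) t s j :
  snoc (y + s *: delta_mx ord0 j) t = snoc y t + s *: delta_mx ord0 (lift ord_max j).
Proof.
apply/rowP => i; case: (unliftP ord_max i) => [k|] ->.
  by rewrite snoc_lift !mxE liftK eqxx/= (inj_eq (@lift_inj _ _)).
by rewrite snoc_max !mxE unlift_none (negbTE (neq_lift _ _)) andbF mulr0 addr0.
Qed.

Lemma snoc_line_max n (y : 'rV[R]_n) t : snoc y t = snoc y 0 + t *: delta_mx ord0 ord_max.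
Proof. by rewrite -vshiftE -snoc_vshift. Qed.

Lemma continuous_snocr n (t : R) : continuous (fun y : 'rV[R]_n => snoc y t).
Proof.
move=> y A /nbhs_ballP[e /= e0 eA]; apply/nbhs_ballP; exists e => //= z zy; apply: eA.
rewrite -ocubeE// => i; move: zy; rewrite -ocubeE// => zy.
case: (unliftP ord_max i) => [j|] ->; first by rewrite !snoc_lift; exact: zy.
by rewrite !snoc_max subrr normr0.
Qed.

Lemma derivable_slice n (f : 'rV[R]_n.+1 -> R) y t j :
  derivable f (snoc y t) (delta_mx ord0 (lift ord_max j)) ->
  derivable (fun y => f (snoc y t)) y (delta_mx ord0 j) /\
  partial j (fun y => f (snoc y t)) y = partial (lift ord_max j) f (snoc y t).
Proof.
move=> df; have := @is_derive_line R n.+1 f (snoc y t) (lift ord_max j) 0.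
rewrite scale0r addr0 => /(_ df) D.
have E : (fun s : R => f (snoc (y + s *: delta_mx ord0 j) t)) =
    (fun s : R => f (snoc y t + s *: delta_mx ord0 (lift ord_max j))).
  by apply/funext => s; rewrite snoc_line_lift.
by rewrite -E in D; exact: line_derive D.
Qed.

Lemma integral_derive0 (g dg : R -> R) (L : R) : 0 < L ->
  (forall t, is_derive t (1 : R) g (dg t)) -> continuous dg ->
  (forall t, L <= `|t| -> g t = 0) -> (forall t, L <= `|t| -> dg t = 0) ->
  (\int[lebesgue_measure]_t (dg t)%:E = 0)%E.
Proof.
move=> L0 D cdg g0 dg0.
have cg : continuous g.
  by move=> t; apply: differentiable_continuous; apply/derivable1_diffP; have [] := D t.
have LL : - L < L by rewrite gtrN.
transitivity (\int[lebesgue_measure]_(t in `[(- L)%R, L]) (dg t)%:E)%E.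
  rewrite [RHS]integral_mkcond; apply: eq_integral => t _; rewrite patchE.
  case: ifPn => //; rewrite notin_setE /= in_itv/= -ler_norml => /negP; rewrite -ltNge => Lt.
  by rewrite dg0// ltW.
rewrite (@continuous_FTC2 _ dg g)//.
- have -> : g L = 0 by rewrite g0// ger0_norm// ltW.
  have -> : g (- L) = 0 by rewrite g0// normrN ger0_norm// ltW.
  by rewrite subee.
- exact: continuous_subspaceT.
- split.
  + by move=> t _; have [] := D t.
  + by apply: cvg_at_right_filter; exact: cg.
  + by apply: cvg_at_left_filter; exact: cg.
- by move=> t _; rewrite derive1E; have [] := D t.
Qed.

(** Induction on the dimension. A derivative in the last direction integrates to 0 on each vertical
    line; one in another direction is a derivative of each horizontal slice, so the last coordinate
    is integrated last. *)
Lemma integral_partial0 n (i : 'I_n) (f : 'rV[R]_n -> R) r :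
  (forall x, derivable f x (delta_mx ord0 i)) -> continuous (partial i f) ->
  (forall x, ~ ccube 0 r x -> f x = 0) ->
  (\int[mu n]_x (partial i f x)%:E = 0)%E.
Proof.
elim: n i f => [[]//|n IH] i f df cf f0.
have p0 x : ~ ccube 0 r x -> partial i f x = 0.
  by move=> nx; apply: (@partial_out _ _ i (ccube 0 r)) => //; exact: closed_ccube.
have pi : (mu n.+1).-integrable setT (EFin \o partial i f).
  have [M M0 HM] := continuous_ccube_bound r cf.
  apply: (@integrable_bounded_supp R n.+1 _ M r) => //; first exact: continuous_measurable_rV.
  move=> x; have [|nx] := pselect (ccube 0 r x); first exact: HM.
  by rewrite p0// normr0.
case: (unliftP ord_max i) => [j|] ij.
- rewrite (integral_rVS_swap pi); apply: integral0_eq => t _.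
  have E y : partial i f (snoc y t) = partial j (fun y => f (snoc y t)) y.
    by rewrite ij; have [_ ->] := @derivable_slice n f y t j ltac:(rewrite -ij; exact: df).
  under eq_integral do rewrite /= E.
  apply: IH => [y||y ny].
  + by have [] := @derivable_slice n f y t j ltac:(rewrite -ij; exact: df).
  + rewrite (_ : partial j _ = partial i f \o (fun y => snoc y t)); last by apply/funext => y; rewrite /= E.
    by move=> y; apply: continuous_comp; [exact: continuous_snocr|exact: cf].
  + apply: f0 => xr; apply: ny => k; have := xr (lift ord_max k).
    by rewrite snoc_lift !mxE.
- rewrite (integral_rVS pi); apply: integral0_eq => y _.
  (* The margin 1 gives a positive length and puts the end points strictly outside the cube,
     whatever the sign of r. *)
  have out t : `|r| + 1 <= `|t| -> ~ ccube 0 r (snoc y t).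
    move=> rt xr; have := xr ord_max; rewrite snoc_max mxE subr0 => tr.
    have := le_trans rt (le_trans tr (ler_norm r)); rewrite gerDl; lra.
  apply: (@integral_derive0 (fun t => f (snoc y t)) _ (`|r| + 1)).
  + by rewrite ltr_wpDl.
  + move=> t; have := @is_derive_line R n.+1 f (snoc y 0) i t.
    rewrite [in X in is_derive _ _ X _](_ : (fun t => f (snoc y 0 + t *: _)) = fun t => f (snoc y t)); last first.
      by apply/funext => s; rewrite [in RHS]snoc_line_max ij.
    by rewrite ij -snoc_line_max; apply; rewrite -ij; exact: df.
  + have cs : continuous (fun t : R => snoc y t).
      move=> t; rewrite (_ : (fun t => _) = vshift (snoc y 0)); first exact: continuous_vshift.
      by apply/funext => s; exact: snoc_vshift.
    by move=> t; apply: (@continuous_comp _ _ _ (snoc y) (partial i f)); [exact: cs|exact: cf].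
  + by move=> t /out; exact: f0.
  + by move=> t /out; exact: p0.
Qed.

End integral_partial.

Section by_parts.
Context {R : realType} {n : nat}.
Local Notation mu := (@lebesgue_rV R n).
Variables (U : set 'rV[R]_n) (eta : 'rV[R]_n -> R).
Hypotheses (oU : open U) (teta : test_function U eta).

(** [h] may be singular on the boundary of U, as powers of x_n are at x_n = 0. Since K is closed and
    inside U, the product is 0 in a neighbourhood of every point outside U. *)
Lemma continuous_mul_supp (K : set 'rV[R]_n) (h g : 'rV[R]_n -> R) : compact K -> K `<=` U ->
  (forall x, U x -> {for x, continuous h}) -> continuous g -> (forall x, ~ K x -> g x = 0) ->
  continuous (fun x => h x * g x).
Proof.
move=> cK KU ch cg g0 x; have [Ux|nUx] := pselect (U x).
  by apply: continuousM; [exact: ch|exact: cg].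
have nK : nbhs x (~` K).
  apply: open_nbhs_nbhs; split; last by move=> /KU.
  by apply: closed_openC; apply: compact_closed => //; exact: norm_hausdorff.
have xK : ~ K x by move=> /KU.
apply: (near_cst_continuous (0 : R)).
by move: nK; apply: filterS => y ny; rewrite g0// mulr0.
Qed.

Lemma continuous_supp_integrable (K : set 'rV[R]_n) (g : 'rV[R]_n -> R) : compact K ->
  continuous g -> (forall x, ~ K x -> g x = 0) -> mu.-integrable setT (EFin \o g).
Proof.
move=> cK cg g0; have [r r0 Kr] := bounded_ccube (compact_bounded cK).
have [M M0 HM] := continuous_ccube_bound r cg.
apply: (@integrable_bounded_supp R n g M r); first exact: continuous_measurable_rV.
  move=> x; have [|nx] := pselect (ccube 0 r x); first exact: HM.
  by rewrite g0 ?normr0// => /Kr.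
by move=> x nx; apply: g0 => /Kr.
Qed.

(** [h * eta] is continuous on the whole space with a continuous i-th derivative and has compact
    support, so the integral of that derivative, the sum of the two terms, is 0. *)
Lemma integral_by_parts (h dh : 'rV[R]_n -> R) i :
  (forall x, U x -> {for x, continuous h}) -> (forall x, U x -> {for x, continuous dh}) ->
  (forall x, U x -> derivable h x (delta_mx ord0 i)) ->
  (forall x, U x -> partial i h x = dh x) ->
  (\int[mu]_(x in U) (h x * partial i eta x)%:E =
   - \int[mu]_(x in U) (dh x * eta x)%:E)%E.
Proof.
move=> ch cdh derh dhE; have [se [K [cK KU K0]]] := teta.
have closedK : closed K by apply: compact_closed => //; exact: norm_hausdorff.
have ce : continuous eta by exact: smooth_continuous.
have cpe : continuous (partial i eta) by apply: smooth_continuous; exact: smooth_partial.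
have pK x : ~ K x -> partial i eta x = 0 by exact: partial_out.
have c1 := continuous_mul_supp cK KU ch cpe pK.
have c2 := continuous_mul_supp cK KU cdh ce K0.
have onU (g : 'rV[R]_n -> R) : (forall x, ~ K x -> g x = 0) ->
    (\int[mu]_(x in U) (g x)%:E = \int[mu]_x (g x)%:E)%E.
  move=> g0; rewrite integral_mkcond; apply: eq_integral => x _; rewrite patchE.
  by case: ifPn => //; rewrite notin_setE => nU; rewrite g0// => /KU.
have z1 x : ~ K x -> h x * partial i eta x = 0 by move=> nK; rewrite pK// mulr0.
have z2 x : ~ K x -> dh x * eta x = 0 by move=> nK; rewrite K0// mulr0.
have i1 := continuous_supp_integrable cK c1 z1.
have i2 := continuous_supp_integrable cK c2 z2.
have nearK x : ~ K x -> \forall y \near x, (cst 0 : 'rV[R]_n -> R) y = h y * eta y.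
  move=> nK; have : nbhs x (~` K) by apply: open_nbhs_nbhs; split => //; exact: closed_openC.
  by apply: filterS => y ny; rewrite K0// mulr0.
have dE x : derivable (fun x => h x * eta x) x (delta_mx ord0 i) /\
    partial i (fun x => h x * eta x) x = h x * partial i eta x + dh x * eta x.
  have [Kx|nKx] := pselect (K x).
    have Ux := KU x Kx; have de : derivable eta x (delta_mx ord0 i) by exact: smooth_derivable.
    split; first by apply: derivableM => //; exact: derh.
    have := deriveM (derh x Ux) de; rewrite /partial => ->.
    by rewrite -/(partial i eta x) -/(partial i h x) dhE// [eta x *: _]mulrC.
  split; first by apply: near_eq_derivable (nearK x nKx) _; exact: derivable_cst.
  rewrite z1// z2// addr0 (partial_out i closedK)// => y ny; by rewrite K0// mulr0.
rewrite !onU//.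
have [r r0 Kr] := bounded_ccube (compact_bounded cK).
have := @integral_partial0 R n i (fun x => h x * eta x) r.
rewrite (_ : partial i _ = fun x => h x * partial i eta x + dh x * eta x); last first.
  by apply/funext => x; have [] := dE x.
move=> H0.
have : (\int[mu]_x (h x * partial i eta x + dh x * eta x)%:E = 0)%E.
  apply: H0.
  - by move=> x; have [] := dE x.
  - by move=> x; exact: (cvgD (c1 x) (c2 x)).
  - by move=> x nx; rewrite K0 ?mulr0// => /Kr.
under eq_integral do rewrite EFinD.
have f2 : (\int[mu]_x (dh x * eta x)%:E)%E \is a fin_num := integrable_fin_num measurableT i2.
by rewrite integralD// => s0; rewrite -[LHS](addeK _ f2) s0 sub0e.
Qed.

End by_parts.

(** * Linearity and uniqueness of weak gradients *)

Section weak_gradient.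
Context {R : realType} {n : nat}.
Variables (D : set 'rV[R]_n.+1) (a : R).
Hypotheses (oD : open D) (bD : bounded_set D) (a1 : -1 < a < 1).
Local Notation U := (upper D).
Local Notation mu := (@lebesgue_rV R n.+1).
Implicit Types (f g u : 'rV[R]_n.+1 -> R) (G : 'rV[R]_n.+1 -> 'rV[R]_n.+1).

Let mU : measurable U := measurable_upper oD.

(** The elementary (f + s g)^2 <= 2 f^2 + 2 s^2 g^2 is enough for finiteness and for convergence to
    0. The shape f + s g serves both for differences and for adding multiples of the profile. *)
Lemma wsqnormD f g s : measurable_fun U f -> measurable_fun U g ->
  (wsqnorm D a (fun x => f x + s * g x)%R <=
   2%:E * wsqnorm D a f + (2 * s ^+ 2)%:E * wsqnorm D a g)%E.
Proof.
move=> mf mg.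
have pge b x : 0 <= xn x `^ b :> R by exact: powR_ge0.
have wge (h : 'rV[R]_n.+1 -> R) x : 0 <= h x ^+ 2 * xn x `^ a by rewrite mulr_ge0 ?sqr_ge0.
rewrite /wsqnorm -ge0_integralZl_EFin//; [|by move=> x _; rewrite lee_fin mulr_ge0 ?sqr_ge0|exact: measurable_wsq].
rewrite -ge0_integralZl_EFin//; [|by move=> x _; rewrite lee_fin mulr_ge0 ?sqr_ge0|exact: measurable_wsq|by rewrite mulr_ge0 ?sqr_ge0].
rewrite -ge0_integralD//; last 4 first.
- by move=> x _; rewrite -EFinM lee_fin mulr_ge0 ?wge.
- by apply: emeasurable_funM => //; exact: measurable_wsq.
- by move=> x _; rewrite -EFinM lee_fin mulr_ge0 ?wge// mulr_ge0 ?sqr_ge0.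
- by apply: emeasurable_funM => //; exact: measurable_wsq.
apply: ge0_le_integral => //.
- by move=> x _; rewrite lee_fin mulr_ge0 ?sqr_ge0.
- by apply: measurable_wsq; apply: measurable_funD => //; exact: measurable_funM.
- by apply: emeasurable_funD; apply: emeasurable_funM => //; exact: measurable_wsq.
move=> x _; rewrite -!EFinM -EFinD lee_fin !mulrA -mulrDl ler_wpM2r//.
have := sqr_ge0 (f x - s * g x); rewrite sqrrB sqrrD exprMn; nra.
Qed.

Lemma wL2D f g s : wL2 D a f -> wL2 D a g -> wL2 D a (fun x => f x + s * g x).
Proof.
move=> [mf ff] [mg gg]; split; first by apply: measurable_funD => //; exact: measurable_funM.
apply: le_lt_trans (wsqnormD s mf mg) _.
have fin (h : 'rV[R]_n.+1 -> R) : (wsqnorm D a h < +oo)%E -> wsqnorm D a h \is a fin_num.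
  by move=> h1; rewrite ge0_fin_numE// wsqnorm_ge0.
by rewrite -(fineK (fin _ ff)) -(fineK (fin _ gg)) -!EFinM -EFinD ltry.
Qed.

Lemma wsqnorm_cvgD (F G : nat -> 'rV[R]_n.+1 -> R) s :
  (forall k, measurable_fun U (F k)) -> (forall k, measurable_fun U (G k)) ->
  wsqnorm D a (F k) @[k --> \oo] --> 0%E -> wsqnorm D a (G k) @[k --> \oo] --> 0%E ->
  wsqnorm D a (fun x => F k x + s * G k x) @[k --> \oo] --> 0%E.
Proof.
move=> mF mG F0 G0.
apply: (squeeze_cvge (f := fun=> 0%E) (h := fun k => 2%:E * wsqnorm D a (F k) + (2 * s ^+ 2)%:E * wsqnorm D a (G k))%E).
- by apply: nearW => k; rewrite wsqnorm_ge0/= wsqnormD.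
- exact: cvg_cst.
- rewrite -[X in _ --> X](adde0 0%E); apply: cvgeD => //.
  + by rewrite -[X in _ --> X](mule0 2%:E); apply: cvgeZl.
  + by rewrite -[X in _ --> X](mule0 (2 * s ^+ 2)%:E); apply: cvgeZl.
Qed.

Lemma eq_wsqnorm f g : ae_eq mu U f g -> measurable_fun U f -> measurable_fun U g ->
  wsqnorm D a f = wsqnorm D a g.
Proof.
move=> fg mf mg; apply: ae_eq_integral => //; [exact: measurable_wsq|exact: measurable_wsq|].
by move: fg; apply: filterS => x H Ux; rewrite /= H.
Qed.

Lemma integrable_mul_bounded f g (M : R) : wL2 D a f -> measurable_fun U g ->
  (forall x, U x -> `|g x| <= M) -> mu.-integrable U (fun x => (f x * g x)%:E).
Proof.
move=> wf mg gM; have fi := wL2_integrable oD bD a1 wf.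
apply: (@le_integrable _ _ _ mu U mU _ (fun x => M%:E * (f x)%:E)%E).
- by apply/measurable_EFinP; apply: measurable_funM => //; case: wf.
- move=> x Ux; rewrite -EFinM !abse_EFin lee_fin !normrM mulrC ler_wpM2r//.
  by apply: le_trans (gM x Ux) _; exact: ler_norm.
- exact: integrableZl.
Qed.

Lemma test_bounded U' eta : test_function U' eta -> exists M : R, forall x : 'rV[R]_n.+1, `|eta x| <= M.
Proof.
move=> [se [K [cK KU K0]]]; have [r r0 Kr] := bounded_ccube (compact_bounded cK).
have [M M0 HM] := continuous_ccube_bound r (smooth_continuous se).
exists M => x; have [|nx] := pselect (ccube 0 r x); first exact: HM.
by rewrite K0 ?normr0// => /Kr.
Qed.

Lemma test_partial U' eta i : test_function U' eta -> test_function U' (@partial R n.+1 i eta).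
Proof.
move=> [se [K [cK KU K0]]]; split; first exact: smooth_partial.
exists K; split => // x nK; apply: (partial_out i _ K0) => //.
by apply: compact_closed => //; exact: norm_hausdorff.
Qed.

Lemma is_weak_gradientD u v G H s : wL2 D a u -> wL2 D a v ->
  is_weak_gradient D a u G -> is_weak_gradient D a v H ->
  is_weak_gradient D a (fun x => u x + s * v x) (fun x => G x + s *: H x).
Proof.
move=> wu wv gG gH i; have [wG pG] := gG i; have [wH pH] := gH i.
rewrite (_ : (fun x => (G x + s *: H x) ord0 i) = fun x => G x ord0 i + s * H x ord0 i); last first.
  by apply/funext => x; rewrite !mxE.
split; first exact: wL2D.
move=> eta teta.
have split_int f g h : wL2 D a f -> wL2 D a g -> test_function U h ->
    (\int[mu]_(x in U) ((f x + s * g x) * h x)%:E =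
     \int[mu]_(x in U) (f x * h x)%:E + s%:E * \int[mu]_(x in U) (g x * h x)%:E)%E /\
    ((\int[mu]_(x in U) (f x * h x)%:E)%E \is a fin_num /\ (\int[mu]_(x in U) (g x * h x)%:E)%E \is a fin_num).
  move=> wf wg th; have [M HM] := test_bounded th.
  have mh : measurable_fun U h by apply: measurable_funTS; exact: measurable_test_function th.
  have fi := integrable_mul_bounded wf mh (fun x _ => HM x).
  have gi := integrable_mul_bounded wg mh (fun x _ => HM x).
  split; last by split; apply: integrable_fin_num.
  under eq_integral do rewrite mulrDl -mulrA EFinD [X in (_ + X)%E]EFinM.
  rewrite integralD//; last exact: integrableZl.
  by rewrite integralZl.
have [-> _] := split_int _ _ _ wu wv (test_partial i teta).
have [-> [f1 f2]] := split_int _ _ _ wG wH teta.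
by rewrite pG// pH// -(fineK f1) -(fineK f2) -!EFinN -!EFinM -!EFinD mulrN opprD.
Qed.

Lemma weak_gradientP u : W12 D a u -> is_weak_gradient D a u (weak_gradient D a u).
Proof. by move=> [_ [G HG]]; exact: getPex (ex_intro _ G HG). Qed.

Lemma W12D u v s : W12 D a u -> W12 D a v -> W12 D a (fun x => u x + s * v x).
Proof.
move=> wu wv; split; first by apply: wL2D; [case: wu|case: wv].
exists (fun x => weak_gradient D a u x + s *: weak_gradient D a v x).
by apply: is_weak_gradientD; [case: wu|case: wv|exact: weak_gradientP|exact: weak_gradientP].
Qed.

(** The difference of two candidates is integrable, since weighted L^2 is contained in L^1 here, and
    integrates to 0 against every test function. *)
Lemma weak_gradient_unique u G H i : is_weak_gradient D a u G -> is_weak_gradient D a u H ->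
  ae_eq mu U (fun x => G x ord0 i) (fun x => H x ord0 i).
Proof.
move=> gG gH; have [wG pG] := gG i; have [wH pH] := gH i.
have wd := wL2D (-1) wG wH.
have : ae_eq mu U (EFin \o (fun x => G x ord0 i + (-1) * H x ord0 i)) (cst 0%E).
  apply: integral_test_function_eq0; [exact: open_upper|exact: (wL2_integrable oD bD a1 wd)|].
  move=> eta teta; have [M HM] := test_bounded teta.
  have mh : measurable_fun U eta by apply: measurable_funTS; exact: measurable_test_function teta.
  have fi := integrable_mul_bounded wG mh (fun x _ => HM x).
  have gi := integrable_mul_bounded wH mh (fun x _ => HM x).
  under eq_integral do rewrite mulrDl mulN1r mulNr EFinB.
  rewrite integralB//.
  have := pG _ teta; rewrite pH// => /eqP; rewrite eqe_opp => /eqP <-.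
  by rewrite subee//; exact: integrable_fin_num.
apply: filterS => x Hx Ux; have := Hx Ux; rewrite /= mulN1r => -[/eqP].
by rewrite subr_eq0 => /eqP.
Qed.

Lemma weak_gradient_ae u G i : W12 D a u -> is_weak_gradient D a u G ->
  ae_eq mu U (fun x => weak_gradient D a u x ord0 i) (fun x => G x ord0 i).
Proof. by move=> wu gG; apply: weak_gradient_unique gG; exact: weak_gradientP. Qed.

Lemma weak_gradientD_ae u v s i : W12 D a u -> W12 D a v ->
  ae_eq mu U (fun x => weak_gradient D a (fun x => u x + s * v x) x ord0 i)
    (fun x => weak_gradient D a u x ord0 i + s * weak_gradient D a v x ord0 i).
Proof.
move=> wu wv.
rewrite (_ : (fun x => weak_gradient D a u x ord0 i + s * weak_gradient D a v x ord0 i) =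
  fun x => (weak_gradient D a u x + s *: weak_gradient D a v x) ord0 i); last first.
  by apply/funext => x; rewrite !mxE.
apply: weak_gradient_ae; first exact: W12D.
by apply: is_weak_gradientD; [case: wu|case: wv|exact: weak_gradientP|exact: weak_gradientP].
Qed.

Lemma weak_gradient_wL2 u i : W12 D a u -> wL2 D a (fun x => weak_gradient D a u x ord0 i).
Proof. by move=> /weak_gradientP/(_ i)[]. Qed.

Lemma smooth_measurable f (A : set 'rV[R]_n.+1) : smooth f -> measurable_fun A f.
Proof. by move=> sf; apply: measurable_funTS; apply: continuous_measurable_rV; exact: smooth_continuous. Qed.

(** [W12_cvg] refers to the gradient chosen by [get]; convergence may be checked against any
    explicit one. *)
Lemma W12_cvgP (phi : nat -> 'rV[R]_n.+1 -> R) u G : W12 D a u -> is_weak_gradient D a u G ->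
  (forall k, smooth (phi k)) ->
  wsqnorm D a (fun x => phi k x - u x) @[k --> \oo] --> 0%E ->
  (forall i, wsqnorm D a (fun x => partial i (phi k) x - G x ord0 i) @[k --> \oo] --> 0%E) ->
  W12_cvg D a phi u.
Proof.
move=> wu gG sp p0 pG; split => // i.
have mG : measurable_fun U (fun x => G x ord0 i) by have [[]] := gG i.
have mw : measurable_fun U (fun x => weak_gradient D a u x ord0 i) by have [] := weak_gradient_wL2 i wu.
have mp k : measurable_fun U (partial i (phi k)) by apply: smooth_measurable; exact: smooth_partial.
rewrite (_ : (fun k => _) = (fun k => wsqnorm D a (fun x => partial i (phi k) x - G x ord0 i))); first exact: pG.
apply/funext => k; apply: eq_wsqnorm; [|exact: measurable_funB|exact: measurable_funB].
by have := weak_gradient_ae i wu gG; apply: filterS => x H Ux; rewrite H.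
Qed.

Lemma smoothD f g s : smooth f -> smooth g -> smooth (fun x : 'rV[R]_n.+1 => f x + s * g x).
Proof.
move=> sf sg; apply: smc_smooth; apply: smc_add; first exact: smc_base.
by apply: smc_mul; [exact: smc_cst|exact: smc_base].
Qed.

Lemma partialD f g s i : smooth f -> smooth g ->
  partial i (fun x : 'rV[R]_n.+1 => f x + s * g x) = fun x => partial i f x + s * partial i g x.
Proof.
move=> sf sg; apply/funext => x; rewrite /partial.
have df : derivable f x (delta_mx ord0 i) by exact: smooth_derivable.
have dg : derivable g x (delta_mx ord0 i) by exact: smooth_derivable.
have dsg : derivable (fun x => s * g x) x (delta_mx ord0 i) by exact: derivableZ.
have := deriveD df dsg => ->; congr (_ + _); exact: deriveZ.
Qed.

Lemma W12_cvgD (phi psi : nat -> 'rV[R]_n.+1 -> R) u v s : W12 D a u -> W12 D a v ->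
  (forall k, smooth (phi k)) -> (forall k, smooth (psi k)) ->
  W12_cvg D a phi u -> W12_cvg D a psi v ->
  W12_cvg D a (fun k x => phi k x + s * psi k x) (fun x => u x + s * v x).
Proof.
move=> wu wv sphi spsi [u0 uG] [v0 vG].
have [mu_ mv_] : measurable_fun U u /\ measurable_fun U v by split; [case: wu => -[]|case: wv => -[]].
have mw w i : W12 D a w -> measurable_fun U (fun x => weak_gradient D a w x ord0 i).
  by move=> ww; have [] := weak_gradient_wL2 i ww.
apply: (W12_cvgP (G := fun x => weak_gradient D a u x + s *: weak_gradient D a v x)).
- exact: W12D.
- by apply: is_weak_gradientD; [case: wu|case: wv|exact: weak_gradientP|exact: weak_gradientP].
- by move=> k; exact: smoothD.
- rewrite (_ : (fun k => _) = (fun k => wsqnorm D a (fun x => (phi k x - u x) + s * (psi k x - v x)))); last first.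
    by apply/funext => k; congr wsqnorm; apply/funext => x; ring.
  by apply: wsqnorm_cvgD => // k; apply: measurable_funB => //; exact: smooth_measurable.
- move=> i; rewrite (_ : (fun k => _) = (fun k => wsqnorm D a (fun x =>
      (partial i (phi k) x - weak_gradient D a u x ord0 i) +
      s * (partial i (psi k) x - weak_gradient D a v x ord0 i)))); last first.
    by apply/funext => k; congr wsqnorm; rewrite partialD//; apply/funext => x; rewrite !mxE; ring.
  by apply: wsqnorm_cvgD => // k; apply: measurable_funB; do ?[exact: mw | apply: smooth_measurable; exact: smooth_partial].
Qed.

End weak_gradient.

(** * Convergence in L^1 *)

Section L1.
Context d (T : measurableType d) (R : realType).
Variables (mu : {measure set T -> \bar R}) (A : set T).
Hypothesis mA : measurable A.
Implicit Types (f g : T -> R) (F G : nat -> T -> R).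

Lemma integrable_measurable f : mu.-integrable A (EFin \o f) -> measurable_fun A f.
Proof. by move=> /measurable_int /measurable_EFinP. Qed.

Lemma integrableDZ f g (s : R) : mu.-integrable A (EFin \o f) -> mu.-integrable A (EFin \o g) ->
  mu.-integrable A (EFin \o (fun x => f x + s * g x)).
Proof.
move=> fi gi; rewrite (_ : EFin \o _ = (EFin \o f) \+ (fun x => s%:E * (EFin \o g) x))%E//.
by apply: integrableD => //; exact: integrableZl.
Qed.

Lemma integralDZ f g (s : R) : mu.-integrable A (EFin \o f) -> mu.-integrable A (EFin \o g) ->
  (\int[mu]_(x in A) (f x + s * g x)%:E =
   \int[mu]_(x in A) (f x)%:E + s%:E * \int[mu]_(x in A) (g x)%:E)%E.
Proof.
move=> fi gi; under eq_integral do rewrite EFinD [X in (_ + X)%E]EFinM.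
rewrite (integralD mA fi); last exact: (integrableZl mA s gi).
by rewrite (integralZl mA gi).
Qed.

Lemma measurable_abs_EFin f : measurable_fun A f -> measurable_fun A (fun x => `|f x|%:E).
Proof. by move=> mf; apply/measurable_EFinP; exact: measurableT_comp. Qed.

Lemma L1_cvgDZ F G (s : R) :
  (forall k, measurable_fun A (F k)) -> (forall k, measurable_fun A (G k)) ->
  (\int[mu]_(x in A) `|F k x|%:E)%E @[k --> \oo] --> 0%E ->
  (\int[mu]_(x in A) `|G k x|%:E)%E @[k --> \oo] --> 0%E ->
  (\int[mu]_(x in A) `|F k x + s * G k x|%:E)%E @[k --> \oo] --> 0%E.
Proof.
move=> mF mG F0 G0.
have mn := measurable_abs_EFin.
apply: (squeeze_cvge (f := fun=> 0%E) (h := fun k =>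
  \int[mu]_(x in A) `|F k x|%:E + `|s|%:E * \int[mu]_(x in A) `|G k x|%:E)%E).
- apply: nearW => k; rewrite integral_ge0/=; last by move=> x _; rewrite lee_fin.
  rewrite -ge0_integralZl_EFin//; last by exact: mn.
  have mF' := mn _ (mF k).
  have mG' : measurable_fun A (fun x => `|s|%:E * `|G k x|%:E)%E.
    by apply: emeasurable_funM => //; exact: mn.
  rewrite -ge0_integralD//.
  apply: ge0_le_integral => //.
  + by apply: mn; apply: measurable_funD => //; exact: measurable_funM.
  + exact: emeasurable_funD.
  + by move=> x _; rewrite -EFinM -EFinD lee_fin -normrM ler_normD.
- exact: cvg_cst.
- rewrite -[X in _ --> X](adde0 0%E); apply: cvgeD => //.
  by rewrite -[X in _ --> X](mule0 `|s|%:E); apply: cvgeZl.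
Qed.

Lemma near_le_cvg0 (u : nat -> \bar R) (e : R) : u k @[k --> \oo] --> 0%E -> 0 < e ->
  \forall k \near \oo, (`|u k| <= e%:E)%E.
Proof.
move=> /fine_cvgP[fu /cvgrPdist_le/(_ e)] H e0.
have := H e0; apply: filterS2 fu => k fk.
by rewrite sub0r normrN -lee_fin -abse_EFin fineK.
Qed.

Lemma L1_cvg_integral F f :
  (forall k, mu.-integrable A (EFin \o F k)) -> mu.-integrable A (EFin \o f) ->
  (\int[mu]_(x in A) `|F k x - f x|%:E)%E @[k --> \oo] --> 0%E ->
  (\int[mu]_(x in A) (F k x)%:E)%E @[k --> \oo] --> (\int[mu]_(x in A) (f x)%:E)%E.
Proof.
move=> Fi fi F0; have ff := integrable_fin_num mA fi.
rewrite -[X in _ --> X](fineK ff); apply: cvge_abs_le => e e0.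
have := near_le_cvg0 F0 e0; apply: filterS => k; rewrite fineK//; apply: le_trans.
rewrite -(integralB mA (Fi k) fi).
have mFf : measurable_fun A (EFin \o (fun x => F k x - f x)).
  by apply/measurable_EFinP; apply: measurable_funB; exact: integrable_measurable.
have := le_abse_integral mu mA mFf; move=> /le_trans; apply.
by rewrite lee_abs.
Qed.

Lemma integrable_cst_fin (M : R) : (mu A < +oo)%E -> mu.-integrable A (EFin \o cst M).
Proof.
move=> Afin; apply/integrableP; split; first exact/measurable_EFinP.
rewrite (eq_integral (cst `|M|%:E))// integral_cst//.
have fA : mu A \is a fin_num by rewrite ge0_fin_numE// measure_ge0.
by rewrite -(fineK fA) -EFinM ltry.
Qed.

Lemma integrable_bounded_fin f (M : R) : (mu A < +oo)%E -> measurable_fun A f ->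
  (forall x, A x -> `|f x| <= M) -> mu.-integrable A (EFin \o f).
Proof.
move=> Afin mf fM; apply: (le_integrable mA _ _ (integrable_cst_fin M Afin)); first exact/measurable_EFinP.
by move=> x Ax; rewrite /= lee_fin (le_trans (fM x Ax))// ler_norm.
Qed.

Lemma ae_imply2 (P Q E : T -> Prop) : (forall x, P x -> Q x -> E x) ->
  {ae mu, forall x, P x} -> {ae mu, forall x, Q x} -> {ae mu, forall x, E x}.
Proof. by move=> PQE; apply: filterS2. Qed.

End L1.

Lemma dominated_cvg_L1 d (T : measurableType d) (R : realType)
    (mu : {measure set T -> \bar R}) (A : set T) (F : nat -> T -> R) (B : R) :
  measurable A -> (forall k, measurable_fun A (F k)) ->
  mu.-integrable A (EFin \o cst B) ->
  (forall k x, A x -> `|F k x| <= B) ->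
  (forall x, A x -> F k x @[k --> \oo] --> 0) ->
  (\int[mu]_(x in A) `|F k x|%:E)%E @[k --> \oo] --> 0%E.
Proof.
move=> mA mF iB FB F0.
have -> : 0%E = (\int[mu]_(x in A) (cst 0%E x))%E by rewrite integral0.
apply: (@dominated_cvg _ _ _ mu A mA _ _ (EFin \o cst B)) => //.
- by move=> k; apply/measurable_EFinP; exact: measurableT_comp.
- move=> x Ax; apply/fine_cvgP; split; first exact: nearW.
  by rewrite /= -[X in _ --> X](@normr0 _ R); apply: cvg_norm; exact: F0.
- by move=> k x Ax; rewrite abse_EFin lee_fin normr_id; exact: FB.
Qed.

(** * The profile x_n^(1-a) and its trace *)

Section profile.
Context {R : realType} {n : nat}.
Variables (D : set 'rV[R]_n.+1) (a : R).
Hypotheses (oD : open D) (bD : bounded_set D) (a1 : -1 < a < 1).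
Local Notation U := (upper D).
Local Notation mu := (@lebesgue_rV R n.+1).
Local Notation S := (upper_frontier D).
Local Notation H := (@surface_measure R n).
Local Notation s := ((1 - a) / 2).
Implicit Types (x : 'rV[R]_n.+1).

Let mU : measurable U := measurable_upper oD.

Definition profile x : R := xn x `^ (1 - a).
Definition profile_grad x : 'rV[R]_n.+1 := ((1 - a) * xn x `^ (- a)) *: delta_mx ord0 ord_max.

Let oma : 0 < 1 - a.
Proof. by case/andP: a1; rewrite subr_gt0. Qed.

Let s0 : 0 < s.
Proof. by rewrite divr_gt0. Qed.

Lemma profile_gradE x i : profile_grad x ord0 i = (1 - a) * xn x `^ (- a) * (ord_max == i)%:R.
Proof. by rewrite !mxE eqxx/= eq_sym. Qed.

Lemma derive_comp_xn (g : R -> R) dg x i : is_derive (xn x) (1 : R) g dg ->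
  derivable (fun x => g (xn x)) x (delta_mx ord0 i) /\
  partial i (fun x => g (xn x)) x = dg * (ord_max == i)%:R.
Proof.
move=> Dg; apply: line_derive.
have E t : xn (x + t *: delta_mx ord0 i) = (ord_max == i)%:R * t + xn x.
  by rewrite /xn !mxE eqxx/= mulrC addrC.
under eq_fun do rewrite E.
have := @is_derive1_comp R g (fun t : R => (ord_max == i)%:R * t + xn x) 0 dg (ord_max == i)%:R.
by rewrite mulr0 add0r => /(_ Dg (is_derive_affine _ _ _)).
Qed.

Let xn_cont : continuous (@xn R n).
Proof. by move=> x; exact: continuous_coor. Qed.

Let cont_powR (b t : R) : 0 < t -> {for t, continuous (fun t : R => t `^ b)}.
Proof.
move=> t0; apply: differentiable_continuous; apply/derivable1_diffP.
by have [] := is_derive1_powR b t0.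
Qed.

Lemma cont_xn_powR b x : U x -> {for x, continuous (fun x => xn x `^ b)}.
Proof.
move=> [_ x0]; apply: (@continuous_comp _ _ _ (@xn R n) (fun t : R => t `^ b)); first exact: xn_cont.
exact: cont_powR.
Qed.

Lemma sq_powR (t b : R) : 0 < t -> (t `^ b) ^+ 2 = t `^ (2 * b).
Proof.
move=> t0; rewrite expr2 -powRD ?mulr2n; first by congr (_ `^ _); ring.
by rewrite (gt_eqF t0) implybT.
Qed.

Lemma powR_sq (t b : R) : 0 <= t -> t `^ (2 * b) = (t ^+ 2) `^ b.
Proof. by move=> t0; rewrite powRrM powR_mulrn. Qed.

(** The square times the weight is a power of exponent 2b + a. For the profile, b = 1 - a gives 2 -
    a; for its gradient, b = - a gives - a, and the condition becomes a < 1. *)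
Lemma wL2_xn_powR (b c : R) : -1 < 2 * b + a -> wL2 D a (fun x => c * xn x `^ b).
Proof.
move=> b1; split.
  by apply: measurable_funTS; apply: measurable_funM => //; exact: measurable_xn_powR.
rewrite /wsqnorm (eq_integral (fun x => (c ^+ 2)%:E * (xn x `^ (2 * b + a))%:E)%E); last first.
  move=> x; rewrite inE => -[_ x0]; rewrite -EFinM exprMn sq_powR// -mulrA powRD//.
  by rewrite (gt_eqF x0) implybT.
have ip := integrable_xn_powR oD bD b1.
rewrite integralZl//; have := integrable_fin_num mU ip => f.
by rewrite -(fineK f) -EFinM ltry.
Qed.

Lemma wL2_bounded (f : 'rV[R]_n.+1 -> R) (M : R) : measurable_fun U f ->
  (forall x, U x -> `|f x| <= M) -> wL2 D a f.
Proof.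
move=> mf fM; split => //.
have am1 : -1 < 2 * 0 + a by rewrite mulr0 add0r; case/andP: a1.
have [_] := wL2_xn_powR M am1; apply: le_lt_trans.
apply: ge0_le_integral => //.
- by move=> x _; rewrite lee_fin mulr_ge0 ?sqr_ge0 ?powR_ge0.
- exact: measurable_wsq.
- by apply: measurable_wsq; apply: measurable_funTS; apply: measurable_funM => //; exact: measurable_xn_powR.
- move=> x Ux; rewrite lee_fin ler_wpM2r ?powR_ge0// powRr0 mulr1.
  rewrite -[X in X <= _]ger0_norm ?sqr_ge0// normrX ler_pXn2r// ?nnegrE//; first exact: fM.
  exact: le_trans (fM x Ux).
Qed.

Lemma profile_wL2 : wL2 D a profile.
Proof.
have b1 : -1 < 2 * (1 - a) + a by case/andP: a1 => h1 h2; lra.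
have := wL2_xn_powR 1 b1; rewrite (_ : (fun x => _) = profile)//.
by apply/funext => x; rewrite mul1r.
Qed.

Let grad_exp : -1 < 2 * (- a) + a.
Proof. by case/andP: a1 => h1 h2; lra. Qed.

Lemma profile_grad_wL2 i : wL2 D a (fun x => profile_grad x ord0 i).
Proof.
have := wL2_xn_powR ((1 - a) * (ord_max == i)%:R) grad_exp.
by rewrite (_ : (fun x => _) = fun x => profile_grad x ord0 i)//; apply/funext => x; rewrite profile_gradE mulrAC.
Qed.

(** Test functions are supported at positive distance from {x_n = 0}, so the classical derivative
    suffices and its possible singularity at x_n = 0 is never seen. *)
Lemma profile_weak_gradient : is_weak_gradient D a profile profile_grad.
Proof.
move=> i; split; first exact: profile_grad_wL2.
move=> eta teta; apply: (@integral_by_parts R n.+1 U eta teta profile (fun x => profile_grad x ord0 i) i).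
- by move=> x; exact: cont_xn_powR.
- move=> x Ux; rewrite (_ : (fun x => _) = fun x => (1 - a) * (ord_max == i)%:R * xn x `^ (- a)); last first.
    by apply/funext => y; rewrite profile_gradE mulrAC.
  by apply: continuousM; [exact: cst_continuous|exact: cont_xn_powR].
- move=> x [_ x0]; by have [] := derive_comp_xn i (is_derive1_powR (1 - a) x0).
- move=> x [_ x0]; have [_ E] := derive_comp_xn i (is_derive1_powR (1 - a) x0).
  by rewrite /profile E profile_gradE; congr (_ * _ `^ _ * _); ring.
Qed.

Lemma profile_W12 : W12 D a profile.
Proof. by split; [exact: profile_wL2|exists profile_grad; exact: profile_weak_gradient]. Qed.

Let hk (k : nat) : R := k.+1%:R^-1.
Let hk0 k : 0 < hk k. Proof. by rewrite invr_gt0. Qed.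
Let hk1 k : hk k <= 1. Proof. by rewrite invf_le1// ler1n. Qed.

(** Traces are defined through functions smooth in the whole space. Here the base of the power is
    positive everywhere, and with s = (1 - a)/2 the limit for x_n > 0 is x_n^(1-a). *)
Definition profile_reg (k : nat) x : R := (x ord0 ord_max ^+ 2 + hk k) `^ s.

Lemma profile_reg_smooth k : smooth (profile_reg k).
Proof. by apply: smc_smooth; exact: smc_pow. Qed.

Let profile_sq x : 0 < xn x -> profile x = (xn x ^+ 2) `^ s.
Proof. by move=> x0; rewrite /profile -powR_sq ?ltW//; congr (_ `^ _); field. Qed.

Let cvg_reg_powR b x : 0 < xn x -> (xn x ^+ 2 + hk k) `^ b @[k --> \oo] --> (xn x ^+ 2) `^ b.
Proof.
move=> x0; have x2 : 0 < xn x ^+ 2 by rewrite exprn_gt0.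
have c : xn x ^+ 2 + hk k @[k --> \oo] --> xn x ^+ 2.
  rewrite -[X in _ --> X]addr0; apply: cvgD; [exact: cvg_cst|exact: cvg_harmonic].
apply: (@cvg_comp _ _ _ (fun k => xn x ^+ 2 + hk k) (fun t : R => t `^ b) _ (nbhs (xn x ^+ 2))); first exact: c.
exact: cont_powR.
Qed.

Lemma cvg_profile_reg x : 0 < xn x -> profile_reg k x - profile x @[k --> \oo] --> 0.
Proof.
move=> x0; rewrite -[X in _ --> X](subrr (profile x)); apply: cvgB; last exact: cvg_cst.
by rewrite profile_sq//; exact: cvg_reg_powR.
Qed.

Lemma profile_bound r x : 0 <= r -> ccube 0 r x -> 0 < xn x ->
  `|profile x| <= (r ^+ 2 + 1) `^ s.
Proof.
move=> r0 xr x0; rewrite ger0_norm ?powR_ge0// profile_sq//.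
have := xr ord_max; rewrite mxE subr0 => /(le_trans (ler_norm _)) xnr.
apply: ge0_ler_powR; rewrite ?nnegrE ?addr_ge0 ?sqr_ge0 ?(ltW s0)//.
by rewrite (le_trans (_ : _ <= r ^+ 2)) ?lerDl// ler_pXn2r// nnegrE ltW.
Qed.

Lemma profile_reg_diff_bound r k x : 0 <= r -> ccube 0 r x -> 0 < xn x ->
  `|profile_reg k x - profile x| <= (r ^+ 2 + 1) `^ s.
Proof.
move=> r0 xr x0.
have := xr ord_max; rewrite mxE subr0 => /(le_trans (ler_norm _)) xnr.
have p0 : 0 <= profile x by rewrite powR_ge0.
have pk : profile x <= profile_reg k x.
  rewrite profile_sq//; apply: ge0_ler_powR; rewrite ?nnegrE ?addr_ge0 ?sqr_ge0 ?(ltW s0)// ?(ltW (hk0 k))//.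
  by rewrite lerDl ltW.
rewrite ger0_norm ?subr_ge0// (le_trans (_ : _ <= profile_reg k x)) ?gerBl//.
apply: ge0_ler_powR; rewrite ?nnegrE ?addr_ge0 ?sqr_ge0 ?(ltW s0)// ?(ltW (hk0 k))//.
by rewrite lerD// ler_pXn2r// nnegrE ltW.
Qed.

Lemma partial_profile_reg k x i : partial i (profile_reg k) x =
  s * (xn x ^+ 2 + hk k) `^ (s - 1) * (2 * xn x) * (ord_max == i)%:R.
Proof. by have [_] := derive_comp_xn i (is_derive_pow s (xn x) (hk0 k)). Qed.

Let profile_grad_sq x : 0 < xn x ->
  (1 - a) * xn x `^ (- a) = s * (xn x ^+ 2) `^ (s - 1) * (2 * xn x).
Proof.
move=> x0; rewrite -powR_sq ?ltW//.
have -> : xn x `^ (- a) = xn x `^ (2 * (s - 1)) * xn x.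
  rewrite -[X in _ = _ * X]powRr1 ?ltW// -powRD ?(gt_eqF x0) ?implybT//.
  by congr (_ `^ _); field.
by field.
Qed.

Lemma cvg_profile_reg_grad x i : 0 < xn x ->
  partial i (profile_reg k) x - profile_grad x ord0 i @[k --> \oo] --> 0.
Proof.
move=> x0; rewrite -[X in _ --> X](subrr (profile_grad x ord0 i)); apply: cvgB; last exact: cvg_cst.
under eq_fun do rewrite partial_profile_reg.
rewrite profile_gradE profile_grad_sq//; apply: cvgM; last exact: cvg_cst.
apply: cvgM; last exact: cvg_cst.
by apply: cvgM; [exact: cvg_cst|exact: cvg_reg_powR].
Qed.

(** The derivative of the regularised profile lies between 0 and that of the profile, so the profile
    gradient itself dominates the difference, uniformly in k. *)
Lemma profile_reg_grad_bound k x i : 0 < xn x ->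
  `|partial i (profile_reg k) x - profile_grad x ord0 i| <= (1 - a) * xn x `^ (- a).
Proof.
move=> x0; rewrite partial_profile_reg profile_gradE -mulrBl normrM.
have g0 : 0 <= (1 - a) * xn x `^ (- a) by rewrite mulr_ge0 ?powR_ge0 ?ltW.
apply: (@le_trans _ _ ((1 - a) * xn x `^ (- a) * 1)); last by rewrite mulr1.
apply: ler_pM => //; last by case: (_ == _); rewrite ?normr1 ?normr0.
have p0 : 0 <= s * (xn x ^+ 2 + hk k) `^ (s - 1) * (2 * xn x).
  by rewrite !mulr_ge0 ?powR_ge0// ltW.
have x2 : 0 < xn x ^+ 2 by rewrite exprn_gt0.
have xh : 0 < xn x ^+ 2 + hk k by rewrite addr_gt0.
have le : s * (xn x ^+ 2 + hk k) `^ (s - 1) * (2 * xn x) <= (1 - a) * xn x `^ (- a).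
  rewrite profile_grad_sq// ler_wpM2r ?mulr_ge0 ?(ltW x0)// ler_wpM2l ?(ltW s0)//.
  (* The exponent s - 1 = - (1 + a)/2 is negative because a > -1, so enlarging the base by [hk k]
     lowers the power. *)
  have [d d0 ->] : exists2 d, 0 <= d & s - 1 = - d.
    by exists (1 - s); [case/andP: a1 => h1 h2; lra|ring].
  rewrite !powRN lef_pV2 ?posrE ?powR_gt0//.
  apply: ge0_ler_powR; rewrite ?nnegrE ?addr_ge0 ?(ltW x2) ?(ltW (hk0 k))//.
  by rewrite lerDl ltW.
by rewrite ler_norml; apply/andP; split; lra.
Qed.

Lemma wsqnorm_dominated (F : nat -> 'rV[R]_n.+1 -> R) (B : 'rV[R]_n.+1 -> R) :
  (forall k, measurable_fun U (F k)) -> wL2 D a B ->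
  (forall k x, U x -> `|F k x| <= B x) ->
  (forall x, U x -> F k x @[k --> \oo] --> 0) ->
  wsqnorm D a (F k) @[k --> \oo] --> 0%E.
Proof.
move=> mF [mB fB] FB F0.
have -> : 0%E = (\int[mu]_(x in U) (cst 0%E x))%E by rewrite integral0.
apply: (@dominated_cvg _ _ _ mu U mU _ _ (fun x => (B x ^+ 2 * xn x `^ a)%:E)) => //.
- by move=> k; exact: measurable_wsq.
- move=> x Ux; apply/fine_cvgP; split; first exact: nearW.
  rewrite /= -[X in _ --> X](mul0r (xn x `^ a)); apply: cvgM; last exact: cvg_cst.
  rewrite -[X in _ --> X](mul0r 0) ; under eq_fun do rewrite expr2.
  by apply: cvgM; exact: F0.
- apply/integrableP; split; first exact: measurable_wsq.
  rewrite (eq_integral (fun x => (B x ^+ 2 * xn x `^ a)%:E)); first exact: fB.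
  by move=> x _; rewrite gee0_abs// lee_fin mulr_ge0 ?sqr_ge0 ?powR_ge0.
- move=> k x Ux; rewrite abse_EFin lee_fin normrM [X in _ * X]ger0_norm ?powR_ge0// ler_wpM2r ?powR_ge0//.
  rewrite normrX ler_pXn2r// ?nnegrE//; first exact: FB.
  exact: le_trans (FB k x Ux).
Qed.

Lemma profile_reg_cvg : W12_cvg D a profile_reg profile.
Proof.
have [r r0 Dr] := bounded_ccube bD.
have mp : measurable_fun U profile by case: profile_wL2.
apply: (W12_cvgP oD bD a1 profile_W12 profile_weak_gradient profile_reg_smooth).
- apply: (@wsqnorm_dominated _ (fun=> (r ^+ 2 + 1) `^ s)).
  + by move=> k; apply: measurable_funB => //; apply: smooth_measurable; exact: profile_reg_smooth.
  + by apply: (@wL2_bounded _ ((r ^+ 2 + 1) `^ s)) => // x _; rewrite ger0_norm// powR_ge0.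
  + by move=> k x [/Dr xr x0]; exact: profile_reg_diff_bound.
  + by move=> x [_ x0]; exact: cvg_profile_reg.
- move=> i; apply: (@wsqnorm_dominated _ (fun x => (1 - a) * xn x `^ (- a))).
  + move=> k; apply: measurable_funB; last by case: (profile_grad_wL2 i).
    by apply: smooth_measurable; apply: smooth_partial; exact: profile_reg_smooth.
  + exact: wL2_xn_powR.
  + by move=> k x [_ x0]; exact: profile_reg_grad_bound.
  + by move=> x [_ x0]; exact: cvg_profile_reg_grad.
Qed.

Hypothesis Sfin : (H S < +oo)%E.

Lemma measurable_surface_S : measurable (S : set (caratheodory_type (@surface_outer R n))).
Proof. exact: (borel_caratheodory (n := n.+1) n (measurable_upper_frontier D)). Qed.

Lemma surface_measurable_smooth (f : 'rV[R]_n.+1 -> R) : smooth f ->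
  measurable_fun (S : set (caratheodory_type (@surface_outer R n))) f.
Proof.
move=> sf; have := @surface_measurable_fun R n _ R f (smooth_measurable sf).
by move=> mf; exact: (measurable_funTS mf).
Qed.

Lemma thin_fin : (@lebesgue_rV R n (thin D) < +oo)%E.
Proof.
have [r r0 Dr] := bounded_ccube bD.
apply: (@le_lt_trans _ _ (@lebesgue_rV R n (ccube 0 r))).
  apply: le_measure; rewrite ?inE; [exact: measurable_thin|exact: measurable_ccube|].
  by move=> y /Dr yr j; have := yr (lift ord_max j); rewrite snoc_lift !mxE.
by rewrite lebesgue_ccube// ltry.
Qed.

Lemma profile_snoc0 (y : 'rV[R]_n) : profile (snoc y 0) = 0.
Proof. by rewrite /profile xn_snoc powR0// gt_eqF. Qed.

(** On the upper frontier the profile is bounded and the surface measure finite, so dominated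
    convergence applies. *)
Lemma profile_trace : is_trace D a profile profile.
Proof.
have [r r0 Dr] := bounded_ccube bD.
have clDr : closure D `<=` ccube 0 r.
  by move=> x /(closure_subset Dr); exact: closed_ccube.
have Sr x : S x -> ccube 0 r x /\ 0 < xn x by move=> [[/clDr]].
have mS := measurable_surface_S.
pose B := (r ^+ 2 + 1) `^ s.
have mp : measurable_fun (S : set (caratheodory_type (@surface_outer R n))) profile.
  have : measurable_fun setT profile by exact: measurable_xn_powR.
  by move=> /(@surface_measurable_fun R n _ R) mf; exact: (measurable_funTS mf).
have ip : H.-integrable S (EFin \o profile).
  apply: (le_integrable mS _ _ (integrable_cst_fin mS B Sfin)); first exact/measurable_EFinP.
  move=> x /Sr[xr x0]; rewrite /= lee_fin [X in _ <= X]ger0_norm ?powR_ge0//.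
  exact: profile_bound.
split => //.
  under eq_fun do rewrite profile_snoc0; exact: integrable0.
exists profile_reg; split; [exact: profile_reg_smooth|exact: profile_reg_cvg| |].
- apply: (dominated_cvg_L1 mS _ (integrable_cst_fin mS B Sfin)).
  + move=> k; apply: measurable_funB; last exact: mp.
    by apply: surface_measurable_smooth; exact: profile_reg_smooth.
  + by move=> k x /Sr[xr x0]; exact: profile_reg_diff_bound.
  + by move=> x /Sr[xr x0]; exact: cvg_profile_reg.
- have fT : @lebesgue_rV R n (thin D) \is a fin_num by rewrite ge0_fin_numE ?thin_fin.
  (* On x_n = 0 the profile vanishes and its regularisation is the constant [hk k] to the power s,
     which tends to 0. *)
  have E k : (\int[@lebesgue_rV R n]_(y in thin D) `|profile_reg k (snoc y 0) - profile (snoc y 0)|%:E =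
      (hk k `^ s * fine (@lebesgue_rV R n (thin D)))%:E)%E.
    rewrite (eq_integral (cst (hk k `^ s)%:E)); last first.
      move=> y _; rewrite profile_snoc0 subr0 /profile_reg snoc_max expr0n/= add0r ger0_norm//.
      exact: powR_ge0.
    by rewrite integral_cst ?EFinM ?fineK//; exact: measurable_thin.
  under eq_fun do rewrite E.
  apply/fine_cvgP; split; first exact: nearW.
  rewrite /= -[X in _ --> X](mul0r (fine (@lebesgue_rV R n (thin D)))).
  apply: cvgM; last exact: cvg_cst.
  apply/cvgrPdist_le => e e0; have ee : 0 < e `^ (s^-1) by exact: powR_gt0.
  near=> k.
  rewrite sub0r normrN ger0_norm ?powR_ge0//.
  have : hk k < e `^ (s^-1) by near: k; exact: (near_infty_natSinv_lt (PosNum ee)).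
  move=> /ltW hke; apply: (@le_trans _ _ ((e `^ (s^-1)) `^ s)).
    by apply: ge0_ler_powR; rewrite ?nnegrE ?powR_ge0 ?(ltW s0) ?(ltW (hk0 k)).
  by rewrite -powRrM mulVf ?gt_eqF// powRr1// ltW.
Unshelve. all: end_near. Qed.

End profile.

(** * Traces and fluxes *)

Section trace_linear.
Context {R : realType} {n : nat}.
Variables (D : set 'rV[R]_n.+1) (a : R).
Hypotheses (oD : open D) (bD : bounded_set D) (a1 : -1 < a < 1).
Local Notation U := (upper D).
Local Notation mu := (@lebesgue_rV R n.+1).
Local Notation S := (upper_frontier D).
Local Notation H := (@surface_measure R n).
Local Notation nu := (@lebesgue_rV R n).
Implicit Types (u v w f T : 'rV[R]_n.+1 -> R).

Let mU : measurable U := measurable_upper oD.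
Let mS := measurable_surface_S D.
Let mT : measurable (thin D) := measurable_thin oD.

Lemma measurable_smooth_thin f : smooth f -> measurable_fun (thin D) (fun y => f (snoc y 0)).
Proof.
move=> sf; apply: measurable_funTS.
apply: (measurableT_comp (f := f)); last exact: measurable_snocr.
exact: smooth_measurable.
Qed.

Lemma is_traceD u v T1 T2 s : W12 D a u -> W12 D a v ->
  is_trace D a u T1 -> is_trace D a v T2 ->
  is_trace D a (fun x => u x + s * v x) (fun x => T1 x + s * T2 x).
Proof.
move=> wu wv [iS1 iT1 [phi [sphi cphi pS pT]]] [iS2 iT2 [psi [spsi cpsi qS qT]]].
split; [exact: (integrableDZ mS s iS1 iS2)|exact: (integrableDZ mT s iT1 iT2)|].
exists (fun k x => phi k x + s * psi k x); split.
- by move=> k; exact: smoothD.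
- exact: W12_cvgD.
- rewrite (_ : (fun k => _) = (fun k => \int[H]_(x in S)
      `|(phi k x - T1 x) + s * (psi k x - T2 x)|%:E)%E); last first.
    by apply/funext => k; apply: eq_integral => x _; congr (`| _ |%:E); ring.
  apply: (L1_cvgDZ mS s _ _ pS qS) => k; apply: measurable_funB.
  + exact: surface_measurable_smooth.
  + exact: (integrable_measurable iS1).
  + exact: surface_measurable_smooth.
  + exact: (integrable_measurable iS2).
- rewrite (_ : (fun k => _) = (fun k => \int[nu]_(y in thin D)
      `|(phi k (snoc y 0) - T1 (snoc y 0)) + s * (psi k (snoc y 0) - T2 (snoc y 0))|%:E)%E); last first.
    by apply/funext => k; apply: eq_integral => x _; congr (`| _ |%:E); ring.
  apply: (L1_cvgDZ mT s (F := fun k y => phi k (snoc y 0) - T1 (snoc y 0))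
    (G := fun k y => psi k (snoc y 0) - T2 (snoc y 0)) _ _ pT qT) => k; apply: measurable_funB.
  + exact: measurable_smooth_thin.
  + exact: (integrable_measurable iT1).
  + exact: measurable_smooth_thin.
  + exact: (integrable_measurable iT2).
Qed.

Hypothesis reg : trace_regular D a.

Let Sfin : (H S < +oo)%E. Proof. by case: reg. Qed.

Let flat0 : hausdorff n (frontier D `&` [set x | xn x = 0]) = 0%E. Proof. by case: reg. Qed.

Lemma traceP u : W12 D a u -> is_trace D a u (trace D a u).
Proof. by move=> wu; have [_ _ /(_ u wu)[T [HT _]]] := reg; exact: getPex (ex_intro _ T HT). Qed.

Definition eq_on_thin T1 T2 := {ae nu, forall y, thin D y -> T1 (snoc y 0) = T2 (snoc y 0)}.

Lemma trace_unique u T : W12 D a u -> is_trace D a u T ->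
  eq_on_upper_frontier D (trace D a u) T /\ eq_on_thin (trace D a u) T.
Proof.
move=> wu HT; have [_ _ /(_ u wu)[T0 [_ H0]]] := reg.
have [h1 h2] := H0 _ (traceP wu); have [h3 h4] := H0 _ HT; split.
- by apply: (ae_imply2 _ h1 h3) => x e1 e2 Sx; rewrite -e1// e2.
- by apply: (ae_imply2 _ h2 h4) => x e1 e2 Sx; rewrite -e1// e2.
Qed.

Lemma traceD u v s : W12 D a u -> W12 D a v ->
  let T x := trace D a u x + s * trace D a v x in
  eq_on_upper_frontier D (trace D a (fun x => u x + s * v x)) T /\
  eq_on_thin (trace D a (fun x => u x + s * v x)) T.
Proof.
by move=> wu wv; apply: trace_unique; [exact: W12D|apply: is_traceD => //; exact: traceP].
Qed.

Lemma trace_profileD u s : W12 D a u ->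
  let T x := trace D a u x + s * profile a x in
  eq_on_upper_frontier D (trace D a (fun x => u x + s * profile a x)) T /\
  eq_on_thin (trace D a (fun x => u x + s * profile a x)) T.
Proof.
move=> wu; have wp := profile_W12 oD bD a1; apply: trace_unique; first exact: W12D.
by apply: is_traceD => //; [exact: traceP|exact: profile_trace].
Qed.

Lemma trace_profileD_thin u s : W12 D a u ->
  eq_on_thin (trace D a (fun x => u x + s * profile a x)) (trace D a u).
Proof.
move=> /(trace_profileD s)[_]; apply: filterS => y Hy /Hy ->.
by rewrite profile_snoc0// mulr0 addr0.
Qed.

Lemma above_on_thin_eq (psi : 'rV[R]_n -> R) u v :
  eq_on_thin (trace D a u) (trace D a v) -> above_on_thin D a psi v -> above_on_thin D a psi u.
Proof.
move=> e v0; apply: (ae_imply2 _ e v0) => y e1 e2 Ty.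
by have -> := e1 Ty; exact: e2 Ty.
Qed.

(** Up to the factor 1 - a this is the weighted inner product of the gradients of u and of the
    profile: the weight x_n^a cancels x_n^(-a). *)
Definition flux u : \bar R := (\int[mu]_(x in U) (weak_gradient D a u x ord0 ord_max)%:E)%E.
Definition thin_integral T : \bar R := (\int[nu]_(y in thin D) (T (snoc y 0))%:E)%E.

Lemma flux_integrable u : W12 D a u ->
  mu.-integrable U (EFin \o (fun x => weak_gradient D a u x ord0 ord_max)).
Proof. by move=> wu; exact: (wL2_integrable oD bD a1 (weak_gradient_wL2 ord_max wu)). Qed.

Lemma thin_integrable u : W12 D a u ->
  nu.-integrable (thin D) (EFin \o (fun y => trace D a u (snoc y 0))).
Proof. by move=> /traceP[]. Qed.

Lemma flux_fin u : W12 D a u -> flux u \is a fin_num.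
Proof. by move=> wu; apply: integrable_fin_num => //; exact: flux_integrable. Qed.

Lemma thin_integral_fin u : W12 D a u -> thin_integral (trace D a u) \is a fin_num.
Proof. by move=> wu; apply: integrable_fin_num => //; exact: thin_integrable. Qed.

Lemma fluxD u v s : W12 D a u -> W12 D a v ->
  flux (fun x => u x + s * v x) = (flux u + s%:E * flux v)%E.
Proof.
move=> wu wv; have wuv := W12D oD bD a1 s wu wv.
rewrite /flux -(integralDZ mU s (flux_integrable wu) (flux_integrable wv)).
apply: ae_eq_integral => //.
- exact: measurable_int (flux_integrable wuv).
- exact: measurable_int (integrableDZ mU s (flux_integrable wu) (flux_integrable wv)).
- have := weak_gradientD_ae oD bD a1 s ord_max wu wv.
  by apply: filterS => x Hx Ux; rewrite /= Hx.
Qed.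

Lemma thin_integral_ae T1 T2 : nu.-integrable (thin D) (EFin \o (fun y => T1 (snoc y 0))) ->
  nu.-integrable (thin D) (EFin \o (fun y => T2 (snoc y 0))) ->
  eq_on_thin T1 T2 -> thin_integral T1 = thin_integral T2.
Proof.
move=> i1 i2 e; apply: ae_eq_integral => //; [exact: measurable_int i1|exact: measurable_int i2|].
by apply: filterS e => y Hy Ty; rewrite /= Hy.
Qed.

Lemma thin_integralD u v s : W12 D a u -> W12 D a v ->
  thin_integral (trace D a (fun x => u x + s * v x)) =
  (thin_integral (trace D a u) + s%:E * thin_integral (trace D a v))%E.
Proof.
move=> wu wv; have wuv := W12D oD bD a1 s wu wv.
rewrite /thin_integral -(integralDZ mT s (thin_integrable wu) (thin_integrable wv)).
apply: (thin_integral_ae (T2 := fun x => trace D a u x + s * trace D a v x)).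
- exact: thin_integrable.
- exact: (integrableDZ mT s (thin_integrable wu) (thin_integrable wv)).
- by have [] := traceD s wu wv.
Qed.

Lemma thin_integral_profileD u s : W12 D a u ->
  thin_integral (trace D a (fun x => u x + s * profile a x)) = thin_integral (trace D a u).
Proof.
move=> wu; have wp := W12D oD bD a1 s wu (profile_W12 oD bD a1).
by apply: thin_integral_ae; [exact: thin_integrable|exact: thin_integrable|exact: trace_profileD_thin].
Qed.

Lemma smooth_partial_integrable f : smooth f -> mu.-integrable U (EFin \o partial ord_max f).
Proof.
move=> sf; have sp := smooth_partial ord_max sf.
have [r r0 Dr] := bounded_ccube bD.
have [M M0 HM] := continuous_ccube_bound r (smooth_continuous sp).
apply: (wL2_integrable oD bD a1); apply: (wL2_bounded oD bD a1 (M := M)); first exact: smooth_measurable.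
by move=> x [/Dr Dx _]; exact: HM.
Qed.

Lemma smooth_thin_integrable f : smooth f ->
  nu.-integrable (thin D) (EFin \o (fun y => f (snoc y 0))).
Proof.
move=> sf; have [r r0 Dr] := bounded_ccube bD.
have [M M0 HM] := continuous_ccube_bound r (smooth_continuous sf).
apply: (integrable_bounded_fin mT (M := M)); [exact: thin_fin|exact: measurable_smooth_thin|].
by move=> y /Dr Dy; exact: HM.
Qed.

Lemma smooth_divergence_bound f : smooth f ->
  (`|\int[mu]_(x in U) (partial ord_max f x)%:E + \int[nu]_(y in thin D) (f (snoc y 0))%:E|
   <= (3 * 2 ^+ n)%:E * \int[H]_(x in S) `|f x|%:E)%E.
Proof.
move=> sf; have sp := smooth_partial ord_max sf.
have [r r0 Dr] := bounded_ccube bD.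
have [M M0 HM] := continuous_ccube_bound (r + 1) (smooth_continuous sp).
have [N N0 HN] := continuous_ccube_bound (r + 1) (smooth_continuous sf).
apply: (divergence_bound oD Dr _ _ HN HM M0 N0 _ flat0 Sfin).
- exact: smooth_continuous.
- by move=> x; exact: smooth_derivable.
- exact: smooth_continuous.
Qed.

(** The smooth approximations that define the trace of [f] need not vanish on the upper frontier,
    but their L^1 norm there tends to 0, and it controls the defect in the divergence identity. *)
Lemma flux_thin_integral f : W12 D a f -> eq_on_upper_frontier D (trace D a f) (fun=> 0) ->
  (flux f + thin_integral (trace D a f) = 0)%E.
Proof.
move=> wf f0; have [iS iT [phi [sphi [p0 pG] pS pT]]] := traceP wf.
have cA : (\int[mu]_(x in U) (partial ord_max (phi k) x)%:E)%E @[k --> \oo] --> flux f.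
  apply: (L1_cvg_integral mU _ (flux_integrable wf)).
    by move=> k; exact: smooth_partial_integrable.
  apply: (wsqnorm_cvg_L1 oD bD a1 _ (pG ord_max)) => k; apply: measurable_funB.
    by apply: smooth_measurable; exact: smooth_partial.
  exact: (integrable_measurable (flux_integrable wf)).
have cB : (\int[nu]_(y in thin D) (phi k (snoc y 0))%:E)%E @[k --> \oo] --> thin_integral (trace D a f).
  apply: (L1_cvg_integral mT _ (thin_integrable wf) pT) => k; exact: smooth_thin_integrable.
have cC : (\int[H]_(x in S) `|phi k x|%:E)%E @[k --> \oo] --> 0%E.
  rewrite (_ : (fun k => _) = (fun k => \int[H]_(x in S) `|phi k x - trace D a f x|%:E)%E) //.
  apply/funext => k; have ms := surface_measurable_smooth (D := D) (sphi k).
  apply: ae_eq_integral; [exact: mS| | |].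
  - exact: measurable_abs_EFin ms.
  - by apply: measurable_abs_EFin; apply: measurable_funB; [exact: ms|exact: (integrable_measurable iS)].
  - by apply: (ae_imply2 _ f0 f0) => x e _ Sx; rewrite e// subr0.
have fAB : (flux f +? thin_integral (trace D a f))%E.
  by apply: fin_num_adde_defl; exact: thin_integral_fin.
have cAB := cvgeD fAB cA cB.
(* The same sequence is given a second limit, 0, by the divergence bound; uniqueness of limits
   concludes. *)
have cAB0 : (\int[mu]_(x in U) (partial ord_max (phi k) x)%:E +
    \int[nu]_(y in thin D) (phi k (snoc y 0))%:E)%E @[k --> \oo] --> 0%E.
  apply: cvge_abs_le => e e0; set C : R := 3 * 2 ^+ n.
  have C0 : 0 < C by rewrite mulr_gt0// exprn_gt0.
  have := near_le_cvg0 cC (divr_gt0 e0 C0); apply: filterS => k H1; rewrite sube0.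
  apply: le_trans (smooth_divergence_bound (sphi k)) _.
  rewrite -/C (_ : e%:E = (C%:E * (e / C)%:E)%E); last first.
    by rewrite -EFinM mulrCA divff ?mulr1// gt_eqF.
  by rewrite lee_wpmul2l ?lee_fin ?(ltW C0)//; apply: le_trans H1; exact: lee_abs.
exact: etrans (esym (cvg_lim (@ereal_hausdorff R) (cAB _))) (cvg_lim (@ereal_hausdorff R) cAB0).
Qed.

End trace_linear.

(** * Energies *)

Section energy.
Context {R : realType} {n : nat}.
Variables (D : set 'rV[R]_n.+1) (a : R).
Hypotheses (oD : open D) (bD : bounded_set D) (a1 : -1 < a < 1).
Local Notation U := (upper D).
Local Notation mu := (@lebesgue_rV R n.+1).
Implicit Types (u v w : 'rV[R]_n.+1 -> R).

Let mU : measurable U := measurable_upper oD.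
Let mT : measurable (thin D) := measurable_thin oD.

Lemma energy_integrable u : W12 D a u -> mu.-integrable U
  (EFin \o (fun x => (\sum_i weak_gradient D a u x ord0 i ^+ 2) * xn x `^ a)).
Proof.
move=> wu; rewrite (_ : EFin \o _ = fun x =>
  (\sum_i (weak_gradient D a u x ord0 i ^+ 2 * xn x `^ a)%:E)%E); last first.
  by apply/funext => x; rewrite /= mulr_suml sumEFin.
apply: integrable_sum => // i _; have [mi fi] := weak_gradient_wL2 i wu.
apply/integrableP; split; first exact: measurable_wsq.
rewrite (eq_integral (fun x => (weak_gradient D a u x ord0 i ^+ 2 * xn x `^ a)%:E)); first exact: fi.
by move=> x _; rewrite gee0_abs// lee_fin mulr_ge0 ?sqr_ge0 ?powR_ge0.
Qed.

Lemma Ea_fin u : W12 D a u -> Ea D a u \is a fin_num.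
Proof. by move=> wu; apply: integrable_fin_num => //; exact: energy_integrable. Qed.

Lemma sum_sqrD_delta (w : 'I_n.+1 -> R) b :
  \sum_i (w i + b * (ord_max == i)%:R) ^+ 2 =
  \sum_i w i ^+ 2 + (2 * b * w ord_max + b ^+ 2).
Proof.
have -> : 2 * b * w ord_max + b ^+ 2 = \sum_i (ord_max == i)%:R * (2 * b * w i + b ^+ 2).
  rewrite (bigD1 ord_max)//= eqxx mul1r big1 ?addr0// => i.
  by rewrite eq_sym => /negbTE ->; rewrite mul0r.
by rewrite -big_split/=; apply: eq_bigr => i _; case: (_ == _) => /=; ring.
Qed.

Lemma xn_powN_integrable : mu.-integrable U (EFin \o (fun x => xn x `^ (- a))).
Proof. by apply: integrable_xn_powR => //; case/andP: a1 => h1 h2; lra. Qed.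

(** The profile changes only the last component of the gradient, by c (1 - a) x_n^(-a), almost
    everywhere. The last term depends on c and the domain but not on u, so it drops out when two
    functions are compared. *)
Lemma Ea_profileD u c : W12 D a u ->
  Ea D a (fun x => u x + c * profile a x) =
  (Ea D a u + (2 * (c * (1 - a)))%:E * flux D a u +
   ((c * (1 - a)) ^+ 2)%:E * \int[mu]_(x in U) (xn x `^ (- a))%:E)%E.
Proof.
move=> wu; have wp := profile_W12 oD bD a1; have wup := W12D oD bD a1 c wu wp.
have fi := flux_integrable oD bD a1 wu; have ei := energy_integrable wu.
have efi := integrableDZ mU (2 * (c * (1 - a))) ei fi.
rewrite /flux -(integralDZ mU _ ei fi) -(integralDZ mU _ efi xn_powN_integrable).
apply: ae_eq_integral => //.
- exact: measurable_int (energy_integrable wup).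
- exact: measurable_int (integrableDZ mU ((c * (1 - a)) ^+ 2) efi xn_powN_integrable).
have H1 : {ae mu, forall x, forall i, U x ->
    weak_gradient D a (fun x => u x + c * profile a x) x ord0 i =
    weak_gradient D a u x ord0 i + c * (1 - a) * xn x `^ (- a) * (ord_max == i)%:R}.
  apply: filter_forall => i.
  have h1 := weak_gradientD_ae oD bD a1 c i wu wp.
  have h2 := weak_gradient_ae oD bD a1 i wp (profile_weak_gradient oD bD a1).
  apply: (ae_imply2 _ h1 h2) => x e1 e2 Ux.
  by rewrite e1// e2// profile_gradE; ring.
apply: filterS H1 => x Hx Ux; congr EFin; have [_ x0] := Ux.
rewrite (eq_bigr _ (fun i _ => congr1 (fun t => t ^+ 2) (Hx i Ux))) sum_sqrD_delta.
(* One such product removes the weight from the cross term; in the squared term it leaves a single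
   factor x_n^(-a). *)
have pp : xn x `^ (- a) * xn x `^ a = 1.
  by rewrite powRN mulVf// gt_eqF// powR_gt0.
set p := xn x `^ (- a) in pp *; set q := xn x `^ a in pp *.
rewrite mulrDl -addrA; congr (_ + _).
rewrite (_ : _ * q = 2 * (c * (1 - a)) * weak_gradient D a u x ord0 ord_max * (p * q) +
  (c * (1 - a)) ^+ 2 * p * (p * q)); last by ring.
by rewrite pp !mulr1.
Qed.

Hypothesis reg : trace_regular D a.

(** With a nonnegative trace on D' the positive part is the trace itself and the negative part is 0,
    so the boundary term becomes linear in the trace. *)
Lemma Ja_above lp lm u : W12 D a u -> above_on_thin D a (fun=> 0) u ->
  Ja D a lp lm u = (Ea D a u + (2 * lp)%:E * thin_integral D (trace D a u))%E.
Proof.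
move=> wu u0; rewrite /Ja; congr (_ + _)%E; rewrite EFinM -muleA; congr (_ * _)%E.
have ti := thin_integrable reg wu.
have mt := integrable_measurable ti.
rewrite /thin_integral -(integralZl mT ti); apply: ae_eq_integral => //.
- apply/measurable_EFinP; apply: measurable_funD; apply: measurable_funM => //.
  + exact: measurable_maxr.
  + by apply: measurable_maxr => //; exact: measurableT_comp.
- by apply: measurable_funeM; exact: measurable_int ti.
- apply: filterS u0 => y Hy Ty; have t0 := Hy Ty.
  by rewrite (max_idPl t0) (max_idPr _) ?oppr_le0// mulr0 addr0 EFinM.
Qed.

End energy.

(** The algebra of the conclusion, moved from extended to real numbers. The K terms cancel, and I +
    T has the same value for v and w, so the inequality between the J_a energies loses everything
    but [Ev] and [Ew]. *)
Lemma energy_comparison (R : realDomainType) (L : R) (Eu Ev Ew Ew' Iv Iw Tu Tv Tw Tw' K : \bar R) :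
  Ev \is a fin_num -> Ew \is a fin_num -> Iv \is a fin_num -> Iw \is a fin_num ->
  Tv \is a fin_num -> Tw \is a fin_num -> K \is a fin_num ->
  (Eu = Ev + (2 * L)%:E * Iv + (L ^+ 2)%:E * K)%E ->
  (Ew' = Ew + (2 * L)%:E * Iw + (L ^+ 2)%:E * K)%E ->
  Tu = Tv -> Tw' = Tw ->
  (Iw + (-1)%:E * Iv + (Tw + (-1)%:E * Tv) = 0)%E ->
  (Eu + (2 * L)%:E * Tu <= Ew' + (2 * L)%:E * Tw')%E -> (Ev <= Ew)%E.
Proof.
case: Ev => // ev; case: Ew => // ew; case: Iv => // iv; case: Iw => // iw.
case: Tv => // tv; case: Tw => // tw; case: K => // k _ _ _ _ _ _ _ -> -> -> ->.
rewrite -!EFinM -!EFinD !lee_fin => -[I].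
have -> : tw = iv - iw + tv by lra.
nra.
Qed.

Theorem proposition1p1 (R : realType) (n : nat) (D : set 'rV[R]_n.+1)
    (a lambdap lambdam : R) (g u : 'rV[R]_n.+1 -> R)
    (hD : bounded_domain D)
    (ha : -1 < a < 1) (hlp : 0 < lambdap) (hlm : 0 < lambdam)
    (hreg : trace_regular D a)
    (hu : minimizer (Ja D a lambdap lambdam)
            [set w | W12 D a w /\ has_boundary_values D a g w] u)
    (hu0 : above_on_thin D a (fun=> 0) u) :
  let c := lambdap / (1 - a) in
  let h := fun x => g x - c * xn x `^ (1 - a) in
  let phi : 'rV[R]_n -> R := fun=> 0 in
  let v := fun x => u x - c * xn x `^ (1 - a) in
  minimizer (Ea D a)
    [set w | [/\ W12 D a w, has_boundary_values D a h w &
                 above_on_thin D a phi w]] v.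
Proof.
move=> c h phi v; have [_ oD _ bD] := hD.
have [[wu gu] umin] := hu.
have wp := profile_W12 oD bD ha.
have vE : v = fun x => u x + (- c) * profile a x by apply/funext => x; rewrite mulNr.
have uE : u = fun x => v x + c * profile a x by apply/funext => x; rewrite /v subrK.
have cE : c * (1 - a) = lambdap.
  by rewrite /c divfK// subr_eq0; case/andP: ha => _ /gt_eqF ->.
have wv : W12 D a v by rewrite vE; exact: W12D.
have hv : has_boundary_values D a h v.
  have [e _] := trace_profileD oD bD ha hreg (- c) wu.
  by rewrite vE; apply: (ae_imply2 _ e gu) => x e1 e2 Sx; rewrite (e1 Sx) (e2 Sx) mulNr.
have tv := trace_profileD_thin oD bD ha hreg (- c) wu.
split.
  by split; [exact: wv|exact: hv|rewrite vE; exact: (above_on_thin_eq tv hu0)].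
move=> w [ww hw w0].
(* The profile restores the boundary values g and leaves the trace on D' unchanged, so [w'] competes
   with [u] and its energy has no lambda_- part. *)
pose w' x := w x + c * profile a x.
have ww' : W12 D a w' by exact: W12D.
have gw' : has_boundary_values D a g w'.
  have [e _] := trace_profileD oD bD ha hreg c ww.
  by apply: (ae_imply2 _ e hw) => x e1 e2 Sx; rewrite (e1 Sx) (e2 Sx) /h subrK.
have w'0 : above_on_thin D a (fun=> 0) w'.
  exact: (above_on_thin_eq (trace_profileD_thin oD bD ha hreg c ww) w0).
(* The difference w - v has zero trace on the upper frontier, since both functions have boundary
   values [h]; the flux identity is applied to it. *)
have wf := W12D oD bD ha (-1) ww wv.
have f0 : eq_on_upper_frontier D (trace D a (fun x => w x + (-1) * v x)) (fun=> 0).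
  have [e _] := traceD oD bD ha hreg (-1) ww wv.
  have hwv : {ae (@surface_measure R n), forall x, upper_frontier D x -> trace D a w x = trace D a v x}.
    by apply: (ae_imply2 _ hw hv) => x e1 e2 Sx; rewrite (e1 Sx) (e2 Sx).
  by apply: (ae_imply2 _ e hwv) => x e1 e2 Sx; rewrite (e1 Sx) (e2 Sx) mulN1r subrr.
have I0 := flux_thin_integral oD bD ha hreg wf f0.
rewrite (fluxD oD bD ha (-1) ww wv) (thin_integralD oD bD ha hreg (-1) ww wv) in I0.
have Juw := umin w' (conj ww' gw').
rewrite (Ja_above oD hreg _ _ wu hu0) (Ja_above oD hreg _ _ ww' w'0) in Juw.
have Eu := Ea_profileD oD bD ha c wv; rewrite -uE cE in Eu.
have Ew := Ea_profileD oD bD ha c ww; rewrite cE in Ew.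
have Tv : thin_integral D (trace D a v) = thin_integral D (trace D a u).
  by rewrite vE; exact: thin_integral_profileD.
have Tw := thin_integral_profileD oD bD ha hreg c ww.
exact: (energy_comparison (Ea_fin oD wv) (Ea_fin oD ww) (flux_fin oD bD ha wv)
  (flux_fin oD bD ha ww) (thin_integral_fin oD hreg wv) (thin_integral_fin oD hreg ww)
  (integrable_fin_num (measurable_upper oD) (xn_powN_integrable oD bD ha)) Eu Ew (esym Tv) Tw I0 Juw).
Qed.
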